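(* For each integer $k\ge 2$, let $f(k):=3-\frac{3}{3k-1}$ if $k$ is even and $f(k):=3-\frac{3}{3k-2}$ if $k$ is odd. Then for every integer $k\ge 2$, $$g\!\left(1,\,2-\tfrac{2}{k+1}\right)=\tilde g\!\left(1,\,2-\tfrac{2}{k+1}\right)=f(k).$$
   Context: All graphs are finite and simple. The average degree of a graph $H$ is $2|E(H)|/|V(H)|$, and $\mathrm{mad}(G)$ is the maximum of the average degree of $H$ over all nonempty subgraphs $H$ of $G$ (with $\mathrm{mad}$ of the graph with no vertices taken to be $0$). For positive reals $a,b$, call a partition of $V(G)$ into (possibly empty) sets $A$ and $B$ an $(a,b)$-partition of $G$ if $\mathrm{mad}(G[A])<a$ and $\mathrm{mad}(G[B])<b$. $g(a,b)$ denotes the largest value such that every graph $G$ with $\mathrm{mad}(G)<g(a,b)$ has an $(a,b)$-partition. $\tilde g(a,b)$ denotes the largest value for which there is a finite set $\mathcal{G}_{a,b}$ of graphs, none of which has an $(a,b)$-partition, such that every graph $G$ with $\mathrm{mad}(G)<\tilde g(a,b)$ that has no graph in $\mathcal{G}_{a,b}$ as a subgraph has an $(a,b)$-partition. *)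

(* Defs.v *)
From HB Require Import structures.
From mathcomp Require Import all_boot all_order all_algebra.
From mathcomp Require Import reals.

Set Implicit Arguments.
Unset Strict Implicit.
Unset Printing Implicit Defensive.

Import Order.TTheory GRing.Theory Num.Theory.

Local Open Scope ring_scope.

Record sgraph := SGraph {
  vertex :> finType;
  adj : rel vertex;
  adj_sym : symmetric adj;
  adj_irrefl : irreflexive adj }.

Definition edges (G : sgraph) : {set {set G}} :=
  [set [set p.1; p.2] | p : G * G & adj p.1 p.2].

(* A subgraph H of G is presented as the pair (V(H), E(H)). *)
Definition nonempty_subgraph (G : sgraph) (H : {set G} * {set {set G}}) : bool :=
  [&& H.1 != set0, H.2 \subset edges G & [forall e in H.2, e \subset H.1]].

Definition avg_degree (R : realType) (G : sgraph)
    (H : {set G} * {set {set G}}) : R :=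
  2 * #|H.2|%:R / #|H.1|%:R.

(* Average degrees are nonnegative, so the default value 0 of the maximum only
   matters for the graph with no vertices. *)
Definition mad (R : realType) (G : sgraph) : R :=
  \big[Num.max/0]_(H : {set G} * {set {set G}} | nonempty_subgraph H)
    avg_degree R H.

Section Induced.
Variables (G : sgraph) (A : {set G}).

Definition induced_adj : rel {x : G | x \in A} :=
  fun x y => adj (val x) (val y).

Lemma induced_adj_sym : symmetric induced_adj.
Proof. by move=> x y; apply: adj_sym. Qed.

Lemma induced_adj_irrefl : irreflexive induced_adj.
Proof. by move=> x; apply: adj_irrefl. Qed.

Definition induced : sgraph := SGraph induced_adj_sym induced_adj_irrefl.
End Induced.

Definition has_partition (R : realType) (a b : R) (G : sgraph) : Prop :=
  exists A B : {set G},
    [/\ A :|: B = [set: G], [disjoint A & B],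
        mad R (induced A) < a & mad R (induced B) < b].

(* H is isomorphic to a (not necessarily induced) subgraph of G. *)
Definition contains_subgraph (G H : sgraph) : Prop :=
  exists2 f : H -> G, injective f & forall x y, adj x y -> adj (f x) (f y).

Definition is_largest (R : realType) (P : R -> Prop) (x : R) : Prop :=
  P x /\ forall y, P y -> y <= x.

(* is_g a b x means g(a, b) = x: in particular the largest value exists. *)
Definition is_g (R : realType) (a b : R) : R -> Prop :=
  is_largest (fun x => forall G : sgraph, mad R G < x -> has_partition a b G).

(* is_g_tilde a b x means that the largest value g~(a, b) exists and is x; the
   finite set of forbidden graphs is a finite family, possibly empty. *)
Definition is_g_tilde (R : realType) (a b : R) : R -> Prop :=
  is_largest (fun x => exists (n : nat) (F : 'I_n -> sgraph),
    (forall i, ~ has_partition a b (F i)) /\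
    (forall G : sgraph, mad R G < x ->
       (forall i, ~ contains_subgraph G (F i)) -> has_partition a b G)).

Definition f (R : realType) (k : nat) : R :=
  if odd k then 3 - 3 / (3 * k%:R - 2) else 3 - 3 / (3 * k%:R - 1).

(* Main.v *)
Require Import Defs.
From HB Require Import structures.
From mathcomp Require Import all_boot all_order all_algebra.
From mathcomp Require Import reals.
From mathcomp Require Import boolp zify ring lra.

Set Implicit Arguments.
Unset Strict Implicit.
Unset Printing Implicit Defensive.

Import Order.TTheory GRing.Theory Num.Theory.

Local Open Scope ring_scope.

(** The condition mad(G[B]) < 2 - 2/(k+1) says that B induces a forest whose
    components have at most k vertices. That mad(G) <= f(k) suffices is proved by
    the potential method, for graphs whose vertices may carry a weight or be forced
    into the forest: a vertex has a potential depending on its type, an edge costs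
    edgeC, and the claim is that a partition exists as soon as the potential of
    every nonempty set is at least -2. In a minimal counterexample every proper set
    W with two or more vertices has potential greater than indC: otherwise W could
    be coloured after making a boundary vertex b as heavy as the potential of W
    permits, and then be replaced by the component of b contracted to one vertex.
    This gap excludes forced vertices, vertices of degree 2 and small weight, and
    adjacent vertices of degree 2 and moderate weight. The remaining surplus
    vertices of degree 2 split their charge between their neighbours; the total
    charge being at least -4, only boundedly many vertices are not balanced, and
    the whole graph can be coloured explicitly.

    Conversely, long chains of blocks, each of which transmits that a vertex must be
    in the independent set, have no partition, and a fractional orientation
    spreading their excess over all blocks shows that their maximum average degree
    tends to f(k). Since a graph without partition has mad > f(k), such a chain
    contains none of finitely many given graphs without partition, so excluding
    these does not help. *)

(** * Counting edges *)

(** The constants are tied together by the basic reduction. Deleting a vertex of type U_k forces its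
    neighbours into the forest: U_j becomes F_(j+1), losing at most [indC] + 3, against a deleted
    edge worth [edgeC]. The balance should be [indC], the potential of U_k itself, whence 2 [indC] =
    [edgeC] - 3. For a plain graph, twice the potential of a set with n vertices and e edges is then
    (3 [edgeC] - 3) n - 2 [edgeC] e, so mad at most f(k) gives potentials at least 0. The bound is
    relaxed to -2 because a potential has to be turned into an integral weight at the price of 3 per
    unit, and rounding down can lose 2. The obstacle in replacing a set of low potential is that its
    colouring restricts the outside along every boundary edge. Low potential leaves each outside
    vertex at most one neighbour in the set, so each restriction is a change of type that the lost
    edge can pay for. In the chains the blocks are balanced up to a total excess of 3, whatever
    their number; this is why long chains approach f(k). *)

Section EdgeCount.
Context (T : finType).
Implicit Types (g : rel T) (A B C S : {set T}) (u v x : T).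

(** The body repeats [edges] for a bare relation on a fixed finite type: the reductions then change
    the relation and the active set, without building new graphs or quotients. *)
Definition edge_set g : {set {set T}} :=
  [set [set p.1; p.2] | p : T * T & g p.1 p.2].

Definition nedges g S : nat := #|[set e in edge_set g | e \subset S]|.

Definition ndeg g v S : nat := #|[set u in S | g v u]|.

Definition cut g A B : nat := (\sum_(v in A) ndeg g v B)%N.

Lemma ndegS g v A B : A \subset B -> (ndeg g v A <= ndeg g v B)%N.
Proof.
move=> sAB; apply: subset_leq_card; apply/subsetP => u; rewrite !inE.
by case/andP=> /(subsetP sAB) -> ->.
Qed.

Lemma ndegU g v A B : [disjoint A & B] ->
  ndeg g v (A :|: B) = (ndeg g v A + ndeg g v B)%N.
Proof.
move=> dAB; rewrite /ndeg -cardsUI.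
have -> : [set u in A | g v u] :&: [set u in B | g v u] = set0.
  apply/setP => u; rewrite !inE; apply/negP => /andP[/andP[uA _] /andP[uB _]].
  by rewrite (disjointFr dAB uA) in uB.
rewrite cards0 addn0; apply: eq_card => u; rewrite !inE.
by case: (u \in A); case: (u \in B); case: (g v u).
Qed.

Lemma ndegD1 g v x S : x \in S -> ndeg g v S = (g v x + ndeg g v (S :\ x))%N.
Proof.
move=> xS; rewrite /ndeg (cardsD1 x) !inE xS /=; congr (_ + _)%N.
by apply: eq_card => u; rewrite !inE andbA.
Qed.

Lemma ndegU1 g v x S : x \notin S -> ndeg g v (x |: S) = (g v x + ndeg g v S)%N.
Proof.
move=> xS; rewrite (@ndegD1 g v x) ?setU11 //; congr (_ + ndeg _ _ _)%N.
by rewrite setU1K.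
Qed.

Lemma ndeg_set1 g v x : ndeg g v [set x] = g v x.
Proof.
rewrite /ndeg; case gvx: (g v x).
  have -> : [set u in [set x] | g v u] = [set x]; last by rewrite cards1.
  by apply/setP => u; rewrite !inE; case: eqP => // ->.
have -> : [set u in [set x] | g v u] = set0; last by rewrite cards0.
by apply/setP => u; rewrite !inE; case: eqP => // ->.
Qed.

Lemma ndeg0P g v S : (forall u, u \in S -> ~~ g v u) -> ndeg g v S = 0%N.
Proof.
move=> h; apply/eqP; rewrite cards_eq0; apply/eqP/setP => u; rewrite !inE.
by apply/negP => /andP[/h/negbTE ->].
Qed.

Lemma ndeg_gt0 g v x S : x \in S -> g v x -> (0 < ndeg g v S)%N.
Proof. by move=> xS gvx; apply/card_gt0P; exists x; rewrite inE xS. Qed.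

Lemma ndeg_gt0E g v S : (0 < ndeg g v S)%N -> exists2 x, x \in S & g v x.
Proof. by case/card_gt0P => x; rewrite inE => /andP[]; exists x. Qed.

Lemma eq_ndeg g g' v S : (forall u, u \in S -> g v u = g' v u) ->
  ndeg g v S = ndeg g' v S.
Proof.
move=> h; apply: eq_card => u; rewrite !inE; case uS: (u \in S) => //=.
exact: h.
Qed.

Lemma eq_nedges g g' S : {in S &, g =2 g'} -> nedges g S = nedges g' S.
Proof.
move=> h; apply: eq_card => e; rewrite !inE; case eS: (e \subset S); rewrite ?andbF //.
rewrite !andbT; apply/imsetP/imsetP => -[[u v]]; rewrite inE /= => guv de; exists (u, v);
 rewrite ?inE //= ?h // -?h //; by apply: (subsetP eS); rewrite de !inE eqxx ?orbT.
Qed.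

Lemma nedges0 g : nedges g set0 = 0%N.
Proof.
apply/eqP; rewrite cards_eq0; apply/eqP/setP => e; rewrite !inE subset0.
apply/negP => /andP[/imsetP[[u v] _ ->] /eqP/setP/(_ u)].
by rewrite !inE eqxx.
Qed.

Section Sym.
Context (g : rel T) (gs : symmetric g) (gi : irreflexive g).

Lemma nedgesU1 v S : v \notin S ->
  nedges g (v |: S) = (nedges g S + ndeg g v S)%N.
Proof.
move=> vS; rewrite /nedges.
pose N := [set [set v; u] | u in [set u in S | g v u]].
have -> : ndeg g v S = #|N|.
  rewrite card_in_imset // => x y; rewrite !inE => /andP[xS _] /andP[yS _].
  move=> /setP/(_ x); rewrite !inE eqxx orbT; case/esym/orP => /eqP // xv.
  by rewrite xv (negbTE vS) in xS.
rewrite -[RHS]cardsUI.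
have -> : [set e in edge_set g | e \subset S] :&: N = set0.
  apply/setP => e; rewrite !inE; apply/negP => /andP[/andP[_ eS] /imsetP[u _ de]].
  by move: vS; rewrite (subsetP eS) // de !inE eqxx.
rewrite cards0 addn0; apply: eq_card => e; rewrite !inE.
apply/andP/orP => [[/imsetP[[x y]]]|]; rewrite ?inE /=.
  move=> gxy -> sub.
  have xin : x \in v |: S by apply: (subsetP sub); rewrite !inE eqxx.
  have yin : y \in v |: S by apply: (subsetP sub); rewrite !inE eqxx orbT.
  move: gxy {sub}; case: (eqVneq x v) xin => [-> _|xv xin] gxy.
    right; apply/imsetP; exists y => //; rewrite !inE; move: yin; rewrite !inE.
    by case/orP => [/eqP yv|->//]; rewrite yv gi in gxy.
  have xS : x \in S by move: xin; rewrite !inE (negbTE xv).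
  move: gxy; case: (eqVneq y v) yin => [-> _|yv yin] gxy.
    right; apply/imsetP; exists x; last by rewrite setUC.
    by rewrite inE xS gs.
  have yS : y \in S by move: yin; rewrite !inE (negbTE yv).
  left; rewrite subUset !sub1set xS yS !andbT; apply/imsetP; exists (x, y) => //.
  by rewrite inE.
case=> [/andP[-> eS]|/imsetP[u]].
  by split=> //; apply: subset_trans eS _; apply: subsetUr.
rewrite !inE => /andP[uS gvu] ->; split.
  by apply/imsetP; exists (v, u) => //; rewrite inE.
by rewrite subUset !sub1set !inE eqxx uS orbT.
Qed.

Lemma nedges1 v : nedges g [set v] = 0%N.
Proof.
rewrite -[[set v]]setU0 nedgesU1 ?inE // nedges0 add0n; apply: ndeg0P => u.
by rewrite inE.
Qed.

Lemma cut0 A : cut g set0 A = 0%N.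
Proof. by rewrite /cut big_set0. Qed.

Lemma cutU1 v A B : v \notin A -> cut g (v |: A) B = (ndeg g v B + cut g A B)%N.
Proof. by move=> vA; rewrite /cut big_setU1. Qed.

Lemma set_ind (P : {set T} -> Prop) :
  P set0 -> (forall x A, x \notin A -> P A -> P (x |: A)) -> forall A, P A.
Proof.
move=> P0 PU A; move: {2}#|A| (erefl #|A|) => n; elim: n A => [|n IH] A.
  by move/eqP; rewrite cards_eq0 => /eqP ->.
move=> cA; have /card_gt0P[x xA] : (0 < #|A|)%N by rewrite cA.
rewrite -(setD1K xA); apply: PU; first by rewrite !inE eqxx.
by apply: IH; move: cA; rewrite (cardsD1 x) xA => -[].
Qed.

Lemma cutU1r v A B : v \notin B -> cut g A (v |: B) = (ndeg g v A + cut g A B)%N.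
Proof.
move=> vB; elim/set_ind: A => [|x A xA IH].
  by rewrite !cut0 addn0; apply/esym/ndeg0P => u; rewrite inE.
rewrite !cutU1 // IH !ndegU1 // gs; lia.
Qed.

Lemma cutC A B : cut g A B = cut g B A.
Proof.
elim/set_ind: B => [|x B xB IH]; last by rewrite cutU1 // cutU1r // IH.
by rewrite cut0 /cut big1 // => v _; apply: ndeg0P => u; rewrite inE.
Qed.

Lemma nedgesU A B : [disjoint A & B] ->
  nedges g (A :|: B) = (nedges g A + nedges g B + cut g A B)%N.
Proof.
elim/set_ind: A => [|x A xA IH]; first by rewrite set0U nedges0 cut0 addn0.
rewrite disjoint_sym disjoints_subset setCU subsetI => /andP[Bx BA].
have xB : x \notin B.
  by apply/negP => /(subsetP Bx); rewrite !inE eqxx.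
have dAB : [disjoint A & B] by rewrite disjoint_sym disjoints_subset.
rewrite -setUA nedgesU1; last by rewrite inE negb_or xA.
rewrite IH // nedgesU1 // cutU1 // ndegU //; lia.
Qed.

Lemma handshake S : (\sum_(v in S) ndeg g v S = 2 * nedges g S)%N.
Proof.
elim/set_ind: S => [|x S xS IH]; first by rewrite big_set0 nedges0.
rewrite big_setU1 //= ndegU1 // gi add0n nedgesU1 //.
have -> : (\sum_(v in S) ndeg g v (x |: S) = ndeg g x S + \sum_(v in S) ndeg g v S)%N.
  by have := cutU1r S xS.
rewrite IH; lia.
Qed.
End Sym.
End EdgeCount.

(** * Potentials of vertex sets *)

Section Potential.
Context (T : finType).
Implicit Types (g : rel T) (A B C S : {set T}) (u v x : T) (c : T -> int).

(** Shared by [rho], which measures density, and [sigma], which tests for forests with light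
    components; only the vertex charges and the price of an edge differ. *)
Definition pot (kappa : int) c g S : int :=
  \sum_(v in S) c v - kappa * (nedges g S)%:Z.

Lemma pot0 kappa c g : pot kappa c g set0 = 0.
Proof. by rewrite /pot big_set0 nedges0 mulr0 subr0. Qed.

Lemma eq_pot kappa c c' g g' S : {in S, c =1 c'} -> {in S &, g =2 g'} ->
  pot kappa c g S = pot kappa c' g' S.
Proof. by move=> hc hg; rewrite /pot (eq_nedges hg); congr (_ - _); apply: eq_bigr. Qed.

Section Sym.
Context (g : rel T) (gs : symmetric g) (gi : irreflexive g) (kappa : int) (c : T -> int).

Lemma pot1 v : pot kappa c g [set v] = c v.
Proof. by rewrite /pot big_set1 nedges1 // mulr0 subr0. Qed.

Lemma potU1 v S : v \notin S ->
  pot kappa c g (v |: S) = pot kappa c g S + c v - kappa * (ndeg g v S)%:Z.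
Proof. by move=> vS; rewrite /pot big_setU1 //= nedgesU1 // PoszD; ring. Qed.

Lemma potD1 v S : v \in S ->
  pot kappa c g S = pot kappa c g (S :\ v) + c v - kappa * (ndeg g v (S :\ v))%:Z.
Proof. by move=> vS; rewrite -{1}(setD1K vS) potU1 // !inE eqxx. Qed.

Lemma potU A B : [disjoint A & B] ->
  pot kappa c g (A :|: B) = pot kappa c g A + pot kappa c g B - kappa * (cut g A B)%:Z.
Proof.
move=> dAB; rewrite /pot nedgesU // (eq_bigl [predU A & B]) => [|x]; last by rewrite !inE.
rewrite bigU //= !PoszD; ring.
Qed.

End Sym.

Lemma ler_pot kappa c c' g g' S : 0 <= kappa ->
  {in S, forall v, c v <= c' v} -> (nedges g' S <= nedges g S)%N ->
  pot kappa c g S <= pot kappa c' g' S.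
Proof.
move=> k0 hc hg; rewrite /pot lerB //; first exact: ler_sum.
by rewrite ler_wpM2l.
Qed.

End Potential.

(** * Potentials and weighted colourings *)

(* The parameter k is written as 2 h + o, where o is its parity. An edge costs
   edgeC = 3 k - 1 - o, so that f(k) = 3 - 3 / edgeC, and indC = (edgeC - 3) / 2 is
   the potential of a vertex that has to lie in the independent set. *)
Definition kpar (h : nat) (o : bool) : nat := (2 * h + o)%N.
Definition edgeC (h : nat) (o : bool) : int := (6 * h)%:Z + (2 * o)%:Z - 1.
Definition indC (h : nat) (o : bool) : int := (3 * h)%:Z + o%:Z - 2.
(* A component of weight j can be attached to a vertex at the price cost j; the
   bonus, which is what makes the bounds tight for large j, is normalised by
   cost k = edgeC. *)
Definition bonus (h : nat) (o : bool) (j : nat) : nat :=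
  if (j <= h)%N then 0%N else if j == h.+1 then 1%N else o.+1.
Definition cost (h : nat) (o : bool) (j : nat) : int :=
  (3 * j)%:Z - (bonus h o j)%:Z.

Lemma costP h o j :
  [\/ (j <= h)%N /\ cost h o j = (3 * j)%:Z,
      j = h.+1 /\ cost h o j = (3 * j)%:Z - 1 |
      (h.+2 <= j)%N /\ cost h o j = (3 * j)%:Z - 1 - o%:Z].
Proof.
rewrite /cost /bonus; have [jh|jh] := leqP j h; first by constructor 1; rewrite subr0.
have [->|ne] := eqVneq j h.+1; first by constructor 2.
constructor 3; split; lia.
Qed.

(* (true, j) is the type F_j: the vertex must lie in the forest and contributes j to
   the weight of its component. (false, j) is the type U_j: the vertex is free, and
   contributes j + 1 if it is put in the forest; U_k is thus forced into the
   independent set. *)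
Definition vtype := (bool * nat)%type.
Definition wt (t : vtype) : nat := if t.1 then t.2 else t.2.+1.
Definition okty (k : nat) (t : vtype) : bool :=
  if t.1 then (0 < t.2 <= k)%N else (t.2 <= k)%N.
Definition typeC h o (t : vtype) : int :=
  if t.1 then edgeC h o - cost h o t.2 else edgeC h o + indC h o - cost h o t.2.
(** A free vertex saturates at U_k, where it is already barred from the forest. A forced vertex has
    no such escape, hence the side condition [t.2 + m <= k] in the lemmas on raised types. *)
Definition heavier k m (t : vtype) : vtype :=
  if t.1 then (true, (t.2 + m)%N) else (false, minn k (t.2 + m)).

Lemma kparE h o : kpar h o = (2 * h + o)%N. Proof. by []. Qed.
Lemma edgeCE h o : edgeC h o = (6 * h)%:Z + (2 * o)%:Z - 1. Proof. by []. Qed.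
Lemma indCE h o : indC h o = (3 * h)%:Z + o%:Z - 2. Proof. by []. Qed.

Ltac par h o :=
  pose proof (kparE h o); pose proof (edgeCE h o); pose proof (indCE h o);
  pose proof (leq_b1 o).
Ltac lia0 := clear; lia.
Ltac par0 h o h0 :=
  generalize h0 (kparE h o) (edgeCE h o) (indCE h o) (leq_b1 o); lia0.

(** * Arithmetic of costs and types *)

Section Arith.
Context (h : nat) (o : bool) (h0 : (0 < h)%N).
Local Notation k := (kpar h o).
Local Notation E := (edgeC h o).
Local Notation I := (indC h o).
Local Notation cost := (cost h o).

Lemma indC_gt0 : 0 < I. Proof. par h o; lia. Qed.
Lemma edgeC_ge5 : 5 <= E. Proof. par h o; lia. Qed.
Lemma edgeC_ge0 : 0 <= E. Proof. par h o; lia. Qed.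
Lemma edgeC_mul (m n : nat) : (m <= n)%N -> E * m%:Z <= E * n%:Z.
Proof. by move=> mn; rewrite ler_wpM2l ?edgeC_ge0. Qed.
Lemma indC2 : 2 * I = E - 3. Proof. par h o; lia. Qed.
Lemma cost_lin j : (j <= h)%N -> cost j = (3 * j)%:Z.
Proof. by move=> jh; case: (costP h o j) => -[? ->] //; lia. Qed.
Lemma cost_k : cost k = E.
Proof. by par h o; case: (costP h o k) => -[? ->]; lia. Qed.
Lemma cost_ge j : 2 * j%:Z <= cost j.
Proof. by par h o; case: (costP h o j) => -[? ->]; lia. Qed.
Lemma cost_le3 j : cost j <= 3 * j%:Z.
Proof. by par h o; case: (costP h o j) => -[? ->]; lia. Qed.
Lemma cost_ge0 j : 0 <= cost j.
Proof. by have := cost_ge j; lia. Qed.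
Lemma cost_mono i j : (i <= j)%N -> cost i <= cost j.
Proof.
by par h o; case: (costP h o i) => -[? ->]; case: (costP h o j) => -[? ->]; lia.
Qed.
Lemma cost_succ j : cost j.+1 <= cost j + 3.
Proof.
by par h o; case: (costP h o j) => -[? ->]; case: (costP h o j.+1) => -[? ->]; lia.
Qed.
(** Two weights of total at most k do not both exceed h, so at most one of them carries a bonus, and
    the bonus is monotone. *)
Lemma cost_sub i j : (i + j <= k)%N -> cost (i + j) <= cost i + cost j.
Proof.
by par h o; case: (costP h o i) => -[? ->]; case: (costP h o j) => -[? ->];
  case: (costP h o (i + j)) => -[? ->]; lia.
Qed.
(** The margin 3 is what excludes an overloaded pair: two adjacent forced vertices of weights i and
    j have potential E - cost i - cost j, here at most -3. *)
Lemma cost_big i j : (i <= k)%N -> (j <= k)%N -> (k < i + j)%N ->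
  E + 3 <= cost i + cost j.
Proof.
by par h o; case: (costP h o i) => -[? ->]; case: (costP h o j) => -[? ->]; lia.
Qed.
Lemma cost_le_k j : (j <= k)%N -> cost j <= E.
Proof. by rewrite -cost_k; apply: cost_mono. Qed.

Lemma light_cost i : I + 3 < E - cost i -> (i < h)%N.
Proof. by par h o; case: (costP h o i) => -[? ->]; lia. Qed.

Lemma cost_half i : (0 < i < h)%N ->
  cost (i + (k - h)) = (3 * i)%:Z + (3 * h)%:Z + 2 * o%:Z - 1.
Proof. by par h o; case: (costP h o (i + (k - h))) => -[? ->]; lia. Qed.

(** The hypothesis amounts to p <= 3m, and for weights above h + 1 the normalisation of the bonus
    gives E - cost (k - m) = 3m exactly. For smaller weights the bound p <= I helps. *)
Lemma low_weight w m (p : int) : (w + m <= k)%N -> p <= I ->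
  p + 2 < (3 * m)%:Z + 3 -> p <= E - cost w.
Proof. by par h o; case: (costP h o w) => -[? ->]; lia. Qed.

Lemma typeC_ge0 t : okty k t -> 0 <= typeC h o t.
Proof.
have := indC_gt0; case: t => -[] j; rewrite /okty /typeC /= => I0.
  by case/andP => _ /cost_le_k; lia.
by move/cost_le_k; lia.
Qed.

Lemma typeC_le t : typeC h o t <= E + I.
Proof.
by have := cost_ge0 t.2; have := indC_gt0; rewrite /typeC; case: ifP; lia.
Qed.

Lemma heavier_ok m t : okty k t -> (t.1 -> (t.2 + m <= k)%N) -> okty k (heavier k m t).
Proof.
case: t => -[] j; rewrite /okty /heavier /= => t0 jm; last exact: geq_minl.
by have := jm isT; lia.
Qed.

(** For a free vertex that saturates, the loss is E - cost j, and [cost_big] bounds it by cost m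
    when m <= k. *)
Lemma typeC_heavier m t : okty k t -> (t.1 -> (t.2 + m <= k)%N) ->
  typeC h o t - cost m <= typeC h o (heavier k m t).
Proof.
case: t => -[] j; rewrite /okty /typeC /heavier /= => t0 jm.
  by have := cost_sub (jm isT); lia.
rewrite /minn; case: ltnP => jm'; last by have := cost_sub jm'; lia.
have [mk|mk] := leqP m k; first by have := cost_big t0 mk jm'; rewrite cost_k; lia.
by have := cost_mono (ltnW mk); have := cost_ge0 j; lia.
Qed.


(** Weight k + 1 is too large for any good set, so a raised vertex that does lie in the forest
    carries the full raise. *)
Lemma wt_heavier m t : okty k t ->
  wt (heavier k m t) = (wt t + m)%N \/ wt (heavier k m t) = k.+1.
Proof. by case: t => -[] j; rewrite /wt /okty /heavier /=; lia. Qed.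

Lemma wt_gt0 t : okty k t -> (0 < wt t)%N.
Proof. by case: t => -[] j; rewrite /wt /okty //=; case/andP. Qed.
End Arith.

(** * Good sets and weighted colourings *)

Section Coloring.
Context (T : finType) (k : nat).
Implicit Types (g : rel T) (ty : T -> vtype) (A S X W : {set T}).

(* X induces a forest all of whose components have weight at most k if and only if
   sigma S = (k + 1) (|S| - e(S)) - wt(S) is positive for all nonempty S in X: a
   cycle has |S| = e(S), and a tree has |S| - e(S) = 1. *)
Definition sigma g ty S : int :=
  pot k.+1%:Z (fun v => k.+1%:Z - (wt (ty v))%:Z) g S.

Definition good g ty X : Prop := forall S, S \subset X -> S != set0 -> 0 < sigma g ty S.

Definition colorable g ty A : Prop := exists X : {set T},
  [/\ X \subset A, forall v, v \in A -> (ty v).1 -> v \in X,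
      forall x y, x \in A :\: X -> y \in A :\: X -> ~~ g x y & good g ty X].

Lemma good_ge0 g ty X S : good g ty X -> S \subset X -> 0 <= sigma g ty S.
Proof.
move=> gX sSX; have [->|S0] := eqVneq S set0; first by rewrite /sigma pot0.
exact/ltW/gX.
Qed.

Lemma good_sub g ty X (Y : {set T}) : Y \subset X -> good g ty X -> good g ty Y.
Proof. by move=> sYX gX S sSY; apply: gX; apply: subset_trans sYX. Qed.

Lemma good_le g g' ty ty' X : (forall v, v \in X -> (wt (ty v) <= wt (ty' v))%N) ->
  {in X &, g =2 g'} -> good g' ty' X -> good g ty X.
Proof.
move=> hw hg gX S sSX S0; apply: lt_le_trans (gX S sSX S0) _.
apply: ler_pot => // [v /(subsetP sSX)/hw|]; first by lia.
by rewrite (@eq_nedges _ g' g) // => x y xS yS; rewrite hg // (subsetP sSX).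
Qed.

Lemma good0 g ty : good g ty set0.
Proof. by move=> S; rewrite subset0 => ->. Qed.

Section Sym.
Context (g : rel T) (gs : symmetric g) (gi : irreflexive g).

Lemma good_wt ty X v : good g ty X -> v \in X -> (wt (ty v) <= k)%N.
Proof.
move=> gX vX; have := gX [set v]; rewrite sub1set /sigma pot1 // => /(_ vX).
have -> : [set v] != set0 by apply/set0Pn; exists v; rewrite inE.
by move=> /(_ isT); lia.
Qed.

(** Connectedness is replaced by |C| <= e(C) + 1, which survives adding any vertex with a neighbour
    in C; a largest such set is closed under adjacency in X. In a good set, positivity of [sigma]
    then bounds the weight of C by k. *)
Lemma component X b : b \in X -> exists C : {set T},
  [/\ C \subset X, b \in C, (#|C| <= nedges g C + 1)%N &
      forall x, x \in X -> x \notin C -> ndeg g x C = 0%N].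
Proof.
move=> bX; pose P (C : {set T}) := [&& C \subset X, b \in C & (#|C| <= nedges g C + 1)%N].
have P1 : P [set b] by rewrite /P sub1set bX inE eqxx cards1 addnC.
case: (arg_maxnP (fun C : {set T} => #|C|) P1) => C /and3P[sCX bC cC] mC.
exists C; split=> // x xX xC; apply/eqP; rewrite -leqn0 leqNgt; apply/negP => d0.
have : P (x |: C).
  rewrite /P subUset sub1set xX sCX !inE bC orbT /= cardsU1 xC nedgesU1 //; lia.
by move/mC; rewrite cardsU1 xC; lia.
Qed.

Lemma sigmaE ty S : sigma g ty S =
  k.+1%:Z * (#|S|%:Z - (nedges g S)%:Z) - (\sum_(v in S) wt (ty v))%N%:Z.
Proof.
rewrite /sigma /pot sumrB sumr_const (big_morph Posz PoszD (erefl _)).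
rewrite -[_ *+ _]mulr_natr natz; ring.
Qed.

Lemma sigma_disjU ty X1 X2 : [disjoint X1 & X2] ->
  sigma g ty (X1 :|: X2) = sigma g ty X1 + sigma g ty X2 - k.+1%:Z * (cut g X1 X2)%:Z.
Proof. exact: potU. Qed.

Lemma cut_eq0 X1 X2 : (forall x y, x \in X1 -> y \in X2 -> ~~ g x y) -> cut g X1 X2 = 0%N.
Proof.
by move=> hc; rewrite /cut big1 // => v vX; apply: ndeg0P => u uX; apply: hc.
Qed.

Lemma goodU ty X1 X2 : [disjoint X1 & X2] ->
  (forall x y, x \in X1 -> y \in X2 -> ~~ g x y) ->
  good g ty X1 -> good g ty X2 -> good g ty (X1 :|: X2).
Proof.
move=> dX hc g1 g2 S sS S0.
have dS : [disjoint S :&: X1 & S :\: X1].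
  by rewrite -setI_eq0; apply/eqP/setP => x; rewrite !inE; case: (x \in X1); rewrite ?andbF.
have s2 : S :\: X1 \subset X2.
  apply/subsetP => x; rewrite !inE => /andP[xX1 /(subsetP sS)].
  by rewrite inE (negbTE xX1).
rewrite -(setID S X1) sigma_disjU // cut_eq0 => [|x y]; last first.
  by rewrite !inE => /andP[_ xX] yX; apply: hc => //; apply: (subsetP s2); rewrite inE.
rewrite mulr0 subr0; have s1 : S :&: X1 \subset X1 by apply: subsetIr.
have [S1|S1] := eqVneq (S :&: X1) set0.
  rewrite S1 {1}/sigma pot0 add0r; apply: g2 => //; apply: contra_neq S0 => S2.
  by rewrite -(setID S X1) S1 S2 setU0.
by have := g1 _ s1 S1; have := good_ge0 g2 s2; lia.
Qed.

Lemma good_add ty X v : v \notin X -> ndeg g v X = 0%N -> (wt (ty v) <= k)%N ->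
  good g ty X -> good g ty (v |: X).
Proof.
move=> vX d0 wv gX; apply: goodU => //.
- by rewrite disjoints1.
- move=> x y; rewrite inE => /eqP -> yX; apply/negP => gvy.
  by have := ndeg_gt0 yX gvy; rewrite d0.
move=> S; rewrite subset1 => /orP[] /eqP ->; last by rewrite eqxx.
by rewrite /sigma pot1 //; lia.
Qed.

(** The types [ty'] have charged the weight of v to x in advance. Adding v brings k + 1 - wt v to
    [sigma] and at most one edge, so the net loss is at most wt v, and it occurs only for sets that
    contain x. *)
Lemma good_attach ty ty' X v x : v \notin X -> x \in X ->
  (forall y, y \in X -> g v y -> y = x) ->
  (wt (ty v) <= k)%N ->
  (forall y, y \in X -> y != x -> (wt (ty y) <= wt (ty' y))%N) ->
  (wt (ty x) + wt (ty v) <= wt (ty' x))%N ->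
  good g ty' X -> good g ty (v |: X).
Proof.
move=> vX xX hx wv hw hwx gX S sS S0.
have gX' : good g ty X.
  apply: good_le gX => // y yX; have [->|yx] := eqVneq y x; last exact: hw.
  lia.
have sSv : S :\ v \subset X.
  apply/subsetP => y; rewrite !inE => /andP[yv /(subsetP sS)].
  by rewrite !inE (negbTE yv).
have [vS|vS] := boolP (v \in S); last first.
  apply: gX' => //; apply/subsetP => y yS; have := subsetP sS y yS.
  by rewrite !inE => /orP[/eqP yv|//]; rewrite -yv yS in vS.
rewrite /sigma (potD1 gs gi _ _ vS) -/(sigma _ _ _).
have [xS|xS] := boolP (x \in S :\ v); last first.
  rewrite ndeg0P => [|u uS].
    by have := good_ge0 gX' sSv; lia.
  by apply/negP => /hx h'; rewrite -h' ?uS // in xS; apply: (subsetP sSv).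
have n1 : (ndeg g v (S :\ v) <= 1)%N.
  rewrite (ndegD1 _ _ xS) ndeg0P; first by case: (g v x).
  move=> u; rewrite in_setD1 => /andP[ux uS]; apply: contra_neqN ux => guv.
  by apply: hx => //; apply: (subsetP sSv).
have S0' : S :\ v != set0 by apply/set0Pn; exists x.
have := gX _ sSv S0'.
have : sigma g ty' (S :\ v) + (wt (ty v))%:Z <= sigma g ty (S :\ v).
  rewrite /sigma !(potD1 gs gi _ _ xS).
  suff : pot k.+1%:Z (fun v0 => k.+1%:Z - (wt (ty' v0))%:Z) g (S :\ v :\ x)
     <= pot k.+1%:Z (fun v0 => k.+1%:Z - (wt (ty v0))%:Z) g (S :\ v :\ x)
    by move: hwx; clear; lia.
  apply: ler_pot => // y; rewrite in_setD1 => /andP[yx yS].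
  by have := hw y (subsetP sSv _ yS) yx; clear; lia.
move: n1; case: (ndeg _ _ _) => [|[|//]] _; lia.
Qed.

(* Half of each edge is charged to either of its ends. *)
Lemma good_local ty X :
  (forall v, v \in X -> (k.+1 * ndeg g v X < 2 * (k.+1 - wt (ty v)))%N) -> good g ty X.
Proof.
move=> hX S sS /set0Pn[v vS].
have hs := handshake gs gi S.
have : 0 < 2 * sigma g ty S; last by lia.
have -> : 2 * sigma g ty S =
  \sum_(u in S) (2 * (k.+1%:Z - (wt (ty u))%:Z) - k.+1%:Z * (ndeg g u S)%:Z).
  rewrite sumrB -!mulr_sumr; have -> : \sum_(u in S) (ndeg g u S)%:Z = (2 * nedges g S)%N%:Z :> int.
    by rewrite -hs (big_morph Posz PoszD (erefl _)).
  by rewrite /sigma /pot PoszM; ring.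
have pos u : u \in S -> 0 < 2 * (k.+1%:Z - (wt (ty u))%:Z) - k.+1%:Z * (ndeg g u S)%:Z.
  move=> uS; have := hX u (subsetP sS _ uS); have := leq_mul (leqnn k.+1) (ndegS g u sS).
  by rewrite -PoszM; lia.
rewrite (bigD1 v) //=; apply: ltr_pwDl; first exact: pos.
by apply: sumr_ge0 => u /andP[uS _]; apply/ltW/pos.
Qed.

End Sym.
End Coloring.

(** * Minimal counterexamples *)

Definition upd (T : finType) (x : T) (t : vtype) (ty : T -> vtype) : T -> vtype :=
  fun u => if u == x then t else ty u.

Definition raise (T : finType) k (x : T) m (ty : T -> vtype) : T -> vtype :=
  upd x (heavier k m (ty x)) ty.

Definition del (T : finType) (g : rel T) (v x : T) : rel T :=
  fun a b => g a b && ~~ ((a == v) && (b == x) || (a == x) && (b == v)).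

Section Update.
Context (T : finType).
Implicit Types (g : rel T) (ty : T -> vtype) (A S X W : {set T}).

Lemma upd_eq x t ty : upd x t ty x = t.
Proof. by rewrite /upd eqxx. Qed.

Lemma upd_neq x t ty u : u != x -> upd x t ty u = ty u.
Proof. by rewrite /upd => /negbTE ->. Qed.

Lemma pot_upd kappa (c c' : T -> int) g W x : x \in W ->
  (forall u, u \in W -> u != x -> c u = c' u) ->
  pot kappa c' g W = pot kappa c g W + (c' x - c x).
Proof.
move=> xW hc; rewrite /pot (bigD1 x) //= [in RHS](bigD1 x) //=.
have -> : \sum_(i in W | i != x) c' i = \sum_(i in W | i != x) c i.
  by apply: eq_bigr => u /andP[uW ux]; rewrite hc.
ring.
Qed.

Lemma pot_upd_out kappa (f : vtype -> int) g W x t ty : x \notin W ->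
  pot kappa (fun u => f (upd x t ty u)) g W = pot kappa (fun u => f (ty u)) g W.
Proof.
move=> xW; apply: eq_pot => // u uW; rewrite upd_neq //.
by apply: contraNneq xW => <-.
Qed.

Lemma pot_upd_in kappa (f : vtype -> int) g W x t ty : x \in W ->
  pot kappa (fun u => f (upd x t ty u)) g W =
  pot kappa (fun u => f (ty u)) g W + (f t - f (ty x)).
Proof.
move=> xW; rewrite (@pot_upd _ (fun u => f (ty u)) (fun u => f (upd x t ty u)) g W x) //.
  by rewrite upd_eq.
by move=> u _ ux; rewrite upd_neq.
Qed.

Section Del.
Context (g : rel T) (gs : symmetric g) (gi : irreflexive g) (v x : T) (gvx : g v x).

Lemma del_sym : symmetric (del g v x).
Proof.
move=> a b; rewrite /del gs; congr (_ && ~~ _).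
by rewrite orbC andbC [in X in _ || X]andbC.
Qed.

Lemma del_irr : irreflexive (del g v x).
Proof. by move=> a; rewrite /del gi. Qed.

Lemma del_neq : v != x.
Proof. by apply/negP => /eqP vx; have := gvx; rewrite vx gi. Qed.

Lemma nedges_del_in S : v \in S -> x \in S -> nedges g S = (nedges (del g v x) S).+1.
Proof.
move=> vS xS; have vx := del_neq.
have xS' : x \in S :\ v by rewrite !inE eq_sym vx.
rewrite -(setD1K vS) !nedgesU1 ?inE ?eqxx //; [|exact: del_sym|exact: del_irr].
rewrite (@eq_nedges _ g (del g v x)) => [|a b]; last first.
  by rewrite !inE /del => /andP[/negbTE -> _] /andP[/negbTE -> _]; rewrite andbF andbT.
have -> : ndeg g v (S :\ v) = (ndeg (del g v x) v (S :\ v)).+1; last by rewrite addnS.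
rewrite (ndegD1 g v xS') (ndegD1 (del g v x) v xS') gvx.
have -> : del g v x v x = false by rewrite /del gvx !eqxx.
rewrite add0n; congr _.+1; apply: eq_ndeg => u; rewrite !inE /del => /andP[/negbTE -> _].
by rewrite andbF (negbTE vx) /= andbT.
Qed.

Lemma nedges_del_out S : ~~ ((v \in S) && (x \in S)) -> nedges (del g v x) S = nedges g S.
Proof.
move=> vxS; apply: eq_nedges => a b aS bS; rewrite /del; apply: andb_idr => _.
apply: contra vxS => /orP[] /andP[/eqP <- /eqP <-]; first by rewrite aS.
by rewrite bS.
Qed.

Lemma arcs_del :
  (#|[set p : T * T | del g v x p.1 p.2]| < #|[set p : T * T | g p.1 p.2]|)%N.
Proof.
apply: proper_card; apply/properP; split.
  by apply/subsetP => p; rewrite !inE => /andP[].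
by exists (v, x); rewrite !inE //= /del !eqxx /= andbF.
Qed.
End Del.
End Update.

Definition rho h o (T : finType) (g : rel T) (ty : T -> vtype) (S : {set T}) : int :=
  pot (edgeC h o) (fun v => typeC h o (ty v)) g S.

Definition sparse h o (T : finType) (g : rel T) (ty : T -> vtype) (A : {set T}) : Prop :=
  forall W : {set T}, W \subset A -> W != set0 -> -2 <= rho h o g ty W.

Lemma rho_upd h o (T : finType) (g : rel T) x t ty (W : {set T}) :
  rho h o g (upd x t ty) W =
  rho h o g ty W + (if x \in W then typeC h o t - typeC h o (ty x) else 0).
Proof.
rewrite /rho; case: ifP => xW; first exact: (@pot_upd_in T _ (typeC h o)).
by rewrite addr0; apply: (@pot_upd_out T _ (typeC h o)); rewrite xW.
Qed.

Lemma sigma_upd k (T : finType) (g : rel T) x t ty (S : {set T}) : x \in S ->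
  sigma k g (upd x t ty) S = sigma k g ty S - (wt t)%:Z + (wt (ty x))%:Z.
Proof.
move=> xS; rewrite /sigma (@pot_upd_in T _ (fun t => k.+1%:Z - (wt t)%:Z)) //; ring.
Qed.

(** Minimality is lexicographic: fewer active vertices, with any new relation and types, or the same
    active set with fewer arcs, as needed by [edge_deletion]. All graphs live on the same T, so a
    contraction is only a change of relation and of active set. *)
Record mincex h o (T : finType) (g : rel T) (ty : T -> vtype) (A : {set T}) : Prop := {
  mc_h : (0 < h)%N;
  mc_sym : symmetric g;
  mc_irr : irreflexive g;
  mc_ok : forall v, v \in A -> okty (kpar h o) (ty v);
  mc_sp : sparse h o g ty A;
  mc_nc : ~ colorable (kpar h o) g ty A;
  mc_IH : forall (g' : rel T) (ty' : T -> vtype) (A' : {set T}),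
    symmetric g' -> irreflexive g' ->
    (forall v, v \in A' -> okty (kpar h o) (ty' v)) -> sparse h o g' ty' A' ->
    (#|A'| < #|A|)%N -> colorable (kpar h o) g' ty' A';
  mc_IHe : forall (g' : rel T) (ty' : T -> vtype),
    symmetric g' -> irreflexive g' ->
    (forall v, v \in A -> okty (kpar h o) (ty' v)) -> sparse h o g' ty' A ->
    (#|[set p : T * T | g' p.1 p.2]| < #|[set p : T * T | g p.1 p.2]|)%N ->
    colorable (kpar h o) g' ty' A }.

Section MinCex.
Context (h : nat) (o : bool) (T : finType) (g : rel T) (ty : T -> vtype) (A : {set T}).
Context (M : mincex h o g ty A).
Local Notation k := (kpar h o).
Local Notation E := (edgeC h o).
Local Notation I := (indC h o).
Local Notation cost := (cost h o).
Local Notation rho := (rho h o).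
Let h0 := mc_h M.
Let gs := mc_sym M.
Let gi := mc_irr M.
Let ok := mc_ok M.
Let sp := mc_sp M.
Implicit Types (b u v x : T) (S W X C : {set T}).

Lemma rho1 v : rho g ty [set v] = typeC h o (ty v).
Proof. by rewrite /rho pot1. Qed.

Lemma rhoU1 v S : v \notin S ->
  rho g ty (v |: S) = rho g ty S + typeC h o (ty v) - E * (ndeg g v S)%:Z.
Proof. exact: potU1. Qed.

Lemma A_neq0 : A != set0.
Proof.
apply/eqP => A0; apply: (mc_nc M); exists set0; rewrite A0; split.
- exact: sub0set.
- by move=> v; rewrite inE.
- by move=> x y; rewrite !inE.
exact: good0.
Qed.

Lemma sparse_sub W : W \subset A -> sparse h o g ty W.
Proof. by move=> sWA S sSW; apply: sp; apply: subset_trans sWA. Qed.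

Lemma colorable_proper W : W \proper A -> colorable k g ty W.
Proof.
move=> pW; have sWA := proper_sub pW; apply: (mc_IH M) => //; last exact: proper_card.
- by move=> v /(subsetP sWA); apply: ok.
exact: sparse_sub.
Qed.

(** A minimal counterexample is connected: without a boundary edge, colourings of W and of A :\: W
    would combine. *)
Lemma boundary_edge W : W \proper A -> W != set0 ->
  exists b x, [/\ b \in W, x \in A, x \notin W & g b x].
Proof.
move=> pW W0; have sWA := proper_sub pW.
have [/existsP[b /andP[bW /existsP[x /andP[xA gbx]]]]|none] :=
  boolP [exists b in W, exists x in A :\: W, g b x].
  by exists b, x; move: xA; rewrite inE => /andP[-> ->].
have noe b x : b \in W -> x \in A :\: W -> ~~ g b x.
  move=> bW xA; apply: contra none => gbx.
  by apply/existsP; exists b; rewrite bW; apply/existsP; exists x; rewrite xA.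
have pW' : A :\: W \proper A.
  rewrite properE subsetDl; apply/negP => /subsetP sub.
  by case/set0Pn: W0 => w wW; have := sub w (subsetP sWA _ wW); rewrite inE wW.
have [X1 [s1 f1 i1 g1]] := colorable_proper pW.
have [X2 [s2 f2 i2 g2]] := colorable_proper pW'.
case: (mc_nc M); exists (X1 :|: X2); split.
- by rewrite subUset (subset_trans s1) // (subset_trans s2) ?subsetDl.
- move=> v vA vF; rewrite inE; have [vW|vW] := boolP (v \in W); first by rewrite f1.
  by rewrite f2 ?orbT // inE vW.
- move=> x y; rewrite !inE !negb_or => /andP[/andP[x1 x2] xA] /andP[/andP[y1 y2] yA].
  have [xW|xW] := boolP (x \in W); have [yW|yW] := boolP (y \in W).
  + by apply: i1; rewrite inE ?x1 ?y1.
  + by apply: noe; rewrite // inE yW.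
  + by rewrite gs; apply: noe; rewrite // inE xW.
  + by apply: i2; rewrite !inE ?x2 ?y2 ?xW ?yW.
apply: goodU => //.
  rewrite -setI_eq0; apply/eqP/setP => x; rewrite !inE; apply/negP => /andP[/(subsetP s1) xW].
  by move/(subsetP s2); rewrite inE xW.
by move=> x y /(subsetP s1) xW /(subsetP s2); apply: noe.
Qed.

Section EdgeDeletion.
Context (v x : T) (i : nat) (vA : v \in A) (xA : x \in A) (gvx : g v x) (tv : ty v = (true, i)).

(** The edge is traded for extra weights n at v and m at x; with m + n >= k, no component can
    contain both ends. If x is in the forest, the two components contribute at least 2 to [sigma],
    and restoring the edge costs k + 1 while restoring the weights returns m + n. The three
    inequalities keep the new graph sparse on sets containing both ends, only v, or only x. *)
Lemma edge_deletion m n : (k <= m + n)%N -> (i + n <= k)%N ->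
  ((ty x).1 -> ((ty x).2 + m <= k)%N) ->
  cost (i + n) - cost i + cost m <= E ->
  (forall W : {set T}, W \subset A -> v \in W -> x \notin W ->
    -2 <= rho g ty W - (cost (i + n) - cost i)) ->
  (forall W : {set T}, W \subset A -> x \in W -> v \notin W ->
    -2 <= rho g ty W - cost m) -> False.
Proof.
move=> kmn ink xm hE hv hx.
have vx := del_neq gi gvx.
pose t1 := upd x (heavier k m (ty x)) ty.
pose ty' := upd v (true, (i + n)%N) t1.
pose g' := del g v x.
have i0 : (0 < i)%N by have := ok vA; rewrite tv /okty /= => /andP[].
have okx := ok xA.
have tyv : ty' v = (true, (i + n)%N) by rewrite /ty' upd_eq.
have t1v : t1 v = (true, i) by rewrite /t1 upd_neq.
have tyx : ty' x = heavier k m (ty x) by rewrite /ty' upd_neq 1?eq_sym // /t1 upd_eq.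
have tyo u : u != v -> u != x -> ty' u = ty u by move=> uv ux; rewrite /ty' upd_neq // /t1 upd_neq.
have dx := typeC_heavier h0 okx xm.
have rho' W : rho g' ty' W = rho g ty W +
    (if v \in W then cost i - cost (i + n) else 0) +
    (if x \in W then typeC h o (heavier k m (ty x)) - typeC h o (ty x) else 0) +
    (if (v \in W) && (x \in W) then E else 0).
  have -> : rho g' ty' W = rho g ty' W + (if (v \in W) && (x \in W) then E else 0).
    rewrite /rho /pot; case: ifP => [/andP[vW xW]|/negbT/nedges_del_out ->]; last by rewrite addr0.
    by rewrite (nedges_del_in gs gi gvx vW xW) !intS; ring.
  congr (_ + _); rewrite /ty' rho_upd /t1 rho_upd -/t1 t1v.
  have e1 : typeC h o (true, (i + n)%N) = E - cost (i + n) by [].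
  have e2 : typeC h o (true, i) = E - cost i by [].
  by rewrite e1 e2; case: (v \in W); case: (x \in W); ring.
have [X [sX fX iX gX]] : colorable k g' ty' A.
  apply: (mc_IHe M); [exact: del_sym|exact: del_irr| | |exact: arcs_del].
    move=> u uA; have [->|uv] := eqVneq u v; first by rewrite tyv /okty /= addn_gt0 i0.
    have [->|ux] := eqVneq u x; first by rewrite tyx heavier_ok.
    by rewrite tyo // ok.
  move=> W sW W0; rewrite rho'; have := sp sW W0.
  have [vW|vW] := boolP (v \in W); have [xW|xW] := boolP (x \in W) => /=.
  - by move: dx hE; lia0.
  - by have := hv W sW vW xW; lia0.
  - by have := hx W sW xW vW; move: dx; lia0.
  - by rewrite !addr0.
have vX : v \in X by apply: fX => //; rewrite tyv.
have g's := @del_sym _ g gs v x; have g'i := @del_irr _ g gi v x.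
have wx : x \in X -> wt (ty' x) = (wt (ty x) + m)%N.
  move=> xX; have := good_wt g's g'i gX xX; rewrite tyx.
  by case: (wt_heavier h0 m okx) => [->//|->]; rewrite ltnn.
have wle u : u \in X -> (wt (ty u) <= wt (ty' u))%N.
  move=> uX; have [uv|uv] := eqVneq u v; first by rewrite uv tyv tv /wt /= leq_addr.
  by have [ux|ux] := eqVneq u x; [rewrite ux wx -?ux // leq_addr|rewrite tyo].
case: (mc_nc M); exists X; split=> //.
- move=> u uA uF; apply: fX => //; have [->|uv] := eqVneq u v; first by rewrite tyv.
  have [ux|ux] := eqVneq u x; last by rewrite tyo.
  by rewrite ux tyx /heavier -ux uF.
- move=> a b aX bX; have := iX a b aX bX; rewrite /g' /del negb_and negbK => /orP[//|].
  move: aX bX; rewrite !inE => /andP[aX _] /andP[bX _].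
  by case/orP => /andP[/eqP av /eqP bv]; rewrite ?av ?bv vX in aX bX.
move=> S sS S0; have := gX S sS S0.
have [/andP[vS xS]|nvx] := boolP ((v \in S) && (x \in S)); last first.
  move/lt_le_trans; apply; apply: ler_pot => //.
    by move=> u /(subsetP sS)/wle wu; rewrite lerD2l lerN2 lez_nat.
  by rewrite nedges_del_out.
move=> _.
have -> : sigma k g ty S = sigma k g' ty' S + n%:Z + m%:Z - k.+1%:Z.
  have -> : sigma k g ty S = sigma k g' ty S - k.+1%:Z.
    by rewrite /sigma /pot (nedges_del_in gs gi gvx vS xS) !intS; ring.
  have -> : sigma k g' ty' S = sigma k g' t1 S - n%:Z.
    by rewrite /ty' sigma_upd // t1v /wt /= PoszD; ring.
  have -> : sigma k g' t1 S = sigma k g' ty S - m%:Z; last by lia0.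
  by rewrite /t1 sigma_upd // -tyx wx ?(subsetP sS) // PoszD; ring.
suff : 2 <= sigma k g' ty' S by move: kmn; lia0.
have [C [sC vC cC oC]] := component g's g'i vS.
rewrite -/g' in cC oC.
have gS := good_sub sS gX.
have C0 : C != set0 by apply/set0Pn; exists v.
have posC := gS C sC C0.
have xC : x \notin C.
  apply/negP => xC; move: posC; rewrite sigmaE.
  have : (wt (ty' v) + wt (ty' x) <= \sum_(u in C) wt (ty' u))%N.
    by rewrite (bigD1 v) //= (bigD1 x) /= ?xC 1?eq_sym //; lia0.
  rewrite wx ?(subsetP sS) // tyv {1}/wt /=; have := wt_gt0 okx.
  have : k.+1%:Z * (#|C|%:Z - (nedges g' C)%:Z) <= k.+1%:Z * 1.
    by rewrite ler_wpM2l //; move: cC; lia0.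
  by move: kmn i0; lia0.
have dC : [disjoint C & S :\: C].
  by rewrite -setI_eq0; apply/eqP/setP => u; rewrite !inE; case: (u \in C).
have sD : S :\: C \subset S by apply: subsetDl.
have posD : 0 < sigma k g' ty' (S :\: C).
  by apply: gS => //; apply/set0Pn; exists x; rewrite inE xC.
have -> : S = C :|: S :\: C by rewrite -{1}(setID S C) (setIidPr sC).
rewrite sigma_disjU // cutC // /cut big1 => [|u]; first by rewrite mulr0 subr0; move: posC posD; lia0.
by rewrite inE => /andP[uC uS]; apply: oC.
Qed.
End EdgeDeletion.
End MinCex.

(** * The potential gap for proper sets *)

Section Gap.
Context (h : nat) (o : bool) (T : finType) (g : rel T) (ty : T -> vtype) (A : {set T}).
Context (M : mincex h o g ty A).
Local Notation k := (kpar h o).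
Local Notation E := (edgeC h o).
Local Notation I := (indC h o).
Local Notation cost := (cost h o).
Local Notation rho := (rho h o).
Let h0 := mc_h M.
Let gs := mc_sym M.
Let gi := mc_irr M.
Let ok := mc_ok M.
Let sp := mc_sp M.
Implicit Types (b u v x : T) (S W X C : {set T}).

Lemma adjacentF v x i : v \in A -> x \in A -> g v x -> ty v = (true, i) ->
  (ty x).1 -> ((ty x).2 + i <= k)%N.
Proof.
move=> vA xA gvx tv xF; rewrite leqNgt; apply/negP => big.
have vx : v \notin [set x] by rewrite inE (del_neq gi gvx).
have : -2 <= rho g ty (v |: [set x]).
  apply: sp; first by rewrite subUset !sub1set vA.
  by apply/set0Pn; exists v; rewrite setU11.
rewrite (rhoU1 M) // (rho1 M) ndeg_set1 gvx tv /typeC xF /=.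
have := ok vA; have := ok xA; rewrite /okty tv xF /= => /andP[_ xk] /andP[_ ik].
by have := cost_big h0 xk ik big; lia0.
Qed.

(** Here v is raised to the full weight k, so that it stands alone, and x takes over its weight i.
    Sets with x but not v can afford cost i, because adding v to them lowers the potential by at
    least that much. *)
Lemma fullF_edge v x i : v \in A -> x \in A -> g v x -> ty v = (true, i) ->
  (forall W, W \subset A -> v \in W -> x \notin W -> E - cost i - 2 <= rho g ty W) ->
  False.
Proof.
move=> vA xA gvx tv hW.
have ik : (i <= k)%N by have := ok vA; rewrite tv /okty /= => /andP[].
apply: (@edge_deletion _ _ _ _ _ _ M v x i vA xA gvx tv i (k - i)); rewrite ?subnKC //.
- exact: (adjacentF vA xA gvx tv).
- by rewrite cost_k // subrK.
- by move=> W sW vW xW; have := hW W sW vW xW; rewrite cost_k //; lia0.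
move=> W sW xW vW; have : -2 <= rho g ty (v |: W).
  apply: sp; first by rewrite subUset sub1set vA.
  by apply/set0Pn; exists v; rewrite setU11.
rewrite (rhoU1 M) // tv /typeC /=.
have d1 : (0 < ndeg g v W)%N by apply: ndeg_gt0 gvx.
have := edgeC_mul o h0 d1.
by lia0.
Qed.

Section LowSet.
Context (W : {set T}) (pW : W \proper A) (W2 : (1 < #|W|)%N).
Context (mW : forall S, S \proper A -> (1 < #|S|)%N -> rho g ty W <= rho g ty S).
Context (lowW : rho g ty W <= I).
Let sWA : W \subset A := proper_sub pW.

Lemma low_ge2 : -2 <= rho g ty W.
Proof. by apply: sp => //; rewrite -card_gt0; apply: leq_trans W2. Qed.

Lemma low_typeF v i : v \in A -> ty v = (true, i) -> rho g ty W + 3 <= E - cost i.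
Proof.
move=> vA tv; rewrite leNgt; apply/negP => lt.
have cA : (2 < #|A|)%N by apply: leq_trans (proper_card pW).
have pv : [set v] \proper A.
  rewrite properE sub1set vA; apply/negP => /subset_leq_card.
  by rewrite cards1 leqNgt; case/negP; apply: leq_trans cA.
have v0 : [set v] != set0 by apply/set0Pn; exists v; rewrite inE.
have [b [x [/set1P -> xA _ gvx]]] := boundary_edge M pv v0.
apply: (fullF_edge vA xA gvx tv) => S sS vS xS.
have [S2|S1] := ltnP 1 #|S|.
  have pS : S \proper A by apply/properP; split=> //; exists x.
  by have := mW pS S2; move: lt; lia0.
have -> : S = [set v] by apply/eqP; rewrite eq_sym eqEcard sub1set vS cards1.
by rewrite (rho1 M) tv /typeC /=; lia0.
Qed.

(** Two neighbours in W would bring the union down to I + (E + I) - 2E = -3. *)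
Lemma low_deg x : x \in A -> x \notin W -> (ndeg g x W <= 1)%N.
Proof.
move=> xA xW; rewrite leqNgt; apply/negP => d2.
have : -2 <= rho g ty (x |: W).
  apply: sp; first by rewrite subUset sub1set xA.
  by apply/set0Pn; exists x; rewrite setU11.
rewrite (rhoU1 M) //; have := typeC_le o h0 (ty x); have := indC2 o h0.
have := edgeC_mul o h0 d2.
by move: lowW; lia0.
Qed.

(** A neighbour U_k would give a union of potential at most 2I - E = -3. A forced neighbour would
    push the potential below the minimum attained by W, unless the union is all of A. *)
Lemma low_typeU x : x \in A -> x \notin W -> (0 < ndeg g x W)%N ->
  ty x = (false, (ty x).2) /\ ((ty x).2 < k)%N.
Proof.
move=> xA xW d0.
have d1 : ndeg g x W = 1%N by apply/eqP; rewrite eqn_leq low_deg.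
have xU : x |: W \subset A by rewrite subUset sub1set xA.
have xU0 : x |: W != set0 by apply/set0Pn; exists x; rewrite setU11.
have rx : rho g ty (x |: W) = rho g ty W + typeC h o (ty x) - E.
  by rewrite (rhoU1 M) // d1 mulr1.
case tx: (ty x) => [[] a] /=; last first.
  split=> //; have := ok xA; rewrite tx /okty /= leq_eqVlt => /orP[/eqP ak|//].
  have := sp xU xU0; rewrite rx tx /typeC /= ak cost_k //; have := indC2 o h0.
  by move: lowW; lia0.
have a0 : (0 < a)%N by have := ok xA; rewrite tx /okty /= => /andP[].
have [eqA|neA] := eqVneq (x |: W) A; last first.
  have := mW (S := x |: W); rewrite properEneq neA xU => /(_ isT).
  rewrite cardsU1 xW ltnS => /(_ (ltnW W2)); rewrite rx tx /typeC /=.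
  by have := cost_ge o h0 a; move: a0; lia0.
have [b bW gxb] := ndeg_gt0E d0.
(* Now A is W together with x, and b is the only neighbour of x; a set that contains x and avoids b
   therefore has x isolated, so its potential splits. *)
case: (@fullF_edge x b a) => //; first exact: (subsetP sWA).
move=> S sS xS bS.
rewrite -(setD1K xS) (rhoU1 M) ?inE ?eqxx // tx /typeC /=.
have -> : ndeg g x (S :\ x) = 0%N.
  apply: ndeg0P => u; rewrite !inE => /andP[ux uS]; apply/negP => gxu.
  have uW : u \in W by have := subsetP sS u uS; rewrite -eqA !inE (negbTE ux).
  have ub : u != b by apply: contraNneq bS => <-.
  have uWb : u \in W :\ b by rewrite !inE ub.
  by have := ndeg_gt0 uWb gxu; move: d1; rewrite (ndegD1 g x bW) gxb; lia0.
have [->|S0] := eqVneq (S :\ x) set0; first by rewrite /rho pot0; lia0.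
have sS' : S :\ x \subset A by apply: subset_trans sS; apply: subD1set.
by have := sp sS' S0; lia0.
Qed.

(** Subsets of W with two or more vertices have at least the potential of W and can pay 3 per unit
    of weight; single vertices stay nonnegative anyway. The last clause says that the component of b
    weighs at most k - m. *)
Lemma raised_coloring b m : b \in W -> (3 * m)%:Z <= rho g ty W + 2 ->
  exists X, [/\ X \subset W, forall v, v \in W -> (ty v).1 -> v \in X,
     forall x y, x \in W :\: X -> y \in W :\: X -> ~~ g x y, good k g ty X &
     forall S, S \subset X -> b \in S -> m%:Z < sigma k g ty S].
Proof.
move=> bW m3; have bA := subsetP sWA b bW; have okb := ok bA.
have bm : (ty b).1 -> ((ty b).2 + m <= k)%N.
  case tb : (ty b) => [[] i] //= _; have := low_typeF bA tb.
  have := cost_le3 o h0 i; move: okb; rewrite tb /okty /= => /andP[_ ik] ci lo.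
  rewrite leqNgt; apply/negP => big.
  have mk : (m <= k)%N by par h o; move: m3 lowW; lia.
  by have := cost_big h0 ik mk big; have := cost_le3 o h0 m; move: m3 lo; lia0.
have [X [sX fX iX gX]] : colorable k g (raise k b m ty) W.
  apply: (mc_IH M) => //; last exact: proper_card.
    move=> v vW; rewrite /raise; have [->|vb] := eqVneq v b.
      by rewrite upd_eq heavier_ok.
    by rewrite upd_neq // ok // (subsetP sWA).
  move=> S sSW S0; have sSA := subset_trans sSW sWA.
  have [S2|S1] := ltnP 1 #|S|.
    have pS : S \proper A by apply: sub_proper_trans pW.
    rewrite /raise rho_upd; have := mW pS S2; have := typeC_heavier h0 okb bm.
    have := cost_le3 o h0 m; have := low_ge2; move: m3.
    by case: (b \in S); lia0.
  have [bS|bS] := boolP (b \in S); last by rewrite /raise rho_upd (negbTE bS) addr0 sp.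
  have -> : S = [set b] by apply/eqP; rewrite eq_sym eqEcard sub1set bS cards1.
  rewrite /rho pot1 // /raise upd_eq.
  by have := typeC_ge0 h0 (heavier_ok h0 okb bm); lia0.
have wb : b \in X -> wt (heavier k m (ty b)) = (wt (ty b) + m)%N.
  move=> bX; have := good_wt gs gi gX bX; rewrite /raise upd_eq.
  by case: (wt_heavier h0 m okb) => [->//|->]; rewrite ltnn.
exists X; split=> //.
- move=> v vW vF; apply: fX => //; rewrite /raise; have [vb|vb] := eqVneq v b.
    by rewrite vb upd_eq /heavier -vb vF.
  by rewrite upd_neq.
- apply: good_le gX => // v vX; rewrite /raise; have [vb|vb] := eqVneq v b.
    by rewrite vb upd_eq wb -?vb ?leq_addr.
  by rewrite upd_neq.
move=> S sS bS; have S0 : S != set0 by apply/set0Pn; exists b.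
have := gX S sS S0; rewrite /raise sigma_upd // wb ?(subsetP sS) //.
by move: (sigma _ _ _ _); lia0.
Qed.

(* W is coloured by X1, with b made as heavy as the potential allows. Neighbours of
   W :\: X1 become forest vertices, and if b is in X1, its component C is contracted
   to b, now of type F_wC; neighbours of X1 :\: C become U_k. *)
Lemma low_False : False.
Proof.
have W0 : W != set0 by rewrite -card_gt0; apply: leq_trans W2.
have [b [x0 [bW x0A x0W gbx0]]] := boundary_edge M pW W0.
have [q pq] : exists q : nat, rho g ty W + 2 = q%:Z.
  exists (absz (rho g ty W + 2)); rewrite gez0_abs //.
  by have := low_ge2; move: (rho _ _ _); lia0.
(* The largest raise that the potential can pay for. The remainder is at most 2, the slack allowed
   by [sparse], so the potential of W is at most 3m. *)
pose m := (q %/ 3)%N.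
have m3 : (3 * m)%:Z <= rho g ty W + 2 by rewrite pq /m; lia.
have m3' : rho g ty W + 2 < (3 * m)%:Z + 3 by rewrite pq /m; lia.
have [X1 [s1 f1 i1 g1 gb]] := raised_coloring bW m3.
have [C [sC bC bC' cC oC]] : exists C, [/\ C \subset X1, b \in X1 -> b \in C,
    (exists x, x \in C) -> b \in X1, (#|C| <= nedges g C + 1)%N &
    forall x, x \in X1 -> x \notin C -> ndeg g x C = 0%N].
  have [bX|bX] := boolP (b \in X1).
    by have [C [? ? ? ?]] := component gs gi bX; exists C; split.
  exists set0; split; rewrite ?sub0set ?cards0 //; first by case=> x; rewrite inE.
  by move=> x _ _; apply: ndeg0P => u; rewrite inE.
pose wC := (\sum_(v in C) wt (ty v))%N.
pose bset := if b \in X1 then [set b] else set0.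
pose A' := (A :\: W) :|: bset.
pose ty' x := if x == b then (true, wC) else
  if (0 < ndeg g x (W :\: X1))%N then (true, (ty x).2.+1) else
  if (0 < ndeg g x (X1 :\: C))%N then (false, k) else ty x.
pose g' a c := if a == b then (c \notin W) && (0 < ndeg g c C)%N else
  if c == b then (a \notin W) && (0 < ndeg g a C)%N else g a c.
have g's : symmetric g'.
  by move=> a c; rewrite /g'; case: eqP => [->|_]; case: eqP => // ->.
have g'i : irreflexive g' by move=> a; rewrite /g'; case: eqP => [->|_]; rewrite ?bW ?gi.
have outb x : x \notin W -> x != b by move=> xW; apply: contraNneq xW => ->.
have g'out : {in ~: W &, g' =2 g}.
  by move=> x y; rewrite !inE /g' => /outb/negbTE -> /outb/negbTE ->.
have splitW : W = (W :\: X1) :|: ((X1 :\: C) :|: C).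
  apply/setP => x; rewrite !inE; have [xC|xC] := boolP (x \in C).
    by rewrite (subsetP sC x xC) (subsetP s1) // (subsetP sC).
  by have [x1|x1] := boolP (x \in X1); rewrite ?(subsetP s1 x x1) ?orbF.
have dW x : ndeg g x W = (ndeg g x (W :\: X1) + (ndeg g x (X1 :\: C) + ndeg g x C))%N.
  have d1 : [disjoint X1 :\: C & C].
    by rewrite -setI_eq0; apply/eqP/setP => u; rewrite !inE; case: (u \in C); rewrite ?andbF.
  have d2 : [disjoint W :\: X1 & (X1 :\: C) :|: C].
    rewrite -setI_eq0; apply/eqP/setP => u; rewrite !inE.
    have [uC|uC] := boolP (u \in C); first by rewrite (subsetP sC u uC).
    by case: (u \in X1); rewrite ?andbF.
  by rewrite {1}splitW !ndegU.
have C_b : b \in X1 -> (0 < wC)%N /\ (wC + m <= k)%N.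
  move=> bX; have bC1 := bC bX; split.
    by rewrite /wC (bigD1 b) //=; have := wt_gt0 (ok (subsetP sWA b bW)); lia0.
  have := gb C sC bC1; rewrite sigmaE -/wC.
  have : k.+1%:Z * (#|C|%:Z - (nedges g C)%:Z) <= k.+1%:Z * 1.
    by rewrite ler_wpM2l //; move: cC; lia0.
  by lia0.
have Ige : 0 <= I by rewrite ltW // indC_gt0.
(* The only possible neighbour of x in W lies in one of three places. Outside X1, x becomes forced
   and all but I of the lost edge is used up; in X1 :\: C, x becomes U_k, at a price of at most E;
   in C, the edge survives as an edge to b. *)
have vbound x : x \in A -> x \notin W ->
  typeC h o (ty x) - E * (ndeg g x W)%:Z + I * (ndeg g x (W :\: X1))%:Z +
    E * (ndeg g x C)%:Z <= typeC h o (ty' x).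
  move=> xA xW; have := low_deg xA xW; have := low_typeU xA xW.
  rewrite dW /ty' (negbTE (outb x xW)).
  case: (ndeg g x (W :\: X1)) => [|[|?]]; case: (ndeg g x (X1 :\: C)) => [|[|?]];
    case: (ndeg g x C) => [|[|?]] //=; rewrite ?mulr0 ?mulr1 ?subr0 ?addr0 //.
  - by move=> _ _; rewrite subrK.
  - move=> /(_ isT)[-> xk] _; rewrite /typeC /= cost_k //.
    by have := cost_ge0 o h0 (ty x).2; lia0.
  - move=> /(_ isT)[-> xk] _; rewrite /typeC /=.
    by have := cost_succ o h0 (ty x).2; have := indC2 o h0; lia0.
have key S : S \subset A -> [disjoint W & S] ->
    rho g ty (W :|: S) + I * (\sum_(x in S) ndeg g x (W :\: X1))%N%:Z
    + E * (\sum_(x in S) ndeg g x C)%N%:Z <= rho g' ty' S + rho g ty W.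
  move=> sS dWS.
  have SW x : x \in S -> x \notin W by move=> xS; rewrite (disjointFl dWS xS).
  rewrite /rho potU // cutC // /cut {2 3}/pot.
  rewrite (@eq_nedges _ g' g); last first.
    by move=> x y /SW xW /SW yW; rewrite g'out ?inE.
  rewrite !(big_morph Posz PoszD (erefl _)).
  have : \sum_(x in S) (typeC h o (ty x) - E * (ndeg g x W)%:Z + I * (ndeg g x (W :\: X1))%:Z +
    E * (ndeg g x C)%:Z) <= \sum_(x in S) typeC h o (ty' x).
    by apply: ler_sum => x xS; apply: vbound; rewrite ?(subsetP sS) ?SW.
  rewrite !big_split /= sumrN -!mulr_sumr.
  by move: (\sum_(x in S) _) (\sum_(x in S) _) (\sum_(x in S) _) (\sum_(x in S) _) (\sum_(x in S) _); lia0.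
have bA' : b \in A' -> b \in X1.
  by rewrite !inE bW /= /bset; case: ifP => //; rewrite inE.
have sub_out S : S \subset A' -> b \notin S -> S \subset A /\ [disjoint W & S].
  move=> sS bS; have SD x : x \in S -> x \in A :\: W.
    move=> xS; have := subsetP sS x xS; rewrite inE => /orP[//|]; rewrite /bset.
    case: ifP => _; rewrite inE // => /eqP xb; by rewrite -xb xS in bS.
  split; first by apply/subsetP => x /SD; rewrite inE => /andP[].
  by rewrite disjoint_sym disjoints_subset; apply/subsetP => x /SD; rewrite !inE => /andP[].
have ndegb S : S \subset A -> [disjoint W & S] ->
    ndeg g' b S = (\sum_(x in S) ndeg g x C)%N.
  move=> sS dWS; rewrite /ndeg -sum1dep_card big_mkcondr; apply: eq_bigr => x xS.
  have xW : x \notin W by rewrite (disjointFl dWS xS).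
  rewrite /g' eqxx xW /= -/(ndeg g x C); have := low_deg (subsetP sS x xS) xW.
  by rewrite dW; case: (ndeg g x C) => [|[|?]] //; lia0.
have [X2 [s2 f2 i2 g2]] : colorable k g' ty' A'.
  apply: (mc_IH M) => //.
  - move=> v vA'; rewrite /ty'; case: (eqVneq v b) vA' => [-> /bA' /C_b[]|vb vA'].
      by rewrite /okty /=; lia0.
    have /andP[vW vA] : (v \notin W) && (v \in A).
      move: vA'; rewrite !inE => /orP[//|]; rewrite /bset.
      by case: ifP => _; rewrite inE // (negbTE vb).
    case: ifP => dI; last by case: ifP => // _; [rewrite /okty /=|exact: ok].
    have [|_] := low_typeU vA vW; first by rewrite dW; move: dI; lia0.
    by rewrite /okty /=.
  - move=> S sS S0; have [bS|bS] := boolP (b \in S); last first.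
      have [sSA dS] := sub_out S sS bS.
      have := key S sSA dS; set sI := (\sum_(x in S) ndeg g x (W :\: X1))%N.
      set sCn := (\sum_(x in S) ndeg g x C)%N => ks.
      have sI0 : 0 <= I * sI%:Z by rewrite mulr_ge0.
      have sC0 : 0 <= E * sCn%:Z by rewrite mulr_ge0 ?edgeC_ge0.
      have sWS : W :|: S \subset A by rewrite subUset sWA.
      have [eqA|neA] := eqVneq (W :|: S) A; last first.
        have pWS : W :|: S \proper A by rewrite properEneq neA.
        have cWS : (1 < #|W :|: S|)%N by apply: leq_trans W2 (subset_leq_card (subsetUl _ _)).
        by have := mW pWS cWS; move: ks sI0 sC0; lia0.
      have x0S : x0 \in S by move: x0A; rewrite -eqA inE (negbTE x0W).
      have spA := sp (subxx A) (A_neq0 M).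
      have x0b : g x0 b by rewrite gs.
      (* When S and W exhaust A, the minimality of W says nothing about the union. The boundary edge
         from x0 to b makes up for it: it is worth at least I, hence at least the potential of W. *)
      have big : I <= I * sI%:Z + E * sCn%:Z.
        have [bX|bX] := boolP (b \in X1).
          have : (0 < sCn)%N by rewrite /sCn (bigD1 x0) //= addn_gt0 (ndeg_gt0 (bC bX)).
          move/(edgeC_mul o h0).
          by move: sI0; have := indC2 o h0; move: Ige; lia0.
        have bWX : b \in W :\: X1 by rewrite inE bX.
        have : (0 < sI)%N by rewrite /sI (bigD1 x0) //= addn_gt0 (ndeg_gt0 bWX).
        move=> s0; have : I * 1 <= I * sI%:Z by rewrite ler_wpM2l.
        by move: sC0; lia0.
      by move: ks; rewrite eqA; move: spA big lowW; lia0.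
    have bX := bA' (subsetP sS b bS); have [wC0 wCm] := C_b bX.
    have bS' : b \notin S :\ b by rewrite !inE eqxx.
    have sS' : S :\ b \subset A' by apply: subset_trans sS; apply: subD1set.
    have [sSA dS] := sub_out _ sS' bS'.
    have := key _ sSA dS; rewrite -(ndegb _ sSA dS).
    have sI0 : 0 <= I * (\sum_(x in S :\ b) ndeg g x (W :\: X1))%N%:Z by rewrite mulr_ge0.
    have tb : typeC h o (ty' b) = E - cost wC by rewrite /ty' eqxx.
    have -> : rho g' ty' S = rho g' ty' (S :\ b) + (E - cost wC) -
        E * (ndeg g' b (S :\ b))%:Z.
      by rewrite -{1}(setD1K bS) /rho (potU1 g's g'i) // tb.
    have : -2 <= rho g ty (W :|: S :\ b).
      apply: sp; first by rewrite subUset sWA.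
      by apply: contra_neq W0 => WS; apply/eqP; rewrite -subset0 -WS subsetUl.
    have : rho g ty W <= E - cost wC.
      exact: (low_weight h0 wCm lowW m3').
    by move: sI0; lia0.
  rewrite /A'; apply: leq_ltn_trans (leq_card_setU _ _) _.
  have : (#|bset| <= 1)%N by rewrite /bset; case: ifP; rewrite ?cards1 ?cards0.
  by rewrite cardsD (setIidPr sWA); have := subset_leq_card sWA; move: W2; lia0.
have outA' x : x \in A -> x \notin W -> x \in A' by move=> xA xW; rewrite !inE xA xW.
have X2W x : x \in X2 -> x \in W -> x \in X1.
  move=> /(subsetP s2); rewrite !inE => /orP[/andP[/negP //]|].
  by rewrite /bset; case: ifP => bX; rewrite inE // => /eqP ->.
have X2A x : x \in X2 -> x \notin W -> x \in A.
  move=> /(subsetP s2); rewrite !inE => /orP[/andP[]//|].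
  by rewrite /bset; case: ifP => bX; rewrite inE // => /eqP ->; rewrite bW.
have noXC x : x \in X2 -> x \notin W -> ndeg g x (X1 :\: C) = 0%N.
  move=> x2 xW; apply/eqP; rewrite -leqn0 leqNgt; apply/negP => d0.
  have := good_wt g's g'i g2 x2; rewrite /ty' (negbTE (outb x xW)) d0.
  have := low_deg (X2A x x2 xW) xW; rewrite dW.
  case: ifP => [|_ _]; last by rewrite /wt /= ltnn.
  by move: d0; lia0.
have wle x : x \in X2 -> x \notin W -> (wt (ty x) <= wt (ty' x))%N.
  move=> x2 xW; rewrite /ty' (negbTE (outb x xW)).
  case: ifP => [dI|_]; last by rewrite noXC.
  have [|-> _] := low_typeU (X2A x x2 xW) xW; first by rewrite dW; move: dI; lia0.
  by rewrite /wt.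
case: (mc_nc M); exists (X1 :|: X2); split.
- rewrite subUset (subset_trans s1) //=; apply/subsetP => x x2.
  have [xW|xW] := boolP (x \in W); first exact: (subsetP sWA).
  exact: X2A.
- move=> v vA vF; rewrite inE; have [vW|vW] := boolP (v \in W); first by rewrite f1.
  rewrite f2 ?orbT ?outA' // /ty' (negbTE (outb v vW)).
  case: ifP => // _; case: ifP => // dX; have [|] := low_typeU vA vW; first by rewrite dW; move: dX; lia0.
  by move=> e; move: vF; rewrite e.
- move=> x y; rewrite !inE !negb_or => /andP[/andP[x1 x2] xA] /andP[/andP[y1 y2] yA].
  have cross u w : u \in W -> u \notin X1 -> w \in A -> w \notin W -> w \notin X2 -> ~~ g u w.
    move=> uW uX wA wW w2; apply: contra w2 => guw; apply: f2; first exact: outA'.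
    have uWX : u \in W :\: X1 by rewrite inE uX.
    by rewrite /ty' (negbTE (outb w wW)) (ndeg_gt0 uWX) // gs.
  have [xW|xW] := boolP (x \in W); have [yW|yW] := boolP (y \in W).
  + by apply: i1; rewrite inE ?x1 ?y1.
  + exact: cross.
  + by rewrite gs; apply: cross.
  + by rewrite -g'out ?inE //; apply: i2; rewrite inE ?x2 ?y2 outA'.
move=> S sS S0.
pose S1 := S :&: W; pose S2 := S :\: W.
have dS : [disjoint S1 & S2].
  by rewrite -setI_eq0; apply/eqP/setP => x; rewrite !inE; case: (x \in W); rewrite ?andbF.
have sS1 : S1 \subset X1.
  apply/subsetP => x; rewrite inE => /andP[/(subsetP sS) + xW].
  by rewrite inE => /orP[//|x2]; apply: X2W.
have sS2 : S2 \subset X2.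
  apply/subsetP => x; rewrite inE => /andP[xW /(subsetP sS)].
  by rewrite inE => /orP[/(subsetP s1) xW'|//]; rewrite xW' in xW.
have S2W x : x \in S2 -> x \notin W by rewrite inE => /andP[].
have dWS2 : [disjoint W & S2].
  by rewrite disjoint_sym disjoints_subset; apply/subsetP => x /S2W; rewrite inE.
have sS2A : S2 \subset A by apply/subsetP => x x2; apply: X2A (S2W x x2); apply: (subsetP sS2).
have le2 : sigma k g' ty' S2 <= sigma k g ty S2.
  apply: ler_pot => // [x x2|].
    by rewrite lerD2l lerN2 lez_nat wle ?S2W // (subsetP sS2).
  by rewrite (@eq_nedges _ g' g) // => x y /S2W xW /S2W yW; rewrite g'out ?inE.
have ge1 := good_ge0 g1 sS1.
have eS : S = S1 :|: S2 by rewrite setID.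
have degX1 y : y \in S2 -> ndeg g y X1 = ndeg g y C.
  move=> y2; have e1 : X1 = (X1 :\: C) :|: C.
    apply/setP => x; rewrite !inE; have [xC|_] := boolP (x \in C); last by rewrite orbF.
    by rewrite (subsetP sC).
  have d1 : [disjoint X1 :\: C & C].
    by rewrite -setI_eq0; apply/eqP/setP => x; rewrite !inE; case: (x \in C); rewrite ?andbF.
  by rewrite {1}e1 ndegU // noXC ?S2W // (subsetP sS2).
rewrite eS sigma_disjU //.
have [SC|/set0Pn[c cSC]] := eqVneq (S1 :&: C) set0.
  rewrite cut_eq0 => [|x y x1 y2]; last first.
    apply/negP => gxy; have xX := subsetP sS1 x x1.
    have xC : x \notin C by apply/negP => xC; have := in_set0 x; rewrite -SC inE x1 xC.
    have xD : x \in X1 :\: C by rewrite inE xC.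
    have := noXC y (subsetP sS2 y y2) (S2W y y2).
    by have := @ndeg_gt0 _ g y x _ xD; rewrite gs => /(_ gxy); lia0.
  rewrite mulr0 subr0.
  have [e1|n1] := eqVneq S1 set0; last first.
    by have := g1 _ sS1 n1; have := good_ge0 g2 sS2; move: le2; lia0.
  have n2 : S2 != set0 by apply: contra_neq S0 => e2; rewrite eS e1 e2 setU0.
  by have := g2 _ sS2 n2; move: le2 ge1; lia0.
move: (cSC); rewrite inE => /andP[cS1 cC1].
have bX : b \in X1 by apply: bC'; exists c.
have bAA : b \in A' by rewrite !inE /bset bX inE eqxx orbT.
have bX2 : b \in X2 by apply: f2; rewrite // /ty' eqxx.
have bS2 : b \notin S2 by rewrite inE bW.
have sb : b |: S2 \subset X2 by rewrite subUset sub1set bX2.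
have nb : b |: S2 != set0 by apply/set0Pn; exists b; rewrite setU11.
have := g2 _ sb nb; rewrite {1}/sigma (potU1 g's g'i) // -/(sigma _ _ _ _) ndegb //.
have -> : ty' b = (true, wC) by rewrite /ty' eqxx.
rewrite /wt /= -/(wt _).
have cutle : (cut g S1 S2 <= \sum_(x in S2) ndeg g x C)%N.
  by rewrite cutC // /cut; apply: leq_sum => y y2; rewrite -degX1 // ndegS.
(* S1 meets C, and a nonempty good set has more vertices than edges; so S1 does at least as well as
   the contracted vertex b of weight wC, and goodness of X2 at b |: S2 carries over. *)
have s1ge : k.+1%:Z - wC%:Z <= sigma k g ty S1.
  have eS1 : S1 = (S1 :&: C) :|: (S1 :\: C) by rewrite setID.
  have dSC : [disjoint S1 :&: C & S1 :\: C].
    by rewrite -setI_eq0; apply/eqP/setP => x; rewrite !inE; case: (x \in C); rewrite ?andbF.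
  have sC1 : S1 :&: C \subset X1 by apply: subset_trans sS1; apply: subsetIl.
  have sD1 : S1 :\: C \subset X1 by apply: subset_trans sS1; apply: subsetDl.
  rewrite {1}eS1 sigma_disjU // cut_eq0 => [|x y]; last first.
    rewrite inE => /andP[_ xC]; rewrite inE => /andP[yC /(subsetP sS1) yX]; apply/negP => gxy.
    by have := oC y yX yC; have := @ndeg_gt0 _ g y x _ xC; rewrite gs => /(_ gxy); lia0.
  have nSC : S1 :&: C != set0 by apply/set0Pn; exists c.
  have := g1 _ sC1 nSC; have := good_ge0 g1 sD1; rewrite (sigmaE _ _ _ (S1 :&: C)).
  have : (\sum_(v in S1 :&: C) wt (ty v) <= wC)%N.
    rewrite /wC [leqRHS](bigID (mem S1)) /= (eq_bigl (fun v => (v \in C) && (v \in S1))) ?leq_addr //.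
    by move=> v; rewrite inE andbC.
  set n := #|_|; set e := nedges _ _; move=> wle' s0.
  have [en|ne] := ltnP e n.
    have : k.+1%:Z * 1 <= k.+1%:Z * (n%:Z - e%:Z) by rewrite ler_wpM2l //; move: en; lia0.
    by move: wle' s0; lia0.
  have : k.+1%:Z * (n%:Z - e%:Z) <= k.+1%:Z * 0 by rewrite ler_wpM2l //; move: ne; lia0.
  by move: wle' s0; lia0.
have : k.+1%:Z * (cut g S1 S2)%:Z <= k.+1%:Z * (\sum_(x in S2) ndeg g x C)%N%:Z.
  by rewrite ler_wpM2l.
by move: s1ge le2; lia0.
Qed.
End LowSet.

Lemma gap W : W \proper A -> (1 < #|W|)%N -> I + 1 <= rho g ty W.
Proof.
move=> pW W2; pose P W := (W \proper A) && (1 < #|W|)%N.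
have PW : P W by rewrite /P pW.
case: (arg_minP (rho g ty) PW) => W1 /andP[pW1 W12] mW1.
rewrite leNgt; apply/negP => lt.
apply: (@low_False W1) => //; first by move=> S pS S2; apply: mW1; rewrite /P pS.
by have := mW1 W PW; move: lt; lia0.
Qed.
End Gap.

(** * Configurations excluded by the gap *)

Section Reductions.
Context (h : nat) (o : bool) (T : finType) (g : rel T) (ty : T -> vtype) (A : {set T}).
Context (M : mincex h o g ty A).
Local Notation k := (kpar h o).
Local Notation E := (edgeC h o).
Local Notation I := (indC h o).
Local Notation cost := (cost h o).
Local Notation rho := (rho h o).
Let h0 := mc_h M.
Let gs := mc_sym M.
Let gi := mc_irr M.
Let ok := mc_ok M.
Let sp := mc_sp M.
Implicit Types (a b c u v x y : T) (S W X Y C D : {set T}).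

Lemma card_A : (1 < #|A|)%N.
Proof.
rewrite ltnNge; apply/negP => A1; case: (mc_nc M).
have /set0Pn[v vA] := A_neq0 M.
have AE : A = [set v] by apply/esym/eqP; rewrite eqEcard sub1set vA cards1.
exists (if (ty v).1 then [set v] else set0); split.
- by rewrite AE; case: ifP => _; rewrite ?sub0set.
- by move=> u; rewrite AE inE => /eqP -> ->; rewrite inE.
- by move=> x y; rewrite AE !inE => /andP[_ /eqP ->] /andP[_ /eqP ->]; rewrite gi.
case: ifP => vF; last exact: good0.
move=> S; rewrite subset1 => /orP[] /eqP -> => [_|]; last by rewrite eqxx.
rewrite /sigma pot1 //; have := ok vA; rewrite /okty /wt vF => /andP[_].
by lia0.
Qed.

Lemma neighbor v : v \in A -> exists2 x, x \in A & g v x.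
Proof.
move=> vA; have v0 : [set v] != set0 by apply/set0Pn; exists v; rewrite inE.
have pv : [set v] \proper A.
  rewrite properE sub1set vA; apply/negP => /subset_leq_card.
  by rewrite cards1 leqNgt card_A.
by have [b [x [/set1P -> xA _ gvx]]] := boundary_edge M pv v0; exists x.
Qed.

Lemma gap_or1 W v x : W \subset A -> v \in W -> x \in A -> x \notin W ->
  W = [set v] \/ I + 1 <= rho g ty W.
Proof.
move=> sW vW xA xW; have pW : W \proper A by apply/properP; split=> //; exists x.
have [W2|W1] := ltnP 1 #|W|; first by right; apply: (gap M).
by left; apply/esym/eqP; rewrite eqEcard sub1set vW cards1.
Qed.

Lemma heavyF v x i : v \in A -> x \in A -> g v x -> ty v = (true, i) ->
  I + 3 < E - cost i.
Proof.
move=> vA xA gvx tv; rewrite ltNge; apply/negP => le.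
apply: (fullF_edge M vA xA gvx tv) => W sW vW xW.
have [->|] := gap_or1 sW vW xA xW; last by move: le; lia0.
by rewrite (rho1 M) tv /typeC /=; lia0.
Qed.

(** By [heavyF] a forced vertex has weight below h. Splitting k evenly in [edge_deletion], h for x
    and k - h for v, makes either raise cost at most I + 3, which the gap covers. *)
Lemma not_typeF v : v \in A -> (ty v).1 = false.
Proof.
move=> vA; apply/negP => vF; have [x xA gvx] := neighbor vA.
have tv : ty v = (true, (ty v).2) by rewrite -{1}vF; case: (ty v).
set i := (ty v).2 in tv.
have hi := heavyF vA xA gvx tv.
have i0 : (0 < i)%N by have := ok vA; rewrite tv /okty /= => /andP[].
have ih : (i < h)%N by apply: light_cost hi.
have ch : cost h = (3 * h)%:Z by apply: cost_lin.
have ci : cost i = (3 * i)%:Z by apply: cost_lin => //; apply: ltnW.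
have cin : cost (i + (k - h)) = (3 * i)%:Z + (3 * h)%:Z + 2 * o%:Z - 1 by apply: cost_half; rewrite ?i0.
apply: (@edge_deletion _ _ _ _ _ _ M v x i vA xA gvx tv h (k - h)).
- by par0 h o h0.
- by move: ih; par0 h o h0.
- move=> xF; have tx : ty x = (true, (ty x).2) by rewrite -{1}xF; case: (ty x).
  have := heavyF xA vA _ tx; rewrite gs => /(_ gvx) /(light_cost h0).
  by par0 h o h0.
- by rewrite cin ci ch; par0 h o h0.
- move=> W sW vW xW; rewrite cin ci.
  have [->|] := gap_or1 sW vW xA xW; last by par0 h o h0.
  by rewrite (rho1 M) tv /typeC /= ci; move: ih; par0 h o h0.
move=> W sW xW vW; rewrite ch.
have [->|] := gap_or1 sW xW vA vW; last by par0 h o h0.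
rewrite (rho1 M) /typeC; case: ifP => xF.
  have tx : ty x = (true, (ty x).2) by rewrite -{1}xF; case: (ty x).
  have := heavyF xA vA _ tx; rewrite gs => /(_ gvx).
  by par0 h o h0.
by have := ok xA; rewrite /okty xF => /(cost_le_k h0); par0 h o h0.
Qed.

Lemma tyU v : v \in A -> ty v = (false, (ty v).2).
Proof. by move=> vA; rewrite -(not_typeF vA); case: (ty v). Qed.

(** If v were U_k it could be deleted with all its neighbours forced. A set with d > 0 neighbours of
    v loses at most (E - I) d, while putting v back adds I - E d; the difference (d - 1) I is
    nonnegative. *)
Lemma lightU v : v \in A -> ((ty v).2 < k)%N.
Proof.
move=> vA; have := ok vA; rewrite /okty not_typeF // leq_eqVlt => /orP[/eqP vk|//].
have tv : ty v = (false, k) by rewrite tyU // vk.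
have nbr u : u \in A -> g v u -> ((ty u).2 < k)%N.
  move=> uA gvu; have := ok uA; rewrite /okty not_typeF // leq_eqVlt => /orP[/eqP uk|//].
  have vu : v \notin [set u] by rewrite inE (del_neq gi gvu).
  have : -2 <= rho g ty (v |: [set u]).
    apply: sp; first by rewrite subUset !sub1set vA.
    by apply/set0Pn; exists v; rewrite setU11.
  rewrite (rhoU1 M) // (rho1 M) ndeg_set1 gvu tv tyU // uk /typeC /= cost_k //.
  by have := indC2 o h0; lia0.
pose ty' u := if g v u then (true, (ty u).2.+1) else ty u.
have [X [sX fX iX gX]] : colorable k g ty' (A :\ v).
  apply: (mc_IH M) => //; last by rewrite [ltnRHS](cardsD1 v) vA.
    move=> u; rewrite inE => /andP[_ uA]; rewrite /ty'; case: ifP => gvu; last exact: ok.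
    by rewrite /okty /= nbr.
  move=> W sW W0.
  have sWA : W \subset A by apply: subset_trans sW _; apply: subD1set.
  have vW : v \notin W by apply/negP => /(subsetP sW); rewrite !inE eqxx.
  have : rho g ty W - (E - I) * (ndeg g v W)%:Z <= rho g ty' W.
    have -> : ndeg g v W = (\sum_(u in W) g v u)%N.
      by rewrite /ndeg -sum1dep_card big_mkcondr; apply: eq_bigr => u _; case: (g v u).
    rewrite /rho /pot (big_morph Posz PoszD (erefl _)) mulr_sumr addrAC -sumrB lerB //.
    apply: ler_sum => u uW; have uA := subsetP sWA u uW; rewrite /ty'.
    case: ifP => gvu; last by rewrite mulr0 subr0.
    rewrite tyU // /typeC /= mulr1.
    by have := cost_succ o h0 (ty u).2; have := indC2 o h0; lia0.
  have [d0|d0] := posnP (ndeg g v W).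
    by rewrite d0 mulr0 subr0; have := sp sWA W0; apply: le_trans.
  have : -2 <= rho g ty (v |: W).
    apply: sp; first by rewrite subUset sub1set vA.
    by apply/set0Pn; exists v; rewrite setU11.
  rewrite (rhoU1 M) // tv /typeC /= cost_k //.
  have : I * 1 <= I * (ndeg g v W)%:Z by rewrite ler_wpM2l // ltW // indC_gt0.
  by lia0.
have vX : v \notin X by apply/negP => /(subsetP sX); rewrite !inE eqxx.
case: (mc_nc M); exists X; split.
- by apply: subset_trans sX _; apply: subD1set.
- by move=> u uA; rewrite not_typeF.
- have nX y : y \in A -> g v y -> y \in X.
    move=> yA gvy; apply: fX; last by rewrite /ty' gvy.
    by rewrite !inE yA eq_sym (del_neq gi gvy).
  move=> x y; rewrite !inE => /andP[xX xA] /andP[yX yA].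
  have [xv|xv] := eqVneq x v; first by rewrite xv; apply: contra yX; apply: nX.
  have [yv|yv] := eqVneq y v; first by rewrite yv gs; apply: contra xX; apply: nX.
  by apply: iX; rewrite !inE ?xX ?yX ?xv ?yv.
apply: good_le gX => // u uX; rewrite /ty'; case: ifP => // gvu.
have uA : u \in A by have := subsetP sX u uX; rewrite inE => /andP[].
by rewrite tyU.
Qed.

Lemma wtU v : v \in A -> wt (ty v) = (ty v).2.+1.
Proof. by move=> vA; rewrite tyU. Qed.

Lemma typeCU v : v \in A -> typeC h o (ty v) = E + I - cost (ty v).2.
Proof. by move=> vA; rewrite tyU. Qed.

(** A vertex of degree at most 1 extends any colouring of the rest: it joins the forest if it has no
    neighbour there, and the independent set otherwise. *)
Lemma min_degree v : v \in A -> (1 < ndeg g v A)%N.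
Proof.
move=> vA; rewrite ltnNge; apply/negP => d1.
have pA : A :\ v \proper A by rewrite properD1.
have [X [sX fX iX gX]] := colorable_proper M pA.
have sXA : X \subset A by apply: subset_trans sX _; apply: subD1set.
have vX : v \notin X by apply/negP => /(subsetP sX); rewrite !inE eqxx.
have notv u : u \in A :\: X -> u != v -> u \in (A :\ v) :\: X.
  by rewrite !inE => /andP[-> ->] ->.
have [dX|dX] := posnP (ndeg g v X).
  case: (mc_nc M); exists (v |: X); split.
  - by rewrite subUset sub1set vA.
  - by move=> u uA; rewrite not_typeF.
  - move=> x y; rewrite !inE !negb_or => /andP[/andP[xv xX] xA] /andP[/andP[yv yX] yA].
    by apply: iX; rewrite !inE ?xX ?yX ?xv ?yv.
  by apply: good_add => //; rewrite wtU // lightU.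
have dA : ndeg g v (A :\: X) = 0%N.
  have : A = X :|: A :\: X by rewrite -{1}(setID A X) (setIidPr sXA).
  have dj : [disjoint X & A :\: X].
    by rewrite -setI_eq0; apply/eqP/setP => u; rewrite !inE; case: (u \in X).
  by move=> e; move: d1; rewrite {1}e ndegU //; move: dX; lia0.
case: (mc_nc M); exists X; split=> //.
- by move=> u uA; rewrite not_typeF.
have nv y : y \in A :\: X -> ~~ g v y.
  by move=> yA; apply/negP => gvy; have := ndeg_gt0 yA gvy; rewrite dA.
move=> x y xA yA; have [->|xv] := eqVneq x v; first exact: nv.
by have [->|yv] := eqVneq y v; [rewrite gs nv|apply: iX; apply: notv].
Qed.

Lemma ndeg_pair v x y W : x != y -> (forall u, u \in W -> g v u = (u == x) || (u == y)) ->
  ndeg g v W = ((x \in W) + (y \in W))%N.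
Proof.
move=> xy hN; have -> : ndeg g v W = #|(W :&: [set x]) :|: (W :&: [set y])|.
  rewrite -setIUr; apply: eq_card => u; rewrite !inE; case uW: (u \in W) => //=.
  exact: hN.
have one z : #|W :&: [set z]| = (z \in W).
  have [zW|zW] := boolP (z \in W); first by rewrite (setIidPr _) ?sub1set // cards1.
  by apply/eqP; rewrite cards_eq0 setIC setI_eq0 disjoints1.
rewrite cardsU !one -setIIr; have -> : [set x] :&: [set y] = set0.
  by apply/eqP; rewrite setI_eq0 disjoints1 inE.
by rewrite setI0 cards0 subn0.
Qed.

Lemma degree2 v : v \in A -> ndeg g v A = 2%N -> exists x y,
  [/\ x \in A, y \in A, x != y & forall u, u \in A -> g v u = (u == x) || (u == y)].
Proof.
move=> vA /eqP/cards2P[x [y] [xy e]]; exists x, y.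
have inN u : (u \in A) && g v u = (u == x) || (u == y).
  by have := congr1 (fun B : {set T} => u \in B) e; rewrite !inE.
split=> //; first by have := inN x; rewrite eqxx => /andP[].
  by have := inN y; rewrite eqxx orbT => /andP[].
by move=> u uA; rewrite -inN uA.
Qed.

Lemma rho_raise ty0 x m W : okty k (ty0 x) -> (ty0 x).1 = false ->
  rho g ty0 W - (if x \in W then cost m else 0) <= rho g (raise k x m ty0) W.
Proof.
move=> okx xU; have xF : (ty0 x).1 -> ((ty0 x).2 + m <= k)%N by rewrite xU.
rewrite /raise rho_upd; have := typeC_heavier h0 okx xF.
by case: (x \in W); lia0.
Qed.

Lemma raise_okU ty0 x m u : okty k (ty0 u) -> okty k (ty0 x) -> (ty0 x).1 = false ->
  okty k (raise k x m ty0 u).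
Proof.
move=> oku okx xU; rewrite /raise; have [->|ux] := eqVneq u x; last by rewrite upd_neq.
by rewrite upd_eq heavier_ok // xU.
Qed.

Lemma raise_U ty0 x m u : (ty0 u).1 = false -> (ty0 x).1 = false ->
  (raise k x m ty0 u).1 = false.
Proof.
move=> uU xU; rewrite /raise; have [->|ux] := eqVneq u x; last by rewrite upd_neq.
by rewrite upd_eq /heavier xU.
Qed.

Lemma wt_raise ty0 x m u : okty k (ty0 x) -> (wt (raise k x m ty0 u) <= k)%N ->
  wt (raise k x m ty0 u) = (wt (ty0 u) + (if u == x then m else 0))%N.
Proof.
move=> okx; rewrite /raise; have [->|ux] := eqVneq u x; last by rewrite upd_neq // addn0.
by rewrite upd_eq; case: (wt_heavier h0 m okx) => [->//|->]; rewrite ltnn.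
Qed.

Lemma extend_coloring D X Y : X \subset A :\: D -> Y \subset D -> D \subset A ->
  (forall a c, a \in (A :\: D) :\: X -> c \in (A :\: D) :\: X -> ~~ g a c) ->
  (forall a c, a \in D :\: Y -> c \in A :\: (Y :|: X) -> ~~ g a c) ->
  good k g ty (Y :|: X) -> False.
Proof.
move=> sX sY sD iX iD gX; apply: (mc_nc M); exists (Y :|: X); split=> //.
- rewrite subUset (subset_trans sY sD); apply: subset_trans sX _; apply: subsetDl.
- by move=> u uA; rewrite not_typeF.
move=> a c aA cA; have [aD|aD] := boolP (a \in D).
  by apply: iD => //; move: aA; rewrite !inE negb_or aD => /andP[/andP[->]].
have [cD|cD] := boolP (c \in D).
  by rewrite gs; apply: iD => //; move: cA; rewrite !inE negb_or cD => /andP[/andP[->]].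
move: aA cA; rewrite !inE !negb_or => /andP[/andP[_ aX] aA] /andP[/andP[_ cX] cA].
by apply: iX; rewrite !inE ?aX ?cX ?aD ?cD.
Qed.

Lemma rho_add2 v x y W : x != y -> v \in A -> W \subset A -> v \notin W ->
  (forall u, u \in A -> g v u = (u == x) || (u == y)) ->
  rho g ty (v |: W) = rho g ty W + (E + I - cost (ty v).2) - E * ((x \in W) + (y \in W))%N%:Z.
Proof.
move=> xy vA sW vW hN; rewrite (rhoU1 M) // typeCU // (@ndeg_pair v x y) // => u uW.
by apply: hN; apply: (subsetP sW).
Qed.

(* Both neighbours are made heavier by the weight of v, so that any colouring of
   the rest leaves room for v in the component of either of them. *)
Lemma light_degree2 v : v \in A -> ndeg g v A = 2%N -> (h <= (ty v).2.+1)%N.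
Proof.
move=> vA d2; rewrite leqNgt; apply/negP => jh.
have [x [y [xA yA xy hN]]] := degree2 vA d2.
set j := (ty v).2 in jh.
pose ty1 := raise k y j.+1 ty; pose ty' := raise k x j.+1 ty1.
have ok1 u : u \in A -> okty k (ty1 u) by move=> uA; rewrite raise_okU ?ok ?not_typeF.
have U1 u : u \in A -> (ty1 u).1 = false by move=> uA; rewrite raise_U ?not_typeF.
have gvx : g v x by rewrite hN // eqxx.
have gvy : g v y by rewrite hN // eqxx orbT.
have cj : cost j = (3 * j)%:Z by apply: cost_lin => //; apply/ltnW/ltnW.
have cj1 : cost j.+1 = (3 * j.+1)%:Z by apply: cost_lin => //; apply: ltnW.
have [X [sX fX iX gX]] : colorable k g ty' (A :\ v).
  apply: (mc_IH M) => //; last by rewrite [ltnRHS](cardsD1 v) vA.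
    by move=> u; rewrite inE => /andP[_ uA]; rewrite /ty' raise_okU ?ok1 ?U1.
  move=> W sW W0.
  have sWA : W \subset A by apply: subset_trans sW _; apply: subD1set.
  have vW : v \notin W by apply/negP => /(subsetP sW); rewrite !inE eqxx.
  have := @rho_raise ty1 x j.+1 W (ok1 x xA) (U1 x xA).
  have := @rho_raise ty y j.+1 W (ok yA) (not_typeF yA); rewrite -/ty1 -/ty' cj1.
  have := rho_add2 xy vA sWA vW hN; rewrite -/j cj.
  have spv : -2 <= rho g ty (v |: W).
    apply: sp; first by rewrite subUset sub1set vA.
    by apply/set0Pn; exists v; rewrite setU11.
  have spW := sp sWA W0.
  have single z : z \in W -> I + 1 <= rho g ty W \/ W = [set z].
    by move=> zW; case: (gap_or1 sWA zW vA vW); [right|left].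
  have pos z : W = [set z] -> 0 <= rho g ty' W.
    move=> Wz; have zA : z \in A by rewrite -sub1set -Wz.
    by rewrite Wz /rho pot1 // typeC_ge0 // raise_okU ?ok1 ?U1.
  move: spv; have [xW|xW] := boolP (x \in W); have [yW|yW] := boolP (y \in W) => /=.
  - by move: jh; par0 h o h0.
  - case: (single x xW) => [|/pos]; last by lia0.
    by move: jh; par0 h o h0.
  - case: (single y yW) => [|/pos]; last by lia0.
    by move: jh; par0 h o h0.
  - by move: spW; lia0.
have vX : v \notin X by apply/negP => /(subsetP sX); rewrite !inE eqxx.
have sXA : X \subset A by apply: subset_trans sX _; apply: subD1set.
have wX u : u \in X -> wt (ty' u) =
    (wt (ty u) + (if u == y then j.+1 else 0) + (if u == x then j.+1 else 0))%N.
  move=> uX; have wu := good_wt gs gi gX uX.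
  have e' := wt_raise (ok1 x xA) wu; rewrite -/ty' in e'.
  rewrite e' (wt_raise (ok yA)) //; first by rewrite -/ty1 -/ty'; move: e' wu; lia0.
have gXty : good k g ty X by apply: good_le gX => // u uX; rewrite wX // -addnA leq_addr.
have wv : wt (ty v) = j.+1 by rewrite wtU.
have wvk : (wt (ty v) <= k)%N by rewrite wv lightU.
have sXD : X \subset A :\: [set v] by [].
have sv : [set v] \subset A by rewrite sub1set.
have colv : good k g ty (v |: X) -> False.
  by apply: (extend_coloring sXD) => // a c; rewrite !inE; case: (a == v).
have [xX|xX] := boolP (x \in X); have [yX|yX] := boolP (y \in X).
- apply: (extend_coloring sXD (sub0set _)) => //; last by rewrite set0U.
  move=> a c; rewrite !inE => /eqP -> /andP[cX cA]; rewrite hN //.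
  by apply/negP => /orP[] /eqP cx; rewrite cx ?xX ?yX in cX.
- apply: colv; apply: (@good_attach _ _ _ gs gi ty ty' X v x) => //.
  + move=> u uX; rewrite hN ?(subsetP sXA) // => /orP[/eqP //|/eqP uy].
    by rewrite -uy uX in yX.
  + by move=> u uX _; rewrite wX // -addnA leq_addr.
  + by rewrite wX // eqxx wv -addnA leq_add2l leq_addl.
- apply: colv; apply: (@good_attach _ _ _ gs gi ty ty' X v y) => //.
  + move=> u uX; rewrite hN ?(subsetP sXA) // => /orP[/eqP ux|/eqP //].
    by rewrite -ux uX in xX.
  + by move=> u uX _; rewrite wX // -addnA leq_addr.
  + by rewrite wX // eqxx wv leq_addr.
- apply: colv; apply: good_add => //; apply: ndeg0P => u uX; rewrite hN ?(subsetP sXA) //.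
  by apply/negP => /orP[] /eqP ux; rewrite -ux uX in xX yX.
Qed.

End Reductions.

Section Reductions2.
Context (h : nat) (o : bool) (T : finType) (g : rel T) (ty : T -> vtype) (A : {set T}).
Context (M : mincex h o g ty A).
Local Notation k := (kpar h o).
Local Notation E := (edgeC h o).
Local Notation I := (indC h o).
Local Notation cost := (cost h o).
Local Notation rho := (rho h o).
Let h0 := mc_h M.
Let gs := mc_sym M.
Let gi := mc_irr M.
Let ok := mc_ok M.
Let sp := mc_sp M.
Implicit Types (a b c u v x y : T) (S W X Y C D : {set T}).

Lemma good_hang ty0 X v x m : v \notin X -> v != x -> okty k (ty0 x) ->
  (forall u, u \in X -> g v u -> u = x) -> (wt (ty0 v) <= m)%N -> (wt (ty0 v) <= k)%N ->
  good k g (raise k x m ty0) X -> good k g ty0 (v |: X).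
Proof.
move=> vX vx okx hN wm wk gX.
have wX u : u \in X -> wt (raise k x m ty0 u) = (wt (ty0 u) + (if u == x then m else 0))%N.
  by move=> uX; apply: (wt_raise M okx); apply: (good_wt gs gi gX).
have [xX|xX] := boolP (x \in X).
  apply: (@good_attach _ _ _ gs gi ty0 _ X v x vX xX hN wk _ _ gX).
    by move=> u uX _; rewrite wX // leq_addr.
  by rewrite wX // eqxx leq_add2l.
apply: good_add => //.
  by apply: ndeg0P => u uX; apply: contraNN xX => /hN <-.
by apply: good_le gX => // u uX; rewrite wX // leq_addr.
Qed.

Lemma degree2_other v u : v \in A -> u \in A -> ndeg g v A = 2%N -> g v u ->
  exists x, [/\ x \in A, x != u, x != v &
    forall w, w \in A -> g v w = (w == u) || (w == x)].
Proof.
move=> vA uA d2 gvu; have [x [y [xA yA xy hN]]] := degree2 vA d2.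
have gvx : g v x by rewrite hN // eqxx.
have gvy : g v y by rewrite hN // eqxx orbT.
have := gvu; rewrite hN // => /orP[] /eqP ->.
  by exists y; split=> //; rewrite eq_sym // (del_neq gi gvy).
exists x; split=> //; first by rewrite eq_sym (del_neq gi gvx).
by move=> w wA; rewrite hN // orbC.
Qed.

Lemma sparse_add v W : v \in A -> W \subset A -> -2 <= rho g ty (v |: W).
Proof.
move=> vA sW; apply: sp; first by rewrite subUset sub1set vA.
by apply/set0Pn; exists v; rewrite setU11.
Qed.

(** Both vertices are deleted and only x is raised, by the weight h of v1. If y is in the forest, v2
    goes to the independent set and v1 hangs on x or stands alone. If only x is, v1 is independent
    and v2 stands alone. If neither is, v1 and v2 form a component of weight at most h + (h + o) =
    k. *)
Lemma adjacent_degree2 v1 v2 : v1 \in A -> v2 \in A -> g v1 v2 ->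
  ndeg g v1 A = 2%N -> ndeg g v2 A = 2%N -> (ty v1).2 = h.-1 ->
  ((ty v2).2 < h + o)%N -> False.
Proof.
move=> v1A v2A g12 d1 d2 w1 w2.
have v12 := del_neq gi g12.
have [x [xA xv2 xv1 h1]] := degree2_other v1A v2A d1 g12.
have [y [yA yv1 yv2 h2]] := degree2_other v2A v1A d2 (etrans (gs _ _) g12).
pose D := [set v1; v2].
pose ty' := raise k x h ty.
have D1 : v1 \in D by rewrite !inE eqxx.
have D2 : v2 \in D by rewrite !inE eqxx orbT.
have sDA : D \subset A by apply/subsetP => u; rewrite !inE => /orP[] /eqP ->.
have xD : x \notin D by rewrite !inE negb_or xv1.
have yD : y \notin D by rewrite !inE negb_or yv1.
have ok' u : u \in A -> okty k (ty' u) by move=> uA; rewrite (raise_okU M) ?ok ?(not_typeF M).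
have ch1 : cost (ty v1).2 = (3 * h.-1)%:Z by rewrite w1 cost_lin // leq_pred.
have ch : cost h = (3 * h)%:Z by apply: cost_lin.
have [X [sX fX iX gX]] : colorable k g ty' (A :\: D).
  apply: (mc_IH M) => //.
  - by move=> u; rewrite inE => /andP[_]; apply: ok'.
  - move=> W sW W0.
    have sWA : W \subset A by apply: subset_trans sW _; apply: subsetDl.
    have WD u : u \in D -> u \notin W.
      by move=> uD; apply/negP => /(subsetP sW); rewrite inE uD.
    have := @rho_raise _ _ _ _ _ _ M ty x h W (ok xA) (not_typeF M xA); rewrite -/ty' ch.
    have spW := sp sWA W0.
    case: ifP => [xW|xW]; last by move: spW; lia0.
    have [yW|yW] := boolP (y \in W); last first.
      case: (gap_or1 M sWA xW v1A (WD _ D1)) => [WX _|]; last by par0 h o h0.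
      suff : 0 <= rho g ty' W by lia0.
      by rewrite WX /rho pot1 // typeC_ge0 // ok'.
    have v2W := WD _ D2; have v1W := WD _ D1.
    have s2 : v2 |: W \subset A by rewrite subUset sub1set v2A.
    have v1W2 : v1 \notin v2 |: W by rewrite !inE negb_or v12.
    have := sparse_add v1A s2; rewrite (rho_add2 M _ v1A s2 v1W2 h1) 1?eq_sym // ch1.
    rewrite (rho_add2 M _ v2A sWA v2W h2) 1?eq_sym //.
    rewrite setU11 (inE, in_setU1) xW yW orbT (negbTE v1W) /=.
    have := cost_ge0 o h0 (ty v2).2; move: (cost (ty v2).2) => c2.
    by par0 h o h0.
  rewrite cardsD (setIidPr sDA) cards2 v12.
  by have := subset_leq_card sDA; rewrite cards2 v12; lia0.
have sXA : X \subset A by apply: subset_trans sX _; apply: subsetDl.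
have XD u : u \in D -> u \notin X.
  by move=> uD; apply/negP => /(subsetP sX); rewrite inE uD.
have v1X := XD _ D1; have v2X := XD _ D2.
have gXty : good k g ty X.
  apply: (good_le _ _ gX) => // u uX; have wu := good_wt gs gi gX uX.
  by rewrite (wt_raise M (ok xA)) // leq_addr.
have wv1 : wt (ty v1) = h by rewrite (wtU M) // w1 prednK.
have wv2 : wt (ty v2) = (ty v2).2.+1 by rewrite (wtU M).
have wk v : v \in A -> (wt (ty v) <= k)%N by move=> vA; rewrite (wtU M) // (lightU M).
have n1 u : u \in X -> g v1 u -> u = x.
  move=> uX; rewrite h1 ?(subsetP sXA) // => /orP[/eqP uv|/eqP //].
  by rewrite -uv uX in v2X.
have n2 u : u \in X -> g v2 u -> u = y.
  move=> uX; rewrite h2 ?(subsetP sXA) // => /orP[/eqP uv|/eqP //].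
  by rewrite -uv uX in v1X.
have sD1 : [set v1] \subset D by rewrite sub1set.
have sD2 : [set v2] \subset D by rewrite sub1set.
have [xX|xX] := boolP (x \in X).
  have [yX|yX] := boolP (y \in X).
    apply: (extend_coloring M sX sD1 sDA iX).
      move=> a c; rewrite !inE => /andP[/negbTE -> /= /eqP ->] /andP[]; rewrite negb_or.
      move=> /andP[cv1 cX] cA; rewrite h2 // (negbTE cv1) /=.
      by apply: contraNneq cX => ->.
    by apply: (@good_hang ty X v1 x h); rewrite ?ok ?wk ?wv1 // eq_sym.
  apply: (extend_coloring M sX sD2 sDA iX).
    move=> a c; rewrite !inE => /andP[/negbTE a2]; rewrite a2 orbF => /eqP -> /andP[].
    rewrite negb_or => /andP[cv2 cX] cA; rewrite h1 // (negbTE cv2) /=.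
    by apply: contraNneq cX => ->.
  apply: good_add => //; last exact: wk.
  by apply: ndeg0P => u uX; apply: contraNN yX => /(n2 u uX) <-.
have g1 : ndeg g v1 X = 0%N.
  by apply: ndeg0P => u uX; apply: contraNN xX => /(n1 u uX) <-.
have [yX|yX] := boolP (y \in X).
  apply: (extend_coloring M sX sD1 sDA iX).
    move=> a c; rewrite !inE => /andP[/negbTE -> /= /eqP ->] /andP[]; rewrite negb_or.
    move=> /andP[cv1 cX] cA; rewrite h2 // (negbTE cv1) /=.
    by apply: contraNneq cX => ->.
  by apply: good_add => //; apply: wk.
apply: (extend_coloring M sX (subxx D) sDA iX).
  by move=> a c; rewrite setDv inE.
pose ty2 := upd v2 (true, k) ty.
have g2 : ndeg g v2 X = 0%N.
  by apply: ndeg0P => u uX; apply: contraNN yX => /(n2 u uX) <-.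
have gty2 : good k g ty2 (v2 |: X).
  apply: good_add => //; first by rewrite /ty2 upd_eq.
  apply: good_le gXty => // u uX; rewrite /ty2 upd_neq //.
  by apply: contraNneq v2X => <-.
rewrite -setUA; apply: (@good_attach _ _ _ gs gi ty ty2 (v2 |: X) v1 v2) => //.
- by rewrite !inE negb_or v12.
- by rewrite setU11.
- move=> u; rewrite in_setU1 => /orP[/eqP //|uX] /(n1 u uX) ux.
  by rewrite ux (negbTE xX) in uX.
- exact: wk.
- by move=> u _ uv; rewrite /ty2 upd_neq.
by rewrite /ty2 upd_eq {3}/wt /= wv1 wv2; move: w2; par0 h o h0.
Qed.

(** The vertices v, p, q are deleted and the outer neighbours p' and q' raised by h. If r is in the
    forest, v is independent and p, q hang on p', q'. Otherwise v is in the forest, joined by p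
    exactly if p' is not there, and likewise by q; the component then weighs at most 1 + 2h, which
    is k for odd k. *)
Lemma two_light_neighbors v p q r : o -> v \in A -> p \in A -> q \in A -> r \in A ->
  uniq [:: p; q; r] -> (forall u, u \in A -> g v u = (u \in [:: p; q; r])) ->
  (ty v).2 = 0%N -> ndeg g p A = 2%N -> ndeg g q A = 2%N ->
  (ty p).2 = h.-1 -> (ty q).2 = h.-1 -> False.
Proof.
move=> oT vA pA qA rA; rewrite /= !inE negb_or andbT => /andP[/andP[pq pr] qr] hv w0 dp dq wp wq.
have gvp : g v p by rewrite hv // !inE eqxx.
have gvq : g v q by rewrite hv // !inE eqxx orbT.
have gvr : g v r by rewrite hv // !inE eqxx !orbT.
have vp := del_neq gi gvp; have vq := del_neq gi gvq; have vr := del_neq gi gvr.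
have gpq : ~~ g p q.
  apply/negP => gpq; apply: (adjacent_degree2 pA qA gpq dp dq wp).
  by rewrite wq; move: h0 oT; clear; lia.
have [p' [p'A p'v p'p hp]] := degree2_other pA vA dp (etrans (gs _ _) gvp).
have [q' [q'A q'v q'q hq]] := degree2_other qA vA dq (etrans (gs _ _) gvq).
have p'q : p' != q by apply: contraNneq gpq => <-; rewrite hp // eqxx orbT.
have q'p : q' != p by apply: contraNneq gpq => <-; rewrite gs hq // eqxx orbT.
pose D := [set v; p; q].
have Dv : v \in D by rewrite !inE eqxx.
have Dp : p \in D by rewrite !inE eqxx orbT.
have Dq : q \in D by rewrite !inE eqxx orbT.
have sDA : D \subset A by apply/subsetP => u; rewrite !inE => /orP[/orP[]|] /eqP ->.
pose ty1 := raise k q' h ty; pose ty' := raise k p' h ty1.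
have ok1 u : u \in A -> okty k (ty1 u) by move=> uA; rewrite (raise_okU M) ?ok ?(not_typeF M).
have U1 u : u \in A -> (ty1 u).1 = false by move=> uA; rewrite raise_U ?(not_typeF M).
have ok' u : u \in A -> okty k (ty' u) by move=> uA; rewrite (raise_okU M) ?ok1 ?U1.
have ch1 : cost h.-1 = (3 * h.-1)%:Z by rewrite cost_lin // leq_pred.
have c0 : cost 0 = 0 by rewrite cost_lin.
have ch : cost h = (3 * h)%:Z by apply: cost_lin.
have [X [sX fX iX gX]] : colorable k g ty' (A :\: D).
  apply: (mc_IH M) => //.
  - by move=> u; rewrite inE => /andP[_]; apply: ok'.
  - move=> W sW W0.
    have sWA : W \subset A by apply: subset_trans sW _; apply: subsetDl.
    have WD u : u \in D -> u \notin W.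
      by move=> uD; apply/negP => /(subsetP sW); rewrite inE uD.
    have := @rho_raise _ _ _ _ _ _ M ty q' h W (ok q'A) (not_typeF M q'A); rewrite -/ty1 ch.
    have := @rho_raise _ _ _ _ _ _ M ty1 p' h W (ok1 p' p'A) (U1 p' p'A); rewrite -/ty' ch.
    have spW := sp sWA W0.
    have single z : z \in W -> I + 1 <= rho g ty W \/ 0 <= rho g ty' W.
      move=> zW; case: (gap_or1 M sWA zW vA (WD _ Dv)) => [Wz|]; last by left.
      by right; have zA := subsetP sWA z zW; rewrite Wz /rho pot1 // typeC_ge0 // ok'.
    have [pW|pW] := boolP (p' \in W); have [qW|qW] := boolP (q' \in W).
    + have vW := WD _ Dv; have pW' := WD _ Dp; have qW' := WD _ Dq.
      have sv : v |: W \subset A by rewrite subUset sub1set vA.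
      have sq : q |: (v |: W) \subset A by rewrite subUset sub1set qA.
      have spq : p |: (q |: (v |: W)) \subset A by rewrite subUset sub1set pA.
      have qvW : q \notin v |: W by rewrite !inE negb_or eq_sym vq.
      have pqW : p \notin q |: (v |: W) by rewrite !inE !negb_or pq eq_sym vp.
      have dv : ndeg g v W = (r \in W).
        have -> : ndeg g v W = #|W :&: [set r]|.
          apply: eq_card => u; rewrite !inE; have [uW|//] := boolP (u \in W).
          rewrite /= hv ?(subsetP sWA) // !inE.
          have -> : u == p = false by apply: contraTF uW => /eqP ->.
          by have -> : u == q = false by apply: contraTF uW => /eqP ->.
        have [rW|rW] := boolP (r \in W); first by rewrite (setIidPr _) ?sub1set // cards1.
        by apply/eqP; rewrite cards_eq0 setIC setI_eq0 disjoints1.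
      have e : rho g ty (p |: (q |: (v |: W))) =
          rho g ty W + 3 * E + 3 * I - (6 * h.-1)%:Z - 4 * E - E * (r \in W)%:Z.
        rewrite (rho_add2 M _ pA sq pqW hp) 1?eq_sym // wp ch1.
        rewrite (rho_add2 M _ qA sv qvW hq) 1?eq_sym // wq ch1.
        rewrite (rhoU1 M) // dv (typeCU M) // w0 c0 !in_setU1 eqxx pW qW !orbT /=.
        by clear; lia.
      have [rW|rW] := boolP (r \in W).
        have := sparse_add pA sq; rewrite e rW; move: oT; par0 h o h0.
      (* The bound -2 is too weak here. The enlarged set misses r, so the gap applies to it, and it
         leaves exactly -2 once both raises are paid. *)
      have pr' : p |: (q |: (v |: W)) \proper A.
        apply/properP; split=> //; exists r => //.
        by rewrite !inE !negb_or rW [r == p]eq_sym pr [r == q]eq_sym qr [r == v]eq_sym vr.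
      have c2 : (1 < #|p |: (q |: (v |: W))|)%N by rewrite !cardsU1 pqW qvW; lia0.
      have := gap M pr' c2; rewrite e (negbTE rW); move: oT; par0 h o h0.
    + by case: (single _ pW) => //=; move: oT; par0 h o h0.
    + by case: (single _ qW) => //=; move: oT; par0 h o h0.
    + by move: spW; lia0.
  apply: proper_card; apply/properP; split; first exact: subsetDl.
  by exists v => //; rewrite inE Dv.
have sXA : X \subset A by apply: subset_trans sX _; apply: subsetDl.
have XD u : u \in D -> u \notin X.
  by move=> uD; apply/negP => /(subsetP sX); rewrite inE uD.
have vX := XD _ Dv; have pX := XD _ Dp; have qX := XD _ Dq.
have wpE : wt (ty p) = h by rewrite (wtU M) // wp prednK.
have wqE : wt (ty q) = h by rewrite (wtU M) // wq prednK.
have wvE : wt (ty v) = 1%N by rewrite (wtU M) // w0.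
have hk : (h <= k)%N by rewrite kparE; lia0.
have np u : u \in X -> g p u -> u = p'.
  move=> uX; rewrite hp ?(subsetP sXA) // => /orP[/eqP uv|/eqP //].
  by rewrite -uv uX in vX.
have nq u : u \in X -> g q u -> u = q'.
  move=> uX; rewrite hq ?(subsetP sXA) // => /orP[/eqP uv|/eqP //].
  by rewrite -uv uX in vX.
have pne : ty1 p = ty p by rewrite /ty1 /raise upd_neq // eq_sym.
have gp : good k g ty1 (p |: X).
  apply: (@good_hang ty1 X p p' h) => //; rewrite ?ok1 ?pne ?wpE //.
  by rewrite eq_sym.
have [rX|rX] := boolP (r \in X).
  have sY : [set p; q] \subset D by apply/subsetP => u; rewrite !inE => /orP[] ->; rewrite !orbT.
  apply: (extend_coloring M sX sY sDA iX).
    move=> a c; rewrite !inE => /andP[]; rewrite negb_or -orbA => /andP[/negbTE -> /negbTE ->].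
    rewrite !orbF => /eqP -> /andP[]; rewrite !negb_or => /andP[/andP[cp cq] cX] cA.
    rewrite hv // !inE (negbTE cp) (negbTE cq) /=.
    by apply: contraNneq cX => ->.
  rewrite [[set p; q]]setUC -setUA.
  apply: (@good_hang ty (p |: X) q q' h) => //; rewrite ?ok ?wqE //.
  - by rewrite !inE negb_or eq_sym pq.
  - by rewrite eq_sym.
  move=> u; rewrite in_setU1 => /orP[/eqP ->|uX]; last exact: nq.
  by rewrite gs (negbTE gpq).
pose Y := [set u in D | (u == v) || (u == p) && (p' \notin X) || (u == q) && (q' \notin X)].
have sY : Y \subset D by apply/subsetP => u; rewrite inE => /andP[].
have vY : v \in Y by rewrite inE Dv eqxx.
have pY : (p \in Y) = (p' \notin X).
  by rewrite inE Dp eqxx [p == v]eq_sym (negbTE vp) (negbTE pq) /= orbF.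
have qY : (q \in Y) = (q' \notin X).
  by rewrite inE Dq eqxx [q == v]eq_sym (negbTE vq) [q == p]eq_sym (negbTE pq).
apply: (extend_coloring M sX sY sDA iX).
  move=> a c; rewrite inE => /andP[aY aD]; rewrite inE in_setU negb_or => /andP[/andP[cY cX] cA].
  have cv : c != v by apply: contraNneq cY => ->.
  have {}aD : [|| a == v, a == p | a == q] by move: aD; rewrite !inE -orbA.
  case/or3P: aD aY => /eqP ->; first by rewrite vY.
    rewrite pY negbK => p'X; rewrite hp // (negbTE cv) /=.
    by apply: contraNneq cX => ->.
  rewrite qY negbK => q'X; rewrite hq // (negbTE cv) /=.
  by apply: contraNneq cX => ->.
(* Room for both p and q is reserved at v, then released h at a time: [tyA] before p is attached,
   [tyB] before q is. *)
pose tyA := upd v (true, (1 + h + h)%N) ty; pose tyB := upd v (true, (1 + h)%N) ty.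
have gty : good k g ty X.
  apply: (good_le _ _ gX) => // u uX; have wu := good_wt gs gi gX uX.
  have e1 := wt_raise M (ok1 _ p'A) wu; rewrite -/ty' in e1.
  have wu1 : (wt (ty1 u) <= k)%N by move: e1 wu; rewrite -/ty'; lia0.
  by rewrite e1 (wt_raise M (ok q'A)) // -addnA leq_addr.
have gA : good k g tyA (v |: X).
  apply: good_add => //.
  - apply: ndeg0P => u uX; rewrite hv ?(subsetP sXA) // !inE.
    by apply/negP => /or3P[] /eqP uE; rewrite -uE uX in pX qX rX.
  - by rewrite /tyA upd_eq /wt /= kparE oT; lia0.
  apply: good_le gty => // u uX; rewrite /tyA upd_neq //.
  by apply: contraNneq vX => <-.
have AB u : (wt (tyB u) <= wt (tyA u))%N.
  rewrite /tyA /tyB; have [->|uv] := eqVneq u v; last by rewrite !upd_neq.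
  by rewrite !upd_eq /wt /= leq_addr.
have Bty u : (wt (ty u) <= wt (tyB u))%N.
  rewrite /tyB; have [->|uv] := eqVneq u v; last by rewrite upd_neq.
  by rewrite upd_eq wvE.
have gB : good k g tyB ((v |: X) :|: (if p' \in X then set0 else [set p])).
  have [p'X|p'X] := boolP (p' \in X); first by rewrite setU0; apply: good_le gA.
  rewrite setUC; apply: (@good_attach _ _ _ gs gi tyB tyA (v |: X) p v) => //.
  - by rewrite !inE negb_or eq_sym vp.
  - by rewrite setU11.
  - move=> u; rewrite in_setU1 => /orP[/eqP //|uX] /(np u uX) up.
    by rewrite -up uX in p'X.
  - by rewrite /tyB upd_neq 1?eq_sym // wpE.
  rewrite /tyB /tyA !upd_eq upd_neq 1?eq_sym // wpE /wt /=; lia0.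
have eY : Y :|: X = ((v |: X) :|: (if p' \in X then set0 else [set p])) :|:
    (if q' \in X then set0 else [set q]).
  apply/setP => u; rewrite inE [u \in Y]inE /D !inE.
  have [->|uv] := eqVneq u v => //=.
  by case: (p' \in X); case: (q' \in X); rewrite !inE ?andbT ?andbF ?orbF //=;
    case: (u == p); case: (u == q); case: (u \in X).
rewrite eY; have [q'X|q'X] := boolP (q' \in X); first by rewrite setU0; apply: good_le gB.
rewrite setUC; apply: (@good_attach _ _ _ gs gi ty tyB _ q v) => //.
- rewrite !inE !negb_or eq_sym vq qX /=; case: ifP; rewrite inE //.
  by rewrite eq_sym pq.
- by rewrite !inE eqxx.
- move=> u; rewrite in_setU in_setU1 -orbA => /or3P[/eqP //|uX /(nq u uX) uq|].
    by rewrite -uq uX in q'X.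
  by case: ifP => _; rewrite inE // => /eqP ->; rewrite gs (negbTE gpq).
- by rewrite wqE.
- by rewrite /tyB upd_eq wqE wvE.
Qed.

End Reductions2.

(** * Discharging *)

Section Discharging.
Context (h : nat) (o : bool) (T : finType) (g : rel T) (ty : T -> vtype) (A : {set T}).
Context (M : mincex h o g ty A).
Local Notation k := (kpar h o).
Local Notation E := (edgeC h o).
Local Notation I := (indC h o).
Local Notation cost := (cost h o).
Local Notation rho := (rho h o).
Let h0 := mc_h M.
Let gs := mc_sym M.
Let gi := mc_irr M.
Let ok := mc_ok M.
Let sp := mc_sp M.
Implicit Types (a b c u v x y z s : T) (X Y C : {set T}).

Definition surplus : {set T} := [set v in A | (ndeg g v A == 2%N) && ((ty v).2 == h.-1)].
Definition core : {set T} := A :\: surplus.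
Local Notation S := surplus.
Local Notation N := core.

(* Twice the charge left at v once every surplus vertex has split its charge
   evenly between its two neighbours. *)
Definition charge v : int :=
  2 * (E + I - cost (ty v).2) - E * (ndeg g v A)%:Z + o.+1%:Z * (ndeg g v S)%:Z.
Local Notation D := charge.

Lemma surplus_sub : S \subset A. Proof. by apply/subsetP => v; rewrite inE => /andP[]. Qed.
Lemma core_sub : N \subset A. Proof. exact: subsetDl. Qed.
Lemma coreA v : v \in N -> v \in A. Proof. exact: (subsetP core_sub). Qed.
Lemma surplusA v : v \in S -> v \in A. Proof. exact: (subsetP surplus_sub). Qed.
Lemma core_surplus : [disjoint N & S].
Proof. by rewrite disjoints_subset; apply/subsetP => v; rewrite !inE => /andP[]. Qed.

Lemma ndeg_split v : ndeg g v A = (ndeg g v N + ndeg g v S)%N.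
Proof.
have -> : A = N :|: S; last by rewrite ndegU // core_surplus.
apply/setP => v'; rewrite in_setU in_setD; have := @surplusA v'.
by case: (v' \in S) => [->|] //; rewrite ?orbT ?orbF.
Qed.

Lemma surplusE s : s \in S -> [/\ s \in A, ndeg g s A = 2%N & (ty s).2 = h.-1].
Proof. by rewrite inE => /andP[sA /andP[/eqP d /eqP w]]. Qed.

Lemma surplus_indep s x : s \in S -> x \in S -> ~~ g s x.
Proof.
move=> /surplusE[sA ds ws] /surplusE[xA dx wx]; apply/negP => gsx.
by apply: (adjacent_degree2 M sA xA gsx ds dx ws); rewrite wx; move: h0; clear; lia.
Qed.

Lemma surplus_ndeg s : s \in S -> ndeg g s N = 2%N /\ ndeg g s S = 0%N.
Proof.
move=> sS; have [_ ds _] := surplusE sS.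
have d0 : ndeg g s S = 0%N by apply: ndeg0P => u; apply: surplus_indep.
by split=> //; move: ds; rewrite ndeg_split d0 addn0.
Qed.

(** For a surplus vertex, twice its potential minus E per incident edge is 2 (o + 1). It has two
    neighbours, both in the core because surplus vertices are independent, and each receives o +
    1. *)
Lemma sum_charge : \sum_(v in N) D v = 2 * rho g ty A.
Proof.
have e : 2 * rho g ty A =
    \sum_(v in A) (2 * typeC h o (ty v) - E * (ndeg g v A)%:Z).
  rewrite sumrB -!mulr_sumr -(big_morph Posz PoszD (erefl _)) handshake //.
  by rewrite /rho /pot PoszM; ring.
rewrite e [RHS](big_setID S) /= (setIidPr surplus_sub) -/N.
have -> : \sum_(v in S) (2 * typeC h o (ty v) - E * (ndeg g v A)%:Z) =
    \sum_(v in N) (o.+1%:Z * (ndeg g v S)%:Z).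
  have -> : \sum_(v in S) (2 * typeC h o (ty v) - E * (ndeg g v A)%:Z) =
     \sum_(v in S) (o.+1%:Z * (ndeg g v N)%:Z).
    apply: eq_bigr => s sS; have [sA ds ws] := surplusE sS.
    have [-> _] := surplus_ndeg sS; rewrite ds (typeCU M) // ws cost_lin ?leq_pred //.
    by par0 h o h0.
  rewrite -!mulr_sumr -!(big_morph Posz PoszD (erefl _)); congr (_ * Posz _).
  by have := cutC gs S N.
rewrite -big_split /=; apply: eq_bigr => v vN; rewrite (typeCU M) ?coreA // /D; ring.
Qed.

(** The full sum is 2 [rho] of A, hence at least -4; with no positive terms, every partial sum obeys
    the same bound. *)
Lemma few_charge (l : seq T) : (forall v, v \in N -> D v <= 0) ->
  uniq l -> {subset l <= N} -> -4 <= \sum_(v <- l) D v.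
Proof.
move=> D0 ul sl.
have : -4 <= \sum_(v in N) D v.
  by rewrite sum_charge; have := sp (subxx A) (A_neq0 M); move: (rho _ _ _); lia0.
move/le_trans; apply.
rewrite (bigID (mem l)) /= -[leRHS]addr0; apply: lerD.
  rewrite (big_uniq _ ul) /= le_eqVlt; apply/orP; left; apply/eqP.
  by apply: eq_bigl => v; rewrite andb_idl // => /sl.
by apply: sumr_le0 => v /andP[vN _]; apply: D0.
Qed.

Lemma core_degree2 v : v \in N -> ndeg g v A = 2%N -> (h <= (ty v).2)%N.
Proof.
move=> vN d2; have := light_degree2 M (coreA vN) d2.
move: vN; rewrite in_setD => /andP[+ vA]; rewrite inE vA d2 eqxx /=.
by move: (ty v).2 => w; clear; lia.
Qed.

Lemma coloring_False X : X \subset A ->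
  (forall x y, x \in A :\: X -> y \in A :\: X -> ~~ g x y) -> good k g ty X -> False.
Proof.
move=> sX iX gX; apply: (mc_nc M); exists X; split=> //.
by move=> v vA; rewrite (not_typeF M).
Qed.

Lemma core_compl x : x \in A :\: N -> x \in S.
Proof.
by rewrite inE [x \in N]inE negb_and negbK => /andP[/orP[//|/negbTE ->]].
Qed.

Lemma core_coloring :
  (forall v, v \in N -> (k.+1 * ndeg g v N < 2 * (k.+1 - wt (ty v)))%N) -> False.
Proof.
move=> hN; apply: (coloring_False core_sub); last exact: good_local.
by move=> x y /core_compl xS /core_compl; apply: surplus_indep.
Qed.

Lemma wt_core v : v \in N -> wt (ty v) = (ty v).2.+1.
Proof. by move/coreA/(wtU M). Qed.

Lemma ndeg2E v : ndeg g v N = 2%N -> exists x y,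
  [/\ x != y, x \in N, y \in N, g v x & g v y] /\
  forall u, u \in N -> g v u -> u = x \/ u = y.
Proof.
move=> /eqP/cards2P[x [y] [xy e]]; exists x, y.
have inN u : (u \in N) && g v u = (u == x) || (u == y).
  by have := congr1 (fun B : {set T} => u \in B) e; rewrite [in X in X -> _]inE !inE.
have := inN x; have := inN y; rewrite !eqxx orbT => /andP[yN gvy] /andP[xN gvx].
split=> // u uN gvu; have := inN u; rewrite uN gvu.
by case: (eqVneq u x) => [->|_]; [left|case: eqVneq => // ->; right].
Qed.

Lemma ndeg_gt0_sym x y : x \in N -> y \in N -> g x y -> (0 < ndeg g y N)%N.
Proof. by move=> xN yN gxy; apply: (ndeg_gt0 xN); rewrite gs. Qed.

End Discharging.

(** * Colouring the whole graph for even k *)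

Section Endgame.
Context (h : nat) (o : bool) (T : finType) (g : rel T) (ty : T -> vtype) (A : {set T}).
Context (M : mincex h o g ty A).
Local Notation k := (kpar h o).
Local Notation E := (edgeC h o).
Local Notation I := (indC h o).
Local Notation cost := (cost h o).
Local Notation rho := (rho h o).
Local Notation S := (surplus h g ty A).
Local Notation N := (core h g ty A).
Local Notation D := (charge h o g ty A).
Let h0 := mc_h M.
Let gs := mc_sym M.
Let gi := mc_irr M.
Implicit Types (a b c u v x y z s : T) (X Y C : {set T}).

Lemma charge_big_degree v : (4 <= ndeg g v A)%N ->
  D v <= - (1 + o%:Z) * (ndeg g v N)%:Z - 4 + 2 * o%:Z.
Proof.
move=> d4; have := @cost_ge0 h o h0 (ty v).2; have sd := ndeg_split h g ty A v.
have e : (ndeg g v A)%:Z = 4 + (ndeg g v A - 4)%N%:Z by move: d4; lia0.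
have E5 : 5 + 2 * o%:Z <= E by par0 h o h0.
have : (5 + 2 * o%:Z) * (ndeg g v A - 4)%N%:Z <= E * (ndeg g v A - 4)%N%:Z by rewrite ler_wpM2r.
rewrite /charge e mulrDr; move: E5 sd d4; par h o.
by case: o H1 H0 => /=; move: h0; clear; lia.
Qed.

(** With t surplus neighbours, degree 2 and weight h + 1 give charge -4 + t, while degree 3 and
    weight 1 give -3 + t. Greater weights give charges below -4, which the total forbids. *)
Lemma even_charge v : ~~ o -> v \in N ->
  [\/ ndeg g v A = 2%N /\ ((ty v).2 = h /\ D v = - 2 - (ndeg g v N)%:Z \/
        D v <= - 6 - (ndeg g v N)%:Z),
      ndeg g v A = 3%N /\ ((ty v).2 = 0%N /\ D v = - (ndeg g v N)%:Z \/
        D v <= - 6 - (ndeg g v N)%:Z) |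
      (4 <= ndeg g v A)%N /\ D v <= - 4 - (ndeg g v N)%:Z].
Proof.
move=> o0 vN; have vA := coreA vN; have d2 := min_degree M vA.
have sd := ndeg_split h g ty A v; have oE : o = false by apply/negbTE.
case: (ltngtP (ndeg g v A) 3) => [d3|d4|d3].
- have dE : ndeg g v A = 2%N by move: d2 d3; lia0.
  have wh := core_degree2 M vN dE; constructor 1; split=> //.
  have [wE|wne] := eqVneq (ty v).2 h; [left|right].
    by split=> //; rewrite /charge wE cost_lin // dE; move: sd; rewrite dE oE; par0 h false h0.
  have wg : (h < (ty v).2)%N by rewrite ltn_neqAle eq_sym wne.
  have := @cost_mono h o h0 _ _ wg; rewrite /charge dE; move: sd; rewrite dE.
  have -> : cost h.+1 = (3 * h)%:Z + 2 by case: (costP h o h.+1) => -[? ->]; move: h0; lia.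
  by rewrite oE; par0 h false h0.
- by constructor 3; split=> //; have := charge_big_degree d4; rewrite oE; lia0.
constructor 2; split=> //; have [wE|wne] := eqVneq (ty v).2 0%N; [left|right].
  by split=> //; rewrite /charge wE cost_lin // d3; move: sd; rewrite d3 oE; par0 h false h0.
have wg : (1 <= (ty v).2)%N by rewrite lt0n.
have := @cost_mono h o h0 _ _ wg; rewrite /charge d3; move: sd; rewrite d3.
by rewrite (@cost_lin h o h0 1) // oE; par0 h false h0.
Qed.

Lemma even_False : ~~ o -> False.
Proof.
move=> o0; have oE : o = false by apply/negbTE.
have D0 v : v \in N -> D v <= 0.
  by move=> vN; case: (even_charge o0 vN) => [[_ [[_]|]]|[_ [[_]|]]|[_]]; lia0.
have few (l : seq T) := @few_charge _ _ _ _ _ _ M l D0.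
have Dn v : v \in N -> D v <= - (ndeg g v N)%:Z.
  by move=> vN; case: (even_charge o0 vN) => [[_ [[_]|]]|[_ [[_]|]]|[_]]; lia0.
have few1 v : v \in N -> -4 <= D v.
  move=> vN; have := few [:: v]; rewrite big_seq1; apply=> // u.
  by rewrite inE => /eqP ->.
have few2 u v : u \in N -> v \in N -> u != v -> -4 <= D u + D v.
  move=> uN vN uv; have := few [:: u; v]; rewrite big_cons big_seq1; apply=> /=.
    by rewrite inE uv.
  by move=> x; rewrite !in_cons in_nil orbF => /orP[] /eqP ->.
have few3 u v w : u \in N -> v \in N -> w \in N -> u != v -> u != w -> v != w ->
    -4 <= D u + (D v + D w).
  move=> uN vN wN uv uw vw; have := few [:: u; v; w].
  rewrite !big_cons big_nil addr0; apply=> /=; first by rewrite !inE negb_or uv uw vw.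
  by move=> x; rewrite !in_cons in_nil orbF => /or3P[] /eqP ->.
have few4 u v w z : u \in N -> v \in N -> w \in N -> z \in N ->
    uniq [:: u; v; w; z] -> -4 <= D u + (D v + (D w + D z)).
  move=> uN vN wN zN un; have := few [:: u; v; w; z].
  rewrite !big_cons big_nil addr0; apply=> // x.
  by rewrite !in_cons in_nil orbF => /or4P[] /eqP ->.
have [/existsP[u /andP[uN bad]]|none] := boolP [exists u in N,
  (1 < ndeg g u N)%N || (ndeg g u A == 2%N) && (0 < ndeg g u N)%N]; last first.
  apply: (core_coloring M) => v vN.
  have := few1 v vN; have wk := lightU M (coreA vN).
  have : ~~ ((1 < ndeg g v N)%N || (ndeg g v A == 2%N) && (0 < ndeg g v N)%N).
    by apply: contra none => b; apply/existsP; exists v; rewrite vN.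
  rewrite negb_or -leqNgt negb_and -leqNgt leqn0 => /andP[n1 n2].
  rewrite (wt_core M vN).
  case: (even_charge o0 vN) => [[dE]|[dE]|[dE]].
  - move: n2; rewrite dE /= => /eqP -> [[-> _] _|]; last by lia0.
    by rewrite muln0; par0 h o h0.
  - case=> [[-> _]|]; last by move: n1; lia0.
    move: n1; case: (ndeg g v N) => [|[|//]] _ _; rewrite ?muln0 ?muln1 kparE oE; move: h0; lia0.
  - move=> Dv fv; have -> : ndeg g v N = 0%N by move: Dv fv; lia0.
    by rewrite muln0; move: wk; lia0.
(* Core neighbours of the bad vertex u have charge at most -1, so u and they exhaust the budget -4:
   as -3 - 1 if u has degree 2, and as -2 - 1 - 1 if it has degree 3. Nothing is left for core edges
   elsewhere. *)
have fact : [/\ ndeg g u S = 1%N, forall z, z \in N -> z != u -> -1 <= D z &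
    forall z, z \in N -> z != u -> (0 < ndeg g z N)%N -> g u z].
  have sd := ndeg_split h g ty A u.
  have nbr y : y \in N -> g u y -> D y <= -1.
    by move=> yN guy; have := Dn y yN; have := ndeg_gt0_sym M uN yN guy; lia0.
  have [nu1|nu2] := leqP (ndeg g u N) 1.
    move: bad; rewrite ltnNge nu1 /= => /andP[/eqP d2 n0].
    have nu : ndeg g u N = 1%N by apply/eqP; rewrite eqn_leq nu1.
    have [y yN guy] := ndeg_gt0E n0.
    have Du : D u <= -3.
      by case: (even_charge o0 uN) => [[_ [[_]|]]|[]|[]]; rewrite ?nu ?d2 //; lia0.
    have uy := del_neq gi guy; have Dy := nbr y yN guy.
    split; first by move: sd; rewrite d2 nu; lia0.
    - move=> z zN zu; have [->|zy] := eqVneq z y.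
        by have := few2 u y uN yN uy; move: Du; lia0.
      have := few3 u y z uN yN zN uy; rewrite eq_sym zu eq_sym zy => /(_ isT isT).
      by move: Du Dy; lia0.
    - move=> z zN zu nz; have [->//|zy] := eqVneq z y.
      have := few3 u y z uN yN zN uy; rewrite eq_sym zu eq_sym zy => /(_ isT isT).
      by have := Dn z zN; move: nz Du Dy; lia0.
  have nle : (ndeg g u N <= 2)%N.
    rewrite leqNgt; apply/negP => n3; have /card_gt2P[x [y [z]]] := n3.
    case=> -[]; rewrite [x \in _]inE [y \in _]inE [z \in _]inE => /andP[xN gx] /andP[yN gy] /andP[zN gz] [xy yz zx].
    have ux := del_neq gi gx; have uy := del_neq gi gy; have uz := del_neq gi gz.
    have := few4 u x y z uN xN yN zN; rewrite /= !inE !negb_or ux uy uz xy yz [x == z]eq_sym zx.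
    move=> /(_ isT); have := Dn u uN; have := nbr x xN gx; have := nbr y yN gy.
    by have := nbr z zN gz; move: n3; lia0.
  have nu : ndeg g u N = 2%N by apply/eqP; rewrite eqn_leq nle.
  have [x [y [[xy xN yN gx gy] hu]]] := ndeg2E nu.
  have ux := del_neq gi gx; have uy := del_neq gi gy.
  have Dx := nbr x xN gx; have Dy := nbr y yN gy.
  have f3 := few3 u x y uN xN yN ux uy xy.
  have Du := Dn u uN; rewrite nu in Du.
  have d3 : ndeg g u A = 3%N.
    case: (even_charge o0 uN) => [[_ [[_]|]]|[]//|[_]]; rewrite nu; move: f3 Dx Dy; lia0.
  have other z : z \in N -> z != u -> z != x -> z != y -> 0 <= D z.
    move=> zN zu zx zy; have := few4 u x y z uN xN yN zN.
    rewrite /= !inE !negb_or ux uy xy [u == z]eq_sym zu [x == z]eq_sym zx [y == z]eq_sym zy.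
    by move=> /(_ isT); move: Du Dx Dy; lia0.
  split; first by move: sd; rewrite d3 nu; lia0.
  - move=> z zN zu; have [->|zx] := eqVneq z x; first by move: f3 Du Dy; lia0.
    have [->|zy] := eqVneq z y; first by move: f3 Du Dx; lia0.
    by have := other z zN zu zx zy; lia0.
  - move=> z zN zu nz; have [->//|zx] := eqVneq z x; have [->//|zy] := eqVneq z y.
    by have := other z zN zu zx zy; have := Dn z zN; move: nz; lia0.
have [tu1 Dz gz] := fact.
have indN z y : z \in N -> y \in N -> z != u -> y != u -> ~~ g z y.
  move=> zN yN zu yu; apply/negP => gzy.
  have n0 : (0 < ndeg g z N)%N by apply: ndeg_gt0 gzy.
  have guz := gz z zN zu n0.
  have : (1 < ndeg g z N)%N.
    rewrite (ndegD1 _ _ uN) gs guz (@ndegD1 _ _ _ y) ?gzy //.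
    by rewrite in_setD1 yu.
  by have := Dz z zN zu; have := Dn z zN; lia0.
have [s sS gus] : exists2 s, s \in S & g u s by apply: ndeg_gt0E; rewrite tu1.
have [sA ds ws] := surplusE sS.
have uS : u \notin S by rewrite (disjointFr (core_surplus _ _ _ _) uN).
have sN : s \notin N by rewrite (disjointFl (core_surplus _ _ _ _) sS).
(* With u independent, its only surplus neighbour s moves to the forest, where one of its two core
   neighbours remains. The other core vertices are pairwise nonadjacent, and their charge of at
   least -1 means weight 1. *)
pose X := (N :\ u) :|: [set s].
have sX : X \subset A.
  by rewrite subUset sub1set sA andbT; apply: subset_trans (subD1set _ _) (core_sub _ _ _ _).
apply: (coloring_False M sX).
  have rest x : x \in A :\: X -> x = u \/ x \in S /\ x != s.
    rewrite in_setD in_setU in_setD1 in_set1 negb_or negb_and negbK => /andP[/andP[hx xs] xA].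
    case/orP: hx => [/eqP|xN]; first by left.
    by right; split=> //; apply: core_compl; rewrite in_setD xN.
  have onlys x : x \in S -> x != s -> ~~ g u x.
    move=> xS xs; apply/negP => gux; move: tu1; rewrite (ndegD1 _ _ sS) gus.
    have xSs : x \in S :\ s by rewrite in_setD1 xs.
    by have := ndeg_gt0 xSs gux; lia0.
  move=> x y /rest[->|[xS xs]] /rest[->|[yS ys]]; first by rewrite gi.
  - exact: onlys.
  - by rewrite gs; apply: onlys.
  - exact: (surplus_indep M).
have sX' : ndeg g s X = 1%N.
  have us : u \in A by apply: coreA uN.
  have : ndeg g s (u |: X) = 2%N.
    have [sn _] := surplus_ndeg M sS; rewrite -sn; apply/eqP; rewrite eqn_leq.
    rewrite -[X in _ && X]/(_ <= _)%N; apply/andP; split.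
      rewrite sn -ds; apply: ndegS; by rewrite subUset sub1set us.
    apply: ndegS; apply/subsetP => z zN; rewrite in_setU1 in_setU in_setD1 zN.
    by case: (z == u).
  rewrite ndegU1; last by rewrite in_setU in_setD1 eqxx in_set1 /=; apply: contraNneq uS => ->.
  by rewrite gs gus; lia0.
apply: good_local => // v; rewrite in_setU in_setD1 in_set1 => /orP[/andP[vu vN]|/eqP ->].
  have wv : wt (ty v) = 1%N.
    have := Dz v vN vu; rewrite (wt_core M vN).
    by case: (even_charge o0 vN) => [[_ [[_]|]]|[_ [[->]|]]|[_]] //; lia0.
  have : (ndeg g v X <= 1)%N.
    rewrite (@ndegD1 _ _ _ s) ?in_setU ?in_set1 ?eqxx ?orbT //.
    rewrite ndeg0P => [|y]; first by case: (g v s).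
    rewrite in_setD1 in_setU in_setD1 in_set1 => /andP[/negbTE ->]; rewrite orbF => /andP[yu yN].
    exact: indN.
  rewrite wv kparE oE; case: (ndeg g v X) => [|[|//]] _; rewrite ?muln0 ?muln1; move: h0; lia0.
by rewrite sX' (wtU M) // ws muln1 kparE oE; move: h0; lia0.
Qed.

End Endgame.

(** * Colouring the whole graph for odd k *)

Section OddEndgame.
Context (h : nat) (o : bool) (T : finType) (g : rel T) (ty : T -> vtype) (A : {set T}).
Context (M : mincex h o g ty A).
Local Notation k := (kpar h o).
Local Notation E := (edgeC h o).
Local Notation I := (indC h o).
Local Notation cost := (cost h o).
Local Notation rho := (rho h o).
Local Notation S := (surplus h g ty A).
Local Notation N := (core h g ty A).
Local Notation D := (charge h o g ty A).
Let h0 := mc_h M.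
Let gs := mc_sym M.
Let gi := mc_irr M.
Implicit Types (a b c u v x y z s : T) (X Y C : {set T}).

Lemma cubic_light_one_surplus v : o -> v \in N -> ndeg g v A = 3%N -> (ty v).2 = 0%N ->
  (ndeg g v S <= 1)%N.
Proof.
move=> oT vN d3 w0; rewrite leqNgt; apply/negP => /card_gt1P[p [q []]].
rewrite [p \in _]inE [q \in _]inE => /andP[pS gvp] /andP[qS gvq] pq.
have [pA dp wp] := surplusE pS; have [qA dq wq] := surplusE qS.
have pN : p \in [set u in A | g v u] by rewrite inE pA.
have qN : q \in [set u in A | g v u] :\ p by rewrite in_setD1 eq_sym pq inE qA.
have : #|[set u in A | g v u] :\ p :\ q| == 1%N.
  have := d3; rewrite /ndeg (cardsD1 p) pN (cardsD1 q) qN.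
  by move: #|_| => m; lia0.
case/cards1P => r e.
have inr u : [&& u != q, u != p, u \in A & g v u] = (u == r).
  by have := congr1 (fun B : {set T} => u \in B) e; rewrite !inE.
have /and4P[rq rp rA gvr] : [&& r != q, r != p, r \in A & g v r] by rewrite inr.
apply: (two_light_neighbors M oT (coreA vN) pA qA rA _ _ w0 dp dq wp wq).
  by rewrite /= !inE negb_or pq eq_sym rp eq_sym rq.
move=> u uA; rewrite !inE -inr uA /=.
by case: (eqVneq u p) => [->|] //=; case: (eqVneq u q) => [->|].
Qed.

(** A surplus vertex now gives 2 to each neighbour, which would be too much without the exclusions:
    core vertices of degree 2 and weight h + 1 have no surplus neighbour, and cubic ones of weight 1
    have at most one. *)
Lemma odd_charge v : o -> v \in N ->
  [\/ [/\ ndeg g v A = 2%N, ndeg g v N = 2%N, (ty v).2 = h & D v = -2],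
      [/\ ndeg g v A = 3%N, ndeg g v N = 2%N, (ty v).2 = 0%N & D v = -1],
      ndeg g v N = 3%N /\ D v <= -3 |
      D v <= - 2 - 2 * (ndeg g v N)%:Z].
Proof.
move=> oT vN; have vA := coreA vN; have d2 := min_degree M vA.
have sd := ndeg_split h g ty A v; have oE : o = true by [].
case: (ltngtP (ndeg g v A) 3) => [d3|d4|d3].
- have dE : ndeg g v A = 2%N by move: d2 d3; lia0.
  have wh := core_degree2 M vN dE.
  have [wE|wne] := eqVneq (ty v).2 h.
    have t0 : ndeg g v S = 0%N.
      apply: ndeg0P => s sS; apply/negP => gvs; have [sA ds ws] := surplusE sS.
      rewrite gs in gvs; apply: (adjacent_degree2 M sA vA gvs ds dE ws).
      by rewrite wE oE addn1.
    constructor 1; split=> //; first by move: sd; rewrite dE t0 addn0.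
    by rewrite /charge wE cost_lin // dE t0 oE; par0 h true h0.
  constructor 4; rewrite /charge dE; move: sd; rewrite dE.
  have wg : (h < (ty v).2)%N by rewrite ltn_neqAle eq_sym wne.
  have := @cost_mono h o h0 _ _ wg.
  have -> : cost h.+1 = (3 * h)%:Z + 2 by case: (costP h o h.+1) => -[? ->]; move: h0; lia.
  by rewrite oE; par0 h true h0.
- constructor 4; have := charge_big_degree M d4; rewrite oE; lia0.
have [wE|wne] := eqVneq (ty v).2 0%N; last first.
  constructor 4; rewrite /charge d3; move: sd; rewrite d3.
  have wg : (1 <= (ty v).2)%N by rewrite lt0n.
  have := @cost_mono h o h0 _ _ wg.
  by rewrite (@cost_lin h o h0 1) // oE; par0 h true h0.
have t1 := cubic_light_one_surplus oT vN d3 wE.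
have De : D v = 3 - 2 * (ndeg g v N)%:Z.
  by rewrite /charge wE cost_lin // d3; move: sd; rewrite d3 oE; par0 h true h0.
move: sd; rewrite d3; move: t1 De; case: (ndeg g v S) => [|[|//]] _ De sd.
  by constructor 3; move: De sd; lia0.
have n2 : ndeg g v N = 2%N by move: sd; lia0.
by constructor 2; split=> //; rewrite De n2.
Qed.

(** The vertex v can join the surplus in the independent set, leaving the edge xy as a component of
    weight 2. *)
Lemma triangle_False v x y : o -> N = [set v; x; y] ->
  v != x -> v != y -> x != y -> g v x -> g v y -> g x y ->
  ndeg g v S = 0%N -> (ty x).2 = 0%N -> (ty y).2 = 0%N -> False.
Proof.
move=> oT NE vx vy xy gvx gvy gxy t0 wx wy.
have xN : x \in N by rewrite NE !inE eqxx orbT.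
have yN : y \in N by rewrite NE !inE eqxx orbT.
have sX : [set x; y] \subset A by rewrite subUset !sub1set (coreA xN) (coreA yN).
apply: (coloring_False M sX).
  have rest z : z \in A :\: [set x; y] -> z = v \/ z \in S.
    rewrite in_setD in_set2 => /andP[/norP[zx zy] zA].
    have [zN|zN] := boolP (z \in N); last by right; apply: core_compl; rewrite in_setD zN.
    by left; move: zN; rewrite NE !inE (negbTE zx) (negbTE zy) !orbF => /eqP.
  have vS s : s \in S -> ~~ g v s.
    by move=> sS; apply/negP => gvs; have := ndeg_gt0 sS gvs; rewrite t0.
  move=> a b /rest[->|aS] /rest[->|bS]; first by rewrite gi.
  - exact: vS.
  - by rewrite gs; apply: vS.
  - exact: (surplus_indep M).
apply: good_local => // z zX.
have zN : z \in N by move: zX; rewrite in_set2 => /orP[] /eqP ->.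
have -> : wt (ty z) = 1%N.
  by rewrite (wt_core M zN); move: zX; rewrite in_set2 => /orP[] /eqP ->; rewrite ?wx ?wy.
have : (ndeg g z [set x; y] <= 1)%N.
  have c1 : #|[set x; y] :\ z| = 1%N by have := cardsD1 z [set x; y]; rewrite zX cards2 xy; lia0.
  rewrite (ndegD1 g z zX) gi add0n -c1; apply: subset_leq_card.
  by apply/subsetP => u; rewrite inE => /andP[].
case: (ndeg g z _) => [|[|//]] _; rewrite ?muln0 ?muln1 kparE oT; move: h0; lia0.
Qed.

Lemma other2 v x : ndeg g x N = 2%N -> v \in N -> g x v ->
  exists z, [/\ z \in N, z != v, g x z & forall u, u \in N -> g x u -> u = v \/ u = z].
Proof.
move=> n2 vN gxv; have [a [b [[ab aN bN ga gb] hx]]] := ndeg2E n2.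
case: (hx v vN gxv) => e; rewrite e.
  by exists b; split=> //; rewrite eq_sym.
by exists a; split=> // u uN gu; case: (hx u uN gu); [right|left].
Qed.

(** With v and z independent, their surplus neighbours move to the forest and keep at most one
    neighbour there; x and y see at most their single surplus neighbour. The forest is thus a
    matching plus isolated vertices. *)
Lemma square_False v x y z : o -> (forall u, u \in N -> u \in [:: v; x; y; z]) ->
  x \in N -> y \in N -> v \in N -> z \in N ->
  ~~ g x y -> ~~ g v z -> ndeg g x S = 1%N -> ndeg g y S = 1%N ->
  (ty x).2 = 0%N -> (ty y).2 = 0%N -> v \notin [:: x; y] -> z \notin [:: x; y] -> False.
Proof.
move=> oT hN xN yN vN zN gxy gvz tx ty1 wx wy vxy zxy.
pose X := [set x; y] :|: [set s in S | g v s || g z s].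
have NS u : u \in N -> u \notin S by move=> uN; rewrite (disjointFr (core_surplus _ _ _ _) uN).
have sX : X \subset A.
  rewrite !subUset !sub1set (coreA xN) (coreA yN) /=; apply/subsetP => s; rewrite inE => /andP[sS _].
  exact: surplusA sS.
apply: (coloring_False M sX).
  have rest a : a \in A :\: X -> a \in [:: v; z] \/ [/\ a \in S, ~~ g v a & ~~ g z a].
    rewrite in_setD in_setU in_set2 !negb_or => /andP[/andP[/andP[ax ay] aX] aA].
    have [aN|aN] := boolP (a \in N).
      left; have := hN a aN; rewrite !in_cons in_nil orbF (negbTE ax) (negbTE ay) /=.
      by case: (a == v).
    have aS : a \in S by apply: core_compl; rewrite in_setD aN.
    by right; move: aX; rewrite inE aS /= negb_or => /andP[].
  have mix a b : a \in [:: v; z] -> [/\ b \in S, ~~ g v b & ~~ g z b] -> ~~ g a b.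
    by rewrite !in_cons in_nil orbF => /orP[] /eqP -> [].
  move=> a b /rest[aV|aS] /rest[bV|bS].
  - move: aV bV; rewrite !in_cons in_nil !orbF.
    by move=> /orP[] /eqP -> /orP[] /eqP ->; rewrite ?gi // gs.
  - exact: mix.
  - by rewrite gs; apply: mix.
  - by case: aS bS => [aS _ _] [bS _ _]; apply: (surplus_indep M).
have noxy a b : a \in [set x; y] -> b \in [set x; y] -> ~~ g a b.
  by rewrite !in_set2 => /orP[] /eqP -> /orP[] /eqP ->; rewrite ?gi // gs.
have end_deg u : u \in [set x; y] -> ndeg g u S = 1%N -> (ndeg g u X <= 1)%N.
  move=> uxy <-; apply: subset_leq_card; apply/subsetP => w; rewrite inE in_setU.
  move=> /andP[/orP[wxy|wS] guw]; last by rewrite inE guw andbT; move: wS; rewrite inE => /andP[].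
  by have := noxy u w uxy wxy; rewrite guw.
apply: good_local => // u; rewrite in_setU => /orP[uxy|].
  have uN : u \in N by move: uxy; rewrite in_set2 => /orP[] /eqP ->.
  have -> : wt (ty u) = 1%N.
    by rewrite (wt_core M uN); move: uxy; rewrite in_set2 => /orP[] /eqP ->; rewrite ?wx ?wy.
  have : (ndeg g u X <= 1)%N.
    by apply: end_deg => //; move: uxy; rewrite in_set2 => /orP[] /eqP ->.
  by case: (ndeg g u X) => [|[|//]] _; rewrite ?muln0 ?muln1 kparE oT; move: h0; lia0.
rewrite inE => /andP[uS guv].
have [w [wN wX guw]] : exists w, [/\ w \in N, w \notin X & g u w].
  have nX w : w \in N -> w \notin [:: x; y] -> w \notin X.
    move=> wN; rewrite !in_cons in_nil orbF => wxy.
    by rewrite in_setU in_set2 (negbTE wxy) /= inE (negbTE (NS w wN)).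
  by case/orP: guv => gu; [exists v|exists z]; split; rewrite ?nX // gs.
have [sn _] := surplus_ndeg M uS; have [uA _ wu] := surplusE uS.
have : (ndeg g u X <= 1)%N.
  have -> : 1%N = ndeg g u (N :\ w) by move: sn; rewrite (ndegD1 _ _ wN) guw; lia0.
  apply: subset_leq_card; apply/subsetP => c; rewrite inE => /andP[cX guc].
  rewrite inE guc andbT in_setD1; have -> : c != w by apply: contraNneq wX => <-.
  move: cX; rewrite in_setU => /orP[|].
    by rewrite in_set2 => /orP[] /eqP ->.
  by rewrite inE => /andP[cS _]; have := surplus_indep M uS cS; rewrite guc.
by rewrite (wtU M) // wu; case: (ndeg g u X) => [|[|//]] _; rewrite ?muln0 ?muln1 kparE oT; move: h0; lia0.
Qed.

Lemma odd_False : o -> False.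
Proof.
move=> oT.
have Dm v : v \in N -> D v <= -1.
  by move=> vN; case: (odd_charge oT vN) => [[_ _ _ ->]|[_ _ _ ->]|[_]|]; lia0.
have D0 v : v \in N -> D v <= 0 by move/Dm; lia0.
have few (l : seq T) := @few_charge _ _ _ _ _ _ M l D0.
have few2 u v : u \in N -> v \in N -> u != v -> -4 <= D u + D v.
  move=> uN vN uv; have := few [:: u; v]; rewrite big_cons big_seq1; apply=> /=.
    by rewrite inE uv.
  by move=> x; rewrite !in_cons in_nil orbF => /orP[] /eqP ->.
have few3 u v w : u \in N -> v \in N -> w \in N -> uniq [:: u; v; w] ->
    -4 <= D u + (D v + D w).
  move=> uN vN wN un; have := few [:: u; v; w].
  rewrite !big_cons big_nil addr0; apply=> //.
  by move=> x; rewrite !in_cons in_nil orbF => /or3P[] /eqP ->.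
have few4 u v w z : u \in N -> v \in N -> w \in N -> z \in N ->
    uniq [:: u; v; w; z] -> -4 <= D u + (D v + (D w + D z)).
  move=> uN vN wN zN un; have := few [:: u; v; w; z].
  rewrite !big_cons big_nil addr0; apply=> // x.
  by rewrite !in_cons in_nil orbF => /or4P[] /eqP ->.
have few5 t u v w z : t \in N -> u \in N -> v \in N -> w \in N -> z \in N ->
    ~~ uniq [:: t; u; v; w; z].
  move=> tN uN vN wN zN; apply/negP => un; have := few [:: t; u; v; w; z].
  rewrite !big_cons big_nil addr0.
  have := Dm t tN; have := Dm u uN; have := Dm v vN; have := Dm w wN; have := Dm z zN.
  move: (D t) (D u) (D v) (D w) (D z) => d1 d2 d3 d4 d5 l1 l2 l3 l4 l5 H.
  suff : -4 <= d1 + (d2 + (d3 + (d4 + d5))) by move: l1 l2 l3 l4 l5; lia0.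
  apply: H => // x; rewrite !in_cons in_nil orbF.
  by case/or4P => [/eqP ->|/eqP ->|/eqP ->|/orP[] /eqP ->].
have n02 v : v \in N -> (0 < ndeg g v N)%N ->
  [/\ ndeg g v A = 2%N, ndeg g v N = 2%N, (ty v).2 = h & D v = -2] \/
  [/\ ndeg g v A = 3%N, ndeg g v N = 2%N, (ty v).2 = 0%N & D v = -1].
  move=> vN n0; case: (odd_charge oT vN) => [c|c|[n3 D3]|c]; [by left|by right| |].
    have : (2 < #|[set u in N | g v u]|)%N by rewrite -[#|_|]/(ndeg g v N) n3.
    case/card_gt2P => [x [y [z]]] [[]].
    rewrite [x \in _]inE [y \in _]inE [z \in _]inE => /andP[xN gx] /andP[yN gy] /andP[zN gz] [xy yz zx].
    have vx := del_neq gi gx; have vy := del_neq gi gy; have vz := del_neq gi gz.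
    have := few4 v x y z vN xN yN zN.
    rewrite /= !inE !negb_or vx vy vz xy yz [x == z]eq_sym zx => /(_ isT).
    by have := Dm x xN; have := Dm y yN; have := Dm z zN; move: D3; lia0.
  have [x xN gvx] := ndeg_gt0E n0.
  have := few2 v x vN xN (del_neq gi gvx); have := Dm x xN.
  by move: c n0; lia0.
have n2 v : v \in N -> (0 < ndeg g v N)%N -> ndeg g v N = 2%N.
  by move=> vN /(n02 v vN)[] [].
have [/existsP[v /andP[vN nv]]|none] := boolP [exists v in N, (0 < ndeg g v N)%N]; last first.
  apply: (core_coloring M) => v vN.
  have -> : ndeg g v N = 0%N.
    apply/eqP; rewrite -leqn0 leqNgt; apply: contra none => n0.
    by apply/existsP; exists v; rewrite vN.
  by rewrite muln0 (wt_core M vN); have := lightU M (coreA vN); lia0.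
have [x [y [[xy xN yN gvx gvy] hv]]] := ndeg2E (n2 v vN nv).
have vx := del_neq gi gvx; have vy := del_neq gi gvy.
have nx := ndeg_gt0_sym M vN xN gvx; have ny := ndeg_gt0_sym M vN yN gvy.
have tA u : u \in N -> (0 < ndeg g u N)%N -> D u = -1 -> ndeg g u S = 1%N /\ (ty u).2 = 0%N.
  move=> uN nu Du; case: (n02 u uN nu) => [[_ _ _]|[d3 n2' w0 _]]; first by rewrite Du.
  by split=> //; have := ndeg_split h g ty A u; rewrite d3 n2'; lia0.
have tB u : u \in N -> (0 < ndeg g u N)%N -> D u = -2 -> ndeg g u S = 0%N.
  move=> uN nu Du; case: (n02 u uN nu) => [[d2' n2' _ _]|[_ _ _]]; last by rewrite Du.
  by have := ndeg_split h g ty A u; rewrite d2' n2'; lia0.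
have D12 u : u \in N -> (0 < ndeg g u N)%N -> D u = -1 \/ D u = -2.
  by move=> uN nu; case: (n02 u uN nu) => -[]; [right|left].
have Dvn := Dm v vN; have Dxn := Dm x xN; have Dyn := Dm y yN.
have [gxy|gxy] := boolP (g x y).
  have NE : N = [set v; x; y].
    apply/eqP; rewrite eq_sym eqEsubset; apply/andP; split.
      by apply/subsetP => u; rewrite !in_setU !in_set1 => /orP[/orP[]|] /eqP ->.
    apply/subsetP => z zN; rewrite !in_setU !in_set1 -orbA; apply/negPn/negP.
    rewrite !negb_or => /and3P[zv zx zy].
    have un : uniq [:: v; x; y; z].
      by rewrite /= !inE !negb_or vx vy xy [v == z]eq_sym zv [x == z]eq_sym zx [y == z]eq_sym zy.
    have Dz : D z = -1.
      by have := few4 v x y z vN xN yN zN un; have := Dm z zN; move: Dvn Dxn Dyn; lia0.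
    have nz : (0 < ndeg g z N)%N.
      case: (odd_charge oT zN) => [[_ -> //]|[_ -> //]|[-> //]|]; rewrite Dz; lia0.
    have [w wN gzw] := ndeg_gt0E nz.
    have wv : w != v.
      apply/negP => /eqP wv; rewrite wv gs in gzw.
      by case: (hv z zN gzw) => e; [rewrite e eqxx in zx|rewrite e eqxx in zy].
    have wx : w != x.
      apply/negP => /eqP wx; rewrite wx gs in gzw.
      have [t [_ tv gxt ht]] := other2 (n2 x xN nx) vN (etrans (gs _ _) gvx).
      case: (ht y yN gxy) => e; first by rewrite e eqxx in vy.
      by case: (ht z zN gzw) => e'; [rewrite e' eqxx in zv|rewrite e' -e eqxx in zy].
    have wy : w != y.
      apply/negP => /eqP wy; rewrite wy gs in gzw.
      have [t [_ tv gyt ht]] := other2 (n2 y yN ny) vN (etrans (gs _ _) gvy).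
      case: (ht x xN (etrans (gs _ _) gxy)) => e; first by rewrite e eqxx in vx.
      by case: (ht z zN gzw) => e'; [rewrite e' eqxx in zv|rewrite e' -e eqxx in zx].
    have := few5 v x y z w vN xN yN zN wN.
    rewrite -[[:: v; x; y; z; w]]/(rcons [:: v; x; y; z] w) rcons_uniq un andbT negbK.
    rewrite !in_cons in_nil orbF (negbTE wv) (negbTE wx) (negbTE wy) /= => /eqP wz.
    by have := del_neq gi gzw; rewrite wz eqxx.
  (* Parity decides: three charges, each -1 or -2, have an even sum of at least -4, so exactly one
     of them is -2. *)
  have sum3 : D v + (D x + D y) = 2 * rho g ty A.
    rewrite -sum_charge // NE -setUA big_setU1 ?in_set2 ?negb_or ?vx //=.
    by rewrite big_setU1 ?in_set1 //= big_set1.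
  have f3 : -4 <= D v + (D x + D y).
    by apply: few3; rewrite //= !inE negb_or vx vy xy.
  have perm (a b c : T) : [set v; x; y] = [set a; b; c] -> N = [set a; b; c] by rewrite NE.
  have := D12 v vN nv; have := D12 x xN nx; have := D12 y yN ny.
  move: (rho g ty A) sum3 f3 => r sum3 f3.
  case=> ey; case=> ex; case=> ev; try by move: sum3 f3; rewrite ey ex ev; lia0.
  - have [_ wy'] := tA y yN ny ey; have [_ wx'] := tA x xN nx ex.
    exact: (@triangle_False v x y oT NE vx vy xy gvx gvy gxy (tB v vN nv ev)).
  - have [_ wy'] := tA y yN ny ey; have [_ wv'] := tA v vN nv ev.
    apply: (@triangle_False x v y oT _ _ xy vy _ gxy gvy (tB x xN nx ex)) => //.
    + by apply: perm; rewrite [[set x; v]]setUC.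
    + by rewrite eq_sym.
    + by rewrite gs.
  - have [_ wx'] := tA x xN nx ex; have [_ wv'] := tA v vN nv ev.
    apply: (@triangle_False y v x oT _ _ _ vx _ _ gvx (tB y yN ny ey)) => //; rewrite 1?eq_sym //.
    + by apply: perm; rewrite setUC setUA.
    + by rewrite gs.
    + by rewrite gs.
have [z [zN zv gxz hx]] := other2 (n2 x xN nx) vN (etrans (gs _ _) gvx).
have zx : z != x by rewrite eq_sym; apply: del_neq gxz.
have zy : z != y by apply: contraNneq gxy => <-.
have un : uniq [:: v; x; y; z].
  by rewrite /= !inE !negb_or vx vy xy [v == z]eq_sym zv [x == z]eq_sym zx [y == z]eq_sym zy.
have f4 := few4 v x y z vN xN yN zN un; have Dzn := Dm z zN.
have allN u : u \in N -> u \in [:: v; x; y; z].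
  move=> uN; have := few5 v x y z u vN xN yN zN uN.
  by rewrite -[[:: v; x; y; z; u]]/(rcons [:: v; x; y; z] u) rcons_uniq un andbT negbK.
have gvz : ~~ g v z.
  by apply/negP => /(hv z zN)[] e; [rewrite e eqxx in zx|rewrite e eqxx in zy].
have [tx wx] : ndeg g x S = 1%N /\ (ty x).2 = 0%N.
  by apply: tA => //; move: f4 Dvn Dxn Dyn Dzn; lia0.
have [ty1 wy] : ndeg g y S = 1%N /\ (ty y).2 = 0%N.
  by apply: tA => //; move: f4 Dvn Dxn Dyn Dzn; lia0.
apply: (@square_False v x y z oT allN) => //; rewrite !in_cons in_nil orbF negb_or.
  by rewrite vx vy.
by rewrite zx zy.
Qed.

End OddEndgame.

Theorem sparse_colorable h o (T : finType) (g : rel T) (ty : T -> vtype) (A : {set T}) :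
  (0 < h)%N -> symmetric g -> irreflexive g ->
  (forall v, v \in A -> okty (kpar h o) (ty v)) -> sparse h o g ty A ->
  colorable (kpar h o) g ty A.
Proof.
(* B bounds the number of arcs, so the measure below encodes the lexicographic order of [mincex]. *)
move=> h0; pose B := #|[set: T * T]|.
have [n] := ubnP (#|A| * B.+1 + #|[set p : T * T | g p.1 p.2]|)%N.
elim: n => // n IH in g ty A *; rewrite ltnS => le gs gi ok sp.
have [X|nc] := pselect (colorable (kpar h o) g ty A); first by [].
exfalso; have arcB (g' : rel T) : (#|[set p : T * T | g' p.1 p.2]| <= B)%N.
  by apply/subset_leq_card/subsetP => p; rewrite inE.
have M : mincex h o g ty A.
  split=> // g' ty'.
    move=> A' gs' gi' ok' sp' lt; apply: IH => //; apply: leq_trans le.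
    rewrite -addSn; apply: leq_trans (leq_addr _ _).
    have le1 := arcB g'; have := leq_mul lt (leqnn B.+1); rewrite mulSn; move: le1.
    by generalize B => b; lia0.
  by move=> gs' gi' ok' sp' lt; apply: IH => //; apply: leq_trans le; rewrite ltn_add2l.
by have [oT|oF] := boolP o; [apply: (odd_False M)|apply: (even_False M)].
Qed.

(** * Maximum average degree *)

Section Imset.
Context (T T' : finType) (f : T -> T') (finj : injective f).
Context (g : rel T) (gs : symmetric g) (gi : irreflexive g).
Context (g' : rel T') (gs' : symmetric g') (gi' : irreflexive g').

Lemma nedges_imset_le (W : {set T}) : (forall x y, g x y -> g' (f x) (f y)) ->
  (nedges g W <= nedges g' (f @: W))%N.
Proof.
move=> hom; elim/set_ind: W => [|x W xW IH]; first by rewrite imset0 !nedges0.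
rewrite imsetU1 !nedgesU1 // ?mem_imset //; apply: leq_add => //.
rewrite /ndeg -(card_imset [set u in W | g x u] finj); apply: subset_leq_card.
apply/subsetP => _ /imsetP[u + ->]; rewrite !inE => /andP[uW gxu].
by rewrite mem_imset // uW hom.
Qed.

Lemma nedges_imset (W : {set T}) : (forall x y, g x y = g' (f x) (f y)) ->
  nedges g W = nedges g' (f @: W).
Proof.
move=> hom; elim/set_ind: W => [|x W xW IH]; first by rewrite imset0 !nedges0.
rewrite imsetU1 !nedgesU1 // ?mem_imset // IH; congr (_ + _)%N.
rewrite /ndeg -(card_imset [set u in W | g x u] finj); apply: eq_card => z.
apply/imsetP/idP => [[u + ->]|]; first by rewrite !inE mem_imset // -hom.
by rewrite inE => /andP[/imsetP[u uW ->]] gxu; exists u => //; rewrite inE uW hom.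
Qed.
End Imset.

Section Mad.
Context (R : realType).
Implicit Types (G H : sgraph).

Lemma mad_ge G (W : {set G}) : W != set0 ->
  2 * (nedges (@adj G) W)%:R <= mad R G * #|W|%:R.
Proof.
move=> W0; have c0 : 0 < #|W|%:R :> R by rewrite ltr0n card_gt0.
rewrite -ler_pdivrMr //.
have := @le_bigmax_cond _ R _ 0 (W, [set e in edges G | e \subset W])
  (@nonempty_subgraph G) (@avg_degree R G).
apply; rewrite /nonempty_subgraph /= W0 /=; apply/andP; split.
  by apply/subsetP => e; rewrite inE => /andP[].
by apply/forall_inP => e; rewrite inE => /andP[].
Qed.

Lemma mad_ge0 G : 0 <= mad R G.
Proof. exact: bigmax_ge_id. Qed.

Lemma avg_degree_le G (H : {set G} * {set {set G}}) : nonempty_subgraph H ->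
  avg_degree R H <= 2 * (nedges (@adj G) H.1)%:R / #|H.1|%:R.
Proof.
move=> /and3P[H0 He /forall_inP Hs]; rewrite /avg_degree ler_pM2r; last first.
  by rewrite invr_gt0 ltr0n card_gt0.
rewrite ler_pM2l ?ltr0n // ler_nat; apply: subset_leq_card; apply/subsetP => e eH.
by rewrite inE (subsetP He e eH) Hs.
Qed.

Lemma mad_le G (y : R) : 0 <= y ->
  (forall W : {set G}, W != set0 -> 2 * (nedges (@adj G) W)%:R <= y * #|W|%:R) ->
  mad R G <= y.
Proof.
move=> y0 hW; apply: bigmax_le => // H nH; apply: le_trans (avg_degree_le nH) _.
have /and3P[H0 _ _] := nH.
by rewrite ler_pdivrMr ?ltr0n ?card_gt0 // hW.
Qed.

Lemma mad_lt G (y : R) : 0 < y ->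
  (forall W : {set G}, W != set0 -> 2 * (nedges (@adj G) W)%:R < y * #|W|%:R) ->
  mad R G < y.
Proof.
move=> y0 hW; apply: bigmax_lt => // H nH; apply: le_lt_trans (avg_degree_le nH) _.
have /and3P[H0 _ _] := nH.
by rewrite ltr_pdivrMr ?ltr0n ?card_gt0 // hW.
Qed.

Lemma mad_subgraph G H : contains_subgraph G H -> mad R H <= mad R G.
Proof.
case=> f finj fhom; apply: mad_le; first exact: mad_ge0.
move=> W W0; have fW0 : f @: W != set0 by rewrite imset_eq0.
have := mad_ge fW0; rewrite card_imset //; apply: le_trans.
rewrite ler_pM2l // ler_nat; apply: nedges_imset_le => //.
- exact: adj_sym.
- exact: adj_irrefl.
- exact: adj_sym.
- exact: adj_irrefl.
Qed.

Lemma nedges_induced G (A : {set G}) (W : {set induced A}) :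
  nedges (@adj (induced A)) W = nedges (@adj G) (val @: W).
Proof.
apply: nedges_imset => //; [exact: val_inj|exact: induced_adj_sym|exact: induced_adj_irrefl
  |exact: adj_sym|exact: adj_irrefl].
Qed.

Lemma induced_preim G (A W : {set G}) : W \subset A ->
  exists V : {set induced A}, val @: V = W.
Proof.
move=> sWA; exists [set x : induced A | val x \in W]; apply/setP => x.
apply/imsetP/idP => [[y + ->]|xW]; first by rewrite inE.
by exists (exist _ x (subsetP sWA x xW)); rewrite ?inE.
Qed.

Section Partition.
Context (k : nat) (k0 : (0 < k)%N).
Let b : R := 2 - 2 / (k%:R + 1).

Lemma part_bound (e n : nat) : (0 < n)%N ->
  (2 * e%:R < b * n%:R) = (k.+1 * e < k * n)%N.
Proof.
move=> n0; have k1 : 0 < k%:R + 1 :> R by rewrite ltr_wpDl.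
have -> : b = 2 * (k%:R / (k%:R + 1)) by rewrite /b; field; rewrite gt_eqF.
rewrite -mulrA ltr_pM2l // mulrAC ltr_pdivlMr // natr1 -!natrM ltr_nat.
by rewrite mulnC.
Qed.

(** An edge alone has average degree 1, so mad below 1 means independence. Since 2 - 2/(k + 1) =
    2k/(k + 1), the condition on the other part is positivity of [sigma] with all weights equal to
    1. *)
Lemma has_partitionP G : has_partition 1 b G <->
  exists X : {set G}, (forall x y, x \notin X -> y \notin X -> ~~ adj x y) /\
    forall S : {set G}, S \subset X -> S != set0 -> (k.+1 * nedges (@adj G) S < k * #|S|)%N.
Proof.
split=> [[A [B [AB dAB mA mB]]]|[X [iX gX]]].
  have notB x : x \notin B -> x \in A.
    by move=> xB; have := in_setT x; rewrite -AB inE (negbTE xB) orbF.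
  exists B; split=> [x y /notB xA /notB yA|S sS S0].
    apply/negP => xy; have xny : x != y by apply: contraTneq xy => ->; rewrite adj_irrefl.
    have sxy : [set x; y] \subset A by rewrite subUset !sub1set xA.
    have [V VE] := induced_preim sxy.
    have V0 : V != set0 by rewrite -(imset_eq0 (val : _ -> G)) VE; apply/set0Pn; exists x; rewrite !inE eqxx.
    have := mad_ge V0; rewrite nedges_induced VE -(card_imset _ val_inj) VE cards2 xny.
    rewrite nedgesU1 ?inE ?nedges1 ?ndeg_set1 ?xy //; try exact: adj_sym; try exact: adj_irrefl.
    by rewrite /= add0n; move: mA; move: (mad R _) => m; lra.
  have [V VE] := induced_preim sS.
  have V0 : V != set0 by rewrite -(imset_eq0 (val : _ -> G)) VE.
  have := mad_ge V0; rewrite nedges_induced VE -(card_imset _ val_inj) VE => le.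
  rewrite -part_bound ?card_gt0 //; apply: le_lt_trans le _.
  by rewrite ltr_pM2r // ltr0n card_gt0.
exists (~: X), X; split; first by rewrite setUC setUCr.
- by rewrite disjoints_subset.
- apply: mad_lt => // W W0; rewrite nedges_induced mul1r.
  have -> : nedges (@adj G) (val @: W) = 0%N.
    apply/eqP; rewrite cards_eq0; apply/eqP/setP => e; rewrite !inE.
    apply/negP => /andP[/imsetP[[x y]]]; rewrite inE /= => gxy -> sub.
    have out z : z \in [set x; y] -> z \notin X.
      by move/(subsetP sub)/imsetP => [w _ ->]; have := valP w; rewrite inE.
    by have := iX x y (out _ (set21 _ _)) (out _ (set22 _ _)); rewrite gxy.
  by rewrite mulr0 ltr0n card_gt0.
have b0 : 0 < b.
  have := part_bound 0 (n := 1); rewrite mulr0 mulr1 muln0 muln1 k0; exact.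
apply: mad_lt => // W W0; rewrite nedges_induced -(card_imset _ val_inj).
have fW0 : val @: W != set0 :> {set G} by rewrite imset_eq0.
rewrite part_bound ?card_gt0 //; apply: gX => //.
by apply/subsetP => _ /imsetP[w _ ->]; apply: valP.
Qed.
End Partition.

Lemma kpar_half (k : nat) : kpar k./2 (odd k) = k.
Proof. by rewrite /kpar mul2n addnC odd_double_half. Qed.

Lemma f_edgeC (k : nat) : (2 <= k)%N ->
  f R k = 3 - 3 / (edgeC k./2 (odd k))%:~R.
Proof.
move=> k2; rewrite /f -[in LHS](kpar_half k) /kpar; have h0 : (0 < k./2)%N by rewrite half_gt0.
have e (x : R) : x = (edgeC k./2 (odd k))%:~R -> 3 - 3 / x = 3 - 3 / (edgeC k./2 (odd k))%:~R.
  by move->.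
rewrite /edgeC; move: h0 (odd k) k./2 {e} => _ o h.
rewrite oddD mul2n odd_double oddb; case: o; rewrite /= ?addn1 ?addn0 ?muln1 ?muln0;
  congr (_ - _ / _); rewrite !rmorphB !rmorphD /= -mul2n -!pmulrn ?natrM ?natrD -?natr1 ?natrM; ring.
Qed.

(** Every vertex starts as U_0, of weight 1. The bound on mad is not strict, so a graph without
    partition has mad strictly above f(k), as the finite families in [is_g_tilde] require. *)
Lemma mad_le_f_partition (k : nat) G : (2 <= k)%N -> mad R G <= f R k ->
  has_partition (1 : R) (2 - 2 / (k%:R + 1)) G.
Proof.
move=> k2 mG; have h0 : (0 < k./2)%N by rewrite half_gt0.
apply/(has_partitionP (ltnW k2)).
set h := k./2 in h0; set o := odd k.
have E5 := edgeC_ge5 o h0; have I2 := indC2 o h0.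
pose ty (x : G) : vtype := (false, 0%N).
have c0 : cost h o 0 = 0 by rewrite cost_lin.
have [X [_ _ iX gX]] : colorable (kpar h o) (@adj G) ty [set: G].
  apply: sparse_colorable => //; [exact: adj_sym|exact: adj_irrefl|].
  move=> W _ W0; have := mad_ge W0.
  have W1 : 0 < #|W|%:R :> R by rewrite ltr0n card_gt0.
  move=> le1; have {le1} : 2 * (nedges (@adj G) W)%:R <= f R k * #|W|%:R.
    by apply: le_trans le1 _; rewrite ler_pM2r.
  rewrite f_edgeC // -/h -/o.
  have -> : rho h o (@adj G) ty W =
      (edgeC h o + indC h o) * #|W|%:Z - edgeC h o * (nedges (@adj G) W)%:Z.
    rewrite /rho /pot (eq_bigr (fun=> edgeC h o + indC h o)) => [|x _].
      by rewrite sumr_const -mulr_natr natz.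
    by rewrite /typeC /= c0 subr0.
  move: (nedges _ _) (#|W|) => e n le1.
  suff : (2 * (edgeC h o * e%:Z) <= (3 * edgeC h o - 3) * n%:Z).
    by move: I2; move: (edgeC h o) (indC h o) => E I I2 H; nia.
  have Er : 0 < (edgeC h o)%:~R :> R by rewrite ltr0z; move: E5; lia.
  move: (edgeC h o) Er le1 => E0 Er le1; rewrite -(ler_int R) !(intrM, intrB) -!pmulrn.
  move: (E0%:~R) Er le1 => E Er le1.
  have : E * (2 * e%:R) <= E * ((3 - 3 / E) * n%:R) by rewrite ler_pM2l.
  have -> : E * ((3 - 3 / E) * n%:R) = (3 * E - 3) * n%:R by field; rewrite gt_eqF.
  by lra.
exists X; split=> [x y xX yX|S sS S0]; first by apply: iX; rewrite !inE ?xX ?yX.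
have := gX S sS S0; rewrite sigmaE kpar_half.
have -> : (\sum_(v in S) wt (ty v))%N = #|S| by rewrite sum1_card.
by move: (nedges _ _) #|S| => e n; nia.
Qed.

End Mad.

(** * Sparse graphs without a partition *)

(* Block i of the chain consists of a triangle y x v and a path z w y, and v is
   joined to z of the next block. Pendant triangles (npend of them) make y, x and v
   heavy: if z is in the independent set then w is not, hence v is in the forest, in
   a component of weight k, hence z of the next block is in the independent set. In
   block 0 (where z and w are idle) and in the last block, one extra pendant
   triangle starts the chain and makes it end in a contradiction. *)
Inductive role := Rz | Rw | Ry | Rx | Rv.

Definition role_code (r : role) : option (bool * bool) :=
  match r with
  | Rz => None | Rw => Some (false, false) | Ry => Some (false, true)
  | Rx => Some (true, false) | Rv => Some (true, true)
  end.

Definition role_decode (c : option (bool * bool)) : role :=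
  match c with
  | None => Rz | Some (false, false) => Rw | Some (false, true) => Ry
  | Some (true, false) => Rx | Some (true, true) => Rv
  end.

Lemma role_codeK : cancel role_code role_decode. Proof. by case. Qed.

HB.instance Definition _ := Finite.copy role (can_type role_codeK).

Section Chain.
Context (h : nat) (o : bool) (n : nat).
Local Notation k := (kpar h o).

(** [None] marks a vertex of the block itself; [Some (c, b)] is end b of its c-th pendant triangle.
    Indices c from [npend] on yield isolated vertices, so that all blocks share one product type. *)
Definition chain_vertex : Type := ('I_n.+1 * role * option ('I_k.+1 * bool))%type.
HB.instance Definition _ := Finite.on chain_vertex.

Definition npend (i : nat) (r : role) : nat :=
  match r with
  | Ry => if i == 0%N then h else h.-1
  | Rx => (h.-1 + o)%N
  | Rv => (h.-1 + (i == n))%N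
  | _ => 0%N
  end.

Definition core_arc (i j : nat) (r s : role) : bool :=
  match r, s with
  | Rz, Rw => i == j
  | Rw, Ry => (i == j) && (0 < i)%N
  | Ry, Rx => i == j
  | Rx, Rv => i == j
  | Ry, Rv => i == j
  | Rv, Rz => j == i.+1
  | _, _ => false
  end.

Definition arc (u v : chain_vertex) : bool :=
  match u, v with
  | (i, r, None), (j, s, None) => core_arc i j r s
  | (i, r, None), (j, s, Some (c, _)) => [&& i == j, r == s & (c < npend i r)%N]
  | (i, r, Some (c, b)), (j, s, Some (d, b')) =>
      [&& i == j, r == s, c == d, (c < npend i r)%N, ~~ b & b']
  | _, _ => false
  end.

Lemma arc_asym u v : arc u v -> ~~ arc v u.
Proof.
case: u => [[i r] p]; case: v => [[j s] q] /=.
case: p => [[c b]|]; case: q => [[d b']|] //=.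
  by case/and5P=> _ _ _ _ /andP[/negbTE -> ->]; rewrite !andbF.
by case: r; case: s => //=; lia.
Qed.

Lemma arc_irr u : arc u u = false.
Proof. by apply/negP => a; have := arc_asym a; rewrite a. Qed.

Definition chain_adj (u v : chain_vertex) : bool := arc u v || arc v u.

Lemma chain_sym : symmetric chain_adj.
Proof. by move=> u v; rewrite /chain_adj orbC. Qed.

Lemma chain_irr : irreflexive chain_adj.
Proof. by move=> u; rewrite /chain_adj arc_irr. Qed.

Definition chain : sgraph := SGraph chain_sym chain_irr.

Lemma card_ord_lt (m d : nat) : (d <= m)%N -> #|[set c : 'I_m | (c < d)%N]| = d.
Proof.
by move=> dm; rewrite -sum1dep_card -(big_ord_widen m (fun _ => 1%N) dm) sum_nat_const card_ord muln1.
Qed.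

Lemma npend_le i r : (0 < h)%N -> (npend i r <= k)%N.
Proof.
move=> h0; rewrite kparE; have := leq_b1 (i == n); have := leq_b1 o.
by case: r => //=; [case: ifP| |]; lia.
Qed.

Section NotColorable.
Context (h0 : (0 < h)%N).
Context (X : {set chain}).
Context (iX : forall x y, x \notin X -> y \notin X -> ~~ chain_adj x y).
Context (gX : forall S : {set chain}, S \subset X -> S != set0 ->
  (k.+1 * nedges chain_adj S < k * #|S|)%N).

Definition cv (i : 'I_n.+1) (r : role) : chain := (i, r, None).

Lemma one_end x y : chain_adj x y -> x \notin X -> y \in X.
Proof. by move=> xy xX; apply: contraTT xy => yX; apply: iX. Qed.

Lemma chain_component b : b \in X -> exists C : {set chain},
  [/\ b \in C, (#|C| <= k)%N & forall x y, x \in C -> y \in X -> chain_adj x y -> y \in C].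
Proof.
move=> bX; have [C [sC bC cC oC]] := component chain_sym chain_irr bX; exists C; split=> //.
  have C0 : C != set0 by apply/set0Pn; exists b.
  by have := gX sC C0; move: cC; move: (nedges _ _) #|C| => e c; nia.
move=> x y xC yX xy; apply/negPn/negP => yC; have := oC y yX yC.
by have := @ndeg_gt0 _ chain_adj y x C xC; rewrite chain_sym xy => /(_ isT); lia.
Qed.

(** The two outer vertices of a pendant triangle are adjacent, so one of them is in X, and it
    belongs to the component of the apex. Each pendant triangle thus adds at least 1 to the size of
    that component; [sel] picks such a vertex. *)
Lemma fiber_card (C : {set chain}) i r :
  (forall x y, x \in C -> y \in X -> chain_adj x y -> y \in C) -> cv i r \in C ->
  (npend i r < #|[set x in C | x.1 == (i, r)]|)%N.
Proof.
move=> cl rC.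
pose sel (c : 'I_k.+1) : chain := (i, r, Some (c, (i, r, Some (c, true)) \in C)).
have pC (c : 'I_k.+1) : (c < npend i r)%N -> sel c \in C.
  move=> cp; rewrite /sel; have [//|tC] := boolP ((i, r, Some (c, true)) \in C).
  have adj b : chain_adj (cv i r) (i, r, Some (c, b)) by rewrite /chain_adj /= !eqxx cp.
  have tX : (i, r, Some (c, true)) \notin X by apply: contra tC => tX; apply: cl rC tX (adj _).
  apply: cl rC _ (adj false); apply: one_end tX.
  by rewrite /chain_adj /= !eqxx cp.
have sinj : injective sel by move=> c d [].
have := card_ord_lt (ltnW (npend_le i r h0 : npend i r < k.+1)%N).
rewrite -(card_imset _ sinj) => {1}<-.
have : cv i r |: [set sel x | x in [set c : 'I_k.+1 | (c < npend i r)%N]]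
    \subset [set x in C | x.1 == (i, r)].
  apply/subsetP => x; rewrite in_setU1 inE => /orP[/eqP ->|/imsetP[c]]; first by rewrite rC eqxx.
  by rewrite inE => cp ->; rewrite pC //= eqxx.
move/subset_leq_card; rewrite cardsU1 => le; apply: leq_trans le.
have -> : cv i r \notin [set sel x | x in [set c : 'I_k.+1 | (c < npend i r)%N]].
  by apply/negP => /imsetP[c _ []].
by rewrite add1n.
Qed.

Lemma heavy_component (C : {set chain}) (l : seq ('I_n.+1 * role)) :
  (forall x y, x \in C -> y \in X -> chain_adj x y -> y \in C) ->
  uniq l -> (forall ir, ir \in l -> cv ir.1 ir.2 \in C) -> (#|C| <= k)%N ->
  (\sum_(ir <- l) (npend ir.1 ir.2).+1 <= k)%N.
Proof.
move=> cl ul lC; apply: leq_trans.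
rewrite -[#|C|]sum1_card (partition_big (fun x : chain => x.1) predT) //=.
rewrite [leqRHS](bigID (mem l)) /=; apply: (leq_trans _ (leq_addr _ _)).
rewrite -(big_uniq _ ul) /=.
elim: l ul lC => [|ir l IH] /=; first by rewrite !big_nil.
move=> /andP[_ ul] lC; rewrite !big_cons leq_add ?IH // => [|ir' ir'l]; last first.
  by apply: lC; rewrite inE ir'l orbT.
rewrite sum1dep_card; have irC := lC ir (mem_head _ _).
by have := fiber_card cl irC; rewrite -surjective_pairing.
Qed.

(** The final clause means that block i alone fills the component of v with k vertices, or k + 1 in
    the last block. It yields a contradiction as soon as [l] is nonempty or i = n. *)
Lemma block_step (i : 'I_n.+1) : (0 < i)%N ==> (cv i Rw \in X) ->
  exists C : {set chain}, [/\ cv i Rv \in C, cv i Rv \in X, (#|C| <= k)%N,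
    (forall x y, x \in C -> y \in X -> chain_adj x y -> y \in C) &
    forall l, uniq l -> (forall ir, ir \in l -> (cv ir.1 ir.2 \in C) && (ir.1 != i)) ->
     (k + (i == n :> nat) + \sum_(ir <- l) (npend ir.1 ir.2).+1 <= k)%N].
Proof.
move=> wX.
have adj_xv : chain_adj (cv i Rx) (cv i Rv) by rewrite /chain_adj /= eqxx.
have adj_yv : chain_adj (cv i Ry) (cv i Rv) by rewrite /chain_adj /= eqxx.
have adj_yx : chain_adj (cv i Ry) (cv i Rx) by rewrite /chain_adj /= eqxx.
have adj_wy : (0 < i)%N -> chain_adj (cv i Rw) (cv i Ry) by rewrite /chain_adj /= eqxx => ->.
have inw (C : {set chain}) : (forall x y, x \in C -> y \in X -> chain_adj x y -> y \in C) ->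
    cv i Ry \in C -> (0 < i)%N -> cv i Rw \in C.
  move=> cl yC i0; move: wX; rewrite i0 /= => wX; apply: (cl _ _ yC wX).
  by rewrite chain_sym adj_wy.
have un (rs : seq role) : uniq rs -> uniq [seq (i, r) | r <- rs].
  by rewrite map_inj_uniq // => r s [].
have vX : cv i Rv \in X.
  apply/negPn/negP => vX.
  have yX : cv i Ry \in X by apply: (one_end _ vX); rewrite chain_sym.
  have xX : cv i Rx \in X by apply: (one_end _ vX); rewrite chain_sym.
  have [C [yC cC cl]] := chain_component yX.
  have xC : cv i Rx \in C by apply: cl yC xX adj_yx.
  have [i0|i0] := posnP i.
    have := @heavy_component C [:: (i, Ry); (i, Rx)] cl (un [:: Ry; Rx] isT) _ cC.
    rewrite !big_cons big_nil /= i0 eqxx kparE => H.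
    suff : (h.+1 + ((h.-1 + o).+1 + 0) <= 2 * h + o)%N by move: h0; lia0.
    by apply: H => ir; rewrite !inE => /orP[] /eqP ->.
  have wC := inw C cl yC i0.
  have := @heavy_component C [:: (i, Ry); (i, Rx); (i, Rw)] cl (un [:: Ry; Rx; Rw] isT) _ cC.
  rewrite !big_cons big_nil /= [i == 0%N :> nat]gtn_eqF // kparE => H.
  suff : (h.-1.+1 + ((h.-1 + o).+1 + (1 + 0)) <= 2 * h + o)%N by move: h0; lia0.
  by apply: H => ir; rewrite !inE => /or3P[] /eqP ->.
have [C [vC cC cl]] := chain_component vX; exists C; split=> // l ul lC.
have ext (l0 : seq ('I_n.+1 * role)) : uniq l0 ->
    (forall ir, ir \in l0 -> (cv ir.1 ir.2 \in C) && (ir.1 == i)) ->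
    (\sum_(ir <- l0) (npend ir.1 ir.2).+1 + \sum_(ir <- l) (npend ir.1 ir.2).+1 <= k)%N.
  move=> u0 h0'; rewrite -big_cat /=; apply: heavy_component cl _ _ cC.
    rewrite cat_uniq u0 ul andbT; apply/hasPn => ir /lC /andP[_ ne].
    by apply: contraNN ne => /h0' /andP[].
  by move=> ir; rewrite mem_cat => /orP[/h0'|/lC] /andP[].
move: (\sum_(ir <- l) (npend ir.1 ir.2).+1)%N ext => sl ext.
have [yX|yX] := boolP (cv i Ry \in X).
  have yC : cv i Ry \in C by apply: cl vC yX _; rewrite chain_sym.
  have [i0|i0] := posnP i.
    have := ext [:: (i, Rv); (i, Ry)] (un [:: Rv; Ry] isT); rewrite !big_cons big_nil /= i0 eqxx => H.
    suff : ((h.-1 + (0%N == n)).+1 + (h.+1 + 0) + sl <= k)%N by rewrite kparE; move: h0; lia0.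
    by apply: H => ir; rewrite !inE => /orP[] /eqP ->; rewrite /= ?vC ?yC eqxx.
  have wC := inw C cl yC i0.
  have := ext [:: (i, Rv); (i, Ry); (i, Rw)] (un [:: Rv; Ry; Rw] isT).
  rewrite !big_cons big_nil /= [i == 0%N :> nat]gtn_eqF // => H.
  suff : ((h.-1 + (i == n :> nat)).+1 + (h.-1.+1 + (1 + 0)) + sl <= k)%N by rewrite kparE; move: h0; lia0.
  by apply: H => ir; rewrite !inE => /or3P[] /eqP ->; rewrite /= ?vC ?yC ?wC eqxx.
have xX : cv i Rx \in X by apply: one_end yX.
have xC : cv i Rx \in C by apply: cl vC xX _; rewrite chain_sym.
have := ext [:: (i, Rv); (i, Rx)] (un [:: Rv; Rx] isT); rewrite !big_cons big_nil /= => H.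
suff : ((h.-1 + (i == n :> nat)).+1 + ((h.-1 + o).+1 + 0) + sl <= k)%N by rewrite kparE; move: h0; lia0.
by apply: H => ir; rewrite !inE => /orP[] /eqP ->; rewrite /= ?vC ?xC eqxx.
Qed.

Lemma chain_w (m : nat) (hm : (m < n.+1)%N) : (0 < m)%N -> cv (Ordinal hm) Rw \in X.
Proof.
elim: m hm => // m IH hm _; have hm' : (m < n.+1)%N by apply: ltnW.
have [|C [vC vX cC cl hC]] := @block_step (Ordinal hm').
  by apply/implyP => m0; apply: IH.
have zX : cv (Ordinal hm) Rz \notin X.
  apply/negP => zX; have zC : cv (Ordinal hm) Rz \in C.
    by apply: cl vC zX _; rewrite /chain_adj /= eqxx.
  have := hC [:: (Ordinal hm, Rz)] isT; rewrite big_cons big_nil /= => H.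
  suff : (k + (m == n) + (1 + 0) <= k)%N by lia0.
  by apply: H => ir; rewrite inE => /eqP ->; rewrite /= zC -val_eqE /= gtn_eqF.
by apply: (one_end _ zX); rewrite /chain_adj /= eqxx.
Qed.

Lemma chain_False : False.
Proof.
have [|C [_ _ _ _ hC]] := @block_step ord_max.
  by apply/implyP => n0; apply: chain_w.
have := hC [::] isT; rewrite big_nil /= eqxx => H.
by suff : (k + true + 0 <= k)%N; [lia0|apply: H].
Qed.
End NotColorable.

End Chain.

(** * Fractional orientations and the density of the chains *)

Section FractionalOrientation.
Context (R : realType) (T : finType) (g : rel T) (gs : symmetric g) (gi : irreflexive g).

(** Each edge distributes e between its ends, and no vertex receives more than L: a certificate
    bounding the density of all subsets at once. *)
Lemma orientation_density (F : T -> T -> R) (e L : R) (W : {set T}) :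
  (forall u v, g u v -> F u v + F v u = e) -> (forall u v, g u v -> 0 <= F u v) ->
  (forall u, \sum_(v | g u v) F u v <= L) ->
  e * (nedges g W)%:R <= L * #|W|%:R.
Proof.
move=> Fe F0 FL.
have dbl : 2 * (e * (nedges g W)%:R) = \sum_(u in W) \sum_(v in W | g u v) e.
  rewrite mulrCA -natrM -(handshake gs gi) natr_sum mulr_sumr; apply: eq_bigr => u _.
  by rewrite sumr_const mulr_natr; congr (_ *+ _); apply: eq_card => v; rewrite !inE.
have dbl2 : \sum_(u in W) \sum_(v in W | g u v) e =
    2 * \sum_(u in W) \sum_(v in W | g u v) F u v.
  have -> : \sum_(u in W) \sum_(v in W | g u v) e =
     \sum_(u in W) \sum_(v in W | g u v) (F u v + F v u).
    by apply: eq_bigr => u _; apply: eq_bigr => v /andP[_ guv]; rewrite Fe.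
  have -> : \sum_(u in W) \sum_(v in W | g u v) (F u v + F v u) =
     \sum_(u in W) \sum_(v in W | g u v) F u v + \sum_(u in W) \sum_(v in W | g u v) F v u.
    by rewrite -big_split; apply: eq_bigr => u _; rewrite big_split.
  have -> : \sum_(u in W) \sum_(v in W | g u v) F v u = \sum_(u in W) \sum_(v in W | g u v) F u v.
    rewrite (exchange_big_dep (mem W)) /=; last by move=> u v _ /andP[].
    by apply: eq_bigr => v vW; apply: eq_bigl => u; rewrite gs vW /= andbC.
  ring.
have : \sum_(u in W) \sum_(v in W | g u v) F u v <= \sum_(u in W) L.
  apply: ler_sum => u uW; apply: le_trans (FL u).
  rewrite [leRHS](bigID (mem W)) /= (eq_bigl (fun v => g u v && (v \in W))).
    by rewrite lerDl sumr_ge0 // => v /andP[guv _]; apply: F0.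
  by move=> v; rewrite andbC.
rewrite sumr_const -mulr_natr; move: dbl; rewrite dbl2; lra.
Qed.

Lemma sum_le_seq (F : T -> R) (l : seq T) : (forall v, 0 <= F v) ->
  (forall v, F v != 0 -> v \in l) -> \sum_v F v <= \sum_(v <- l) F v.
Proof.
move=> F0 Fl; rewrite (bigID (mem l)) /= [X in _ + X]big1 ?addr0; last first.
  by move=> v vl; apply/eqP; apply: contraNT vl => /Fl.
elim: l {Fl} => [|a l IH]; first by rewrite big_nil big_pred0.
rewrite big_cons; have [al|al] := boolP (a \in l).
  rewrite (eq_bigl (mem l)) => [|v]; first by apply: le_trans IH _; rewrite lerDr.
  by rewrite !inE; case: eqVneq => // ->.
rewrite (bigD1 a) ?inE ?eqxx //= lerD2l (eq_bigl (mem l)) // => v.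
by rewrite !inE; case: eqVneq => [->|]; rewrite ?andbF ?andbT ?(negbTE al).
Qed.
End FractionalOrientation.

Section ChainDensity.
Context (R : realType) (h : nat) (o : bool) (n : nat) (h0 : (0 < h)%N).
Local Notation k := (kpar h o).
Local Notation V := (chain_vertex h o n).
Local Notation hr := (h%:R : R).
Local Notation or := (o%:R : R).
Let E : R := 6 * hr + 2 * or - 1.
Let I : R := 3 * hr + or - 2.
Let tau (i : nat) : R := 3 * i%:R / n.+1%:R.

(* The share of an arc paid by its tail: each block passes tau i of the total
   excess 3, sitting at the last block, on to the preceding one. *)
Definition tail_share (u v : V) : R :=
  match u, v with
  | (i, r, None), (_, s, None) =>
      match r, s with
      | Rz, Rw => I + tau i
      | Rw, Ry => E - 3 + tau i
      | Ry, Rx => E / 2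
      | Rx, Rv => E / 2 + 1 - 2 * or
      | Ry, Rv => E / 2 - 2 + or + tau i
      | Rv, Rz => tau i.+1
      | _, _ => 0
      end
  | (_, _, None), (_, _, Some _) => 3 / 2
  | (_, _, Some _), (_, _, Some _) => E / 2
  | _, _ => 0
  end.

Definition share (u v : V) : R :=
  if arc u v then tail_share u v else if arc v u then E - tail_share v u else 0.

Let hr1 : 1 <= hr. Proof. by rewrite ler1n. Qed.
Let or01 : 0 <= or <= 1. Proof. by case: o; rewrite /= lexx ler01. Qed.
Let hE : 5 <= E /\ 2 * or + 5 <= E.
Proof. by have := hr1; have /andP[] := or01; rewrite /E; lra. Qed.
Let IE : 2 * I = E - 3. Proof. rewrite /I /E; lra. Qed.

Lemma tau_ge0 i : 0 <= tau i.
Proof. by rewrite /tau divr_ge0 // mulr_ge0. Qed.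

Lemma tau_le3 i : (i <= n.+1)%N -> tau i <= 3.
Proof.
move=> hi; rewrite /tau ler_pdivrMr ?ltr0n // ler_pM2l // ler_nat //.
Qed.

Lemma tau0 : tau 0 = 0. Proof. by rewrite /tau mulr0 mul0r. Qed.

Lemma tau_last : tau n.+1 = 3.
Proof. by rewrite /tau mulfK // pnatr_eq0. Qed.

Lemma tauS i : tau i.+1 = tau i + 3 / n.+1%:R.
Proof. by rewrite /tau -natr1; ring. Qed.

Lemma tail_share_bound u v : arc u v -> 0 <= tail_share u v <= E.
Proof.
have := hr1; have /andP[o0' o1'] := or01; have [E5 Eo] := hE; have := IE.
case: u => [[i r] p]; case: v => [[j s] q].
have := tau_ge0 i; have := tau_le3 (ltnW (ltn_ord i)).
have := tau_ge0 i.+1; have := tau_le3 (ltn_ord i).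
rewrite /arc /tail_share; case: p => [[c b]|]; case: q => [[d b']|] //=; try lra.
by case: r; case: s => //=; lra.
Qed.

Lemma shareD (u v : V) : chain_adj u v -> share u v + share v u = E.
Proof.
rewrite /chain_adj /share => /orP[] a; rewrite a (negbTE (arc_asym a)); ring.
Qed.

Lemma share_ge0 (u v : V) : 0 <= share u v.
Proof.
rewrite /share; case: ifP => [/tail_share_bound/andP[]//|_].
by case: ifP => [/tail_share_bound/andP[_]|//]; rewrite subr_ge0.
Qed.

Lemma share_out (u v : V) : ~~ chain_adj u v -> share u v = 0.
Proof. by rewrite /chain_adj negb_or /share => /andP[/negbTE -> /negbTE ->]. Qed.

Let pends i r : seq V := [seq (i, r, Some p) | p <- enum {: 'I_k.+1 * bool}].

(** The apex pays 3/2 on each of its two edges to a pendant triangle. The outer vertices are then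
    left with E - 3/2 and E/2, which is exactly E + I. *)
Lemma pendant_load i r (l : seq V) (B : R) :
  (forall v, chain_adj ((i, r, None) : V) v -> v.2 = None -> v \in l) ->
  \sum_(v <- l) share (i, r, None) v <= B ->
  \sum_(v | chain_adj ((i, r, None) : V) v) share (i, r, None) v <= B + 3 * (npend h o n i r)%:R.
Proof.
move=> hl hB; rewrite big_mkcond /=.
have -> : \sum_v (if chain_adj ((i, r, None) : V) v then share (i, r, None) v else 0) =
   \sum_v share (i, r, None) v.
  by apply: eq_bigr => v _; case: ifP => // /negbT /share_out ->.
apply: le_trans (@sum_le_seq _ _ _ (l ++ pends i r) _ _) _.
- by move=> v; apply: share_ge0.
- move=> v nz; have adj : chain_adj ((i, r, None) : V) v.
    by apply: contraNT nz => /share_out ->.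
  rewrite mem_cat; case: v adj {nz} => [[j s] [p|]] adj; last by rewrite hl.
  apply/orP; right; have : (i == j) && (r == s).
    by move: adj; rewrite /chain_adj /=; case: p => c b; rewrite orbF => /and3P[-> ->].
  by case/andP=> /eqP <- /eqP <-; apply: map_f; rewrite mem_enum.
rewrite big_cat /=; apply: lerD => //.
rewrite /pends big_map big_enum /=.
have -> : \sum_(p : 'I_k.+1 * bool) share (i, r, None) (i, r, Some p) =
    \sum_(c : 'I_k.+1) \sum_(b : bool) (if (c < npend h o n i r)%N then 3 / 2 else 0).
  rewrite pair_big /=; apply: eq_bigr => -[c b] _.
  by rewrite /share /= !eqxx /=.
rewrite -[in leRHS](card_ord_lt (ltnW (npend_le o n i r h0 : (npend h o n i r < k.+1)%N))).
rewrite -sum1_card natr_sum mulr_sumr [leRHS]big_mkcond /=; apply: ler_sum => c _.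
rewrite sumr_const card_bool inE; case: ifP => _; last by rewrite mul0rn.
by rewrite -mulr_natr; lra.
Qed.

Let hn : 0 < n.+1%:R :> R. Proof. by rewrite ltr0n. Qed.

(** The shares are solved so that z, w, y, x receive at most E + I, while v also receives tau i.+1 -
    tau i = 3/(n + 1). In block 0 the extra pendant at y replaces the missing share 3 of its edge to
    w; in the last block the one at v replaces the missing tau n.+1 = 3. *)
Lemma load u : \sum_(v | chain_adj (u : V) v) share u v <= E + I + 3 / n.+1%:R.
Proof.
have r1 := hr1; have /andP[o0' o1'] := or01; have [E5 Eo] := hE; have IE' := IE.
have EE : E = 6 * hr + 2 * or - 1 by [].
have II : I = 3 * hr + or - 2 by [].
have d0 : 0 < 3 / n.+1%:R :> R by rewrite divr_gt0.
have [dn dE] : exists x, x = 3 / n.+1%:R :> R by exists (3 / n.+1%:R).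
rewrite -dE in d0 *.
have hpred : (h.-1)%:R = hr - 1 by rewrite -subn1 natrB.
case: u => [[i r] [[c b]|]].
  rewrite big_mkcond /=.
  have -> : \sum_v (if chain_adj ((i, r, Some (c, b)) : V) v then share (i, r, Some (c, b)) v else 0) =
     \sum_v share (i, r, Some (c, b)) v.
    by apply: eq_bigr => v _; case: ifP => // /negbT /share_out ->.
  apply: le_trans (@sum_le_seq _ _ _ [:: (i, r, None); (i, r, Some (c, ~~ b))] _ _) _.
  - by move=> v; apply: share_ge0.
  - move=> v nz; have : chain_adj ((i, r, Some (c, b)) : V) v.
      by apply: contraNT nz => /share_out ->.
    case: v {nz} => [[j s] [[d b']|]]; rewrite /chain_adj /= !inE.
      by case/orP => /and5P[/eqP -> /eqP -> /eqP -> _ /andP[]];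
        case: b; case: b' => //= _ _; rewrite eqxx orbT.
    by case/and3P=> /eqP -> /eqP -> _; rewrite eqxx.
  rewrite !big_cons big_nil /share /= !eqxx /=.
  by case: (c < _)%N; case: b => /=; lra.
have t0 := tau_ge0 i; have tS := tauS i; have t3 := tau_le3 (ltnW (ltn_ord i)).
rewrite -dE in tS.
have adjE (j : 'I_n.+1) s t : chain_adj ((i, s, None) : V) (j, t, None) =
   core_arc i j s t || core_arc j i t s by [].
have shB s (j : 'I_n.+1) t (B : R) : 0 <= B -> (core_arc i j s t -> tail_share (i, s, None) (j, t, None) <= B) ->
    (core_arc j i t s -> E - tail_share (j, t, None) (i, s, None) <= B) ->
    share (i, s, None) (j, t, None) <= B.
  move=> B0 h1 h2; rewrite /share.
  by case: ifP => [|_]; [apply: h1|case: ifP => [|_ //]; apply: h2].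
have I0 : 0 <= I by move: r1 o0'; rewrite II; lra.
case: r.
- have := @pendant_load i Rz [:: (i, Rw, None); (inord i.-1, Rv, None)] ((I + tau i) + (E - tau i)).
  rewrite mulr0 addr0 => /(_ _ _) H; apply: le_trans (H _ _) _.
  + case=> [[j s] [p|]] // + _; rewrite adjE !inE; case: s => //=.
      by rewrite orbF => /eqP/val_inj ->; rewrite eqxx.
    move=> /eqP ij; have -> : j = inord i.-1 by apply/val_inj; rewrite /= inordK ij //=; exact: ltnW.
    by rewrite eqxx orbT.
  + rewrite !big_cons big_nil addr0; apply: lerD; apply: shB => //=; try lra.
    by move=> /eqP <-; lra.
  lra.
- have := @pendant_load i Rw [:: (i, Rz, None); (i, Ry, None)] ((E - (I + tau i)) + (E - 3 + tau i)).
  rewrite mulr0 addr0 => /(_ _ _) H; apply: le_trans (H _ _) _.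
  + case=> [[j s] [p|]] // + _; rewrite adjE !inE; case: s => //=.
      by move/eqP/val_inj ->; rewrite eqxx.
    by rewrite orbF => /andP[/eqP/val_inj -> _]; rewrite eqxx orbT.
  + by rewrite !big_cons big_nil addr0; apply: lerD; apply: shB => //= *; lra.
  lra.
- have pB : (npend h o n i Ry)%:R = (if i == 0%N :> nat then hr else hr - 1).
    by rewrite /npend; case: ifP.
  have := @pendant_load i Ry [:: (i, Rw, None); (i, Rx, None); (i, Rv, None)]
    ((if i == 0%N :> nat then 0 else 3 - tau i) + (E / 2 + (E / 2 - 2 + or + tau i))).
  rewrite pB => /(_ _ _) H; apply: le_trans (H _ _) _.
  + case=> [[j s] [p|]] // + _; rewrite adjE !inE; case: s => //=.
    * by move/andP => [/eqP/val_inj -> _]; rewrite eqxx.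
    * by rewrite orbF => /eqP/val_inj ->; rewrite eqxx orbT.
    * by rewrite orbF => /eqP/val_inj ->; rewrite eqxx !orbT.
  + rewrite !big_cons big_nil addr0; apply: lerD; last by apply: lerD; apply: shB => //= *; lra.
    apply: shB => //=; first by case: ifP => // _; lra.
    by move=> /andP[_ i0]; rewrite gtn_eqF //; lra.
  have : i == 0%N :> nat -> tau i = 0 by move/eqP ->; apply: tau0.
  by case: ifP => _ => [/(_ isT)|_]; lra.
- have pB : (npend h o n i Rx)%:R = hr - 1 + or by rewrite /npend natrD hpred.
  have := @pendant_load i Rx [:: (i, Ry, None); (i, Rv, None)] ((E - E / 2) + (E / 2 + 1 - 2 * or)).
  rewrite pB => /(_ _ _) H; apply: le_trans (H _ _) _.
  + case=> [[j s] [p|]] // + _; rewrite adjE !inE; case: s => //=.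
      by move/eqP/val_inj ->; rewrite eqxx.
    by rewrite orbF => /eqP/val_inj ->; rewrite eqxx orbT.
  + by rewrite !big_cons big_nil addr0; apply: lerD; apply: shB => //= *; lra.
  lra.
have pB : (npend h o n i Rv)%:R = hr - 1 + (i == n :> nat)%:R by rewrite /npend natrD hpred.
(* For i = n the index i.+1 is out of range and [inord] returns block 0; no arc from v ends at its
   z, so that share is 0. *)
have := @pendant_load i Rv [:: (i, Rx, None); (i, Ry, None); (inord i.+1, Rz, None)]
  ((E - (E / 2 + 1 - 2 * or)) + ((E - (E / 2 - 2 + or + tau i)) + (if i == n :> nat then 0 else tau i.+1))).
rewrite pB => /(_ _ _) H; apply: le_trans (H _ _) _.
+ case=> [[j s] [p|]] // + _; rewrite adjE !inE; case: s => //=.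
  * rewrite orbF => /eqP ij; have -> : j = inord i.+1 by apply/val_inj; rewrite /= inordK -ij //.
    by rewrite eqxx !orbT.
  * by move/eqP/val_inj ->; rewrite eqxx orbT.
  * by move/eqP/val_inj ->; rewrite eqxx.
+ rewrite !big_cons big_nil addr0; apply: lerD; first by apply: shB => //= *; lra.
  apply: lerD; first by apply: shB => //= *; lra.
  apply: shB => //=; first by case: ifP => // _; apply: tau_ge0.
  move=> /eqP e'; rewrite ifN //; apply: contraTneq (ltn_ord (inord i.+1 : 'I_n.+1)) => e.
  by rewrite e' e ltnn.
have : i == n :> nat -> tau i.+1 = 3 by move/eqP ->; apply: tau_last.
by case: (i == n :> nat) => [/(_ isT)|_] /=; rewrite ?mulr1n ?mulr0n; lra.
Qed.

Lemma chain_density (W : {set chain h o n}) :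
  E * (nedges (@chain_adj h o n) W)%:R <= (E + I + 3 / n.+1%:R) * #|W|%:R.
Proof.
apply: (orientation_density (@chain_sym h o n) (@chain_irr h o n)); first exact: shareD.
  by move=> u v _; apply: share_ge0.
exact: load.
Qed.
End ChainDensity.

Lemma chain_mad (R : realType) (h : nat) (o : bool) (n : nat) : (0 < h)%N ->
  mad R (chain h o n) <= 3 - 3 / (edgeC h o)%:~R + 6 / n.+1%:R.
Proof.
move=> h0; have E5 := edgeC_ge5 o h0.
have Er : (edgeC h o)%:~R = 6 * h%:R + 2 * o%:R - 1 :> R.
  by rewrite /edgeC intrB intrD -!pmulrn !natrM.
have : 5 <= (edgeC h o)%:~R :> R by rewrite -[5]/(5%:~R) ler_int.
set e := _%:~R in Er *; move=> e5.
have d0 : 0 < 6 / n.+1%:R :> R by rewrite divr_gt0 ?ltr0n.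
have e35 : 3 / e <= 3 / 5 by rewrite ler_pM2l // lef_pV2 // posrE; lra.
apply: mad_le; first by move: d0 e35; move: (3 / e) (6 / _) => a b; lra.
move=> W W0; have := @chain_density R h o n h0 W; rewrite -Er => le1.
have e0 : 0 < e by lra.
rewrite -(ler_pM2l e0).
have -> : e * (2 * (nedges (@adj (chain h o n)) W)%:R) = 2 * (e * (nedges (@chain_adj h o n) W)%:R).
  by rewrite mulrCA.
apply: le_trans (_ : 2 * ((e + (3 * h%:R + o%:R - 2) + 3 / n.+1%:R) * #|W|%:R) <= _).
  by rewrite ler_pM2l.
rewrite !mulrA ler_wpM2r //.
have fe x : e * (3 - 3 / e + x) = 3 * e - 3 + e * x by field; rewrite gt_eqF.
rewrite fe.
have : 1 * (6 / n.+1%:R) <= e * (6 / n.+1%:R) by rewrite ler_wpM2r ?ltW //; lra.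
have -> : 6 / n.+1%:R = 2 * (3 / n.+1%:R) :> R by ring.
by move: (3 / n.+1%:R) => d; lra.
Qed.

(** * Sharpness and the two extremal values *)

Lemma chain_not_partition (R : realType) (k n : nat) : (2 <= k)%N ->
  ~ has_partition (1 : R) (2 - 2 / (k%:R + 1)) (chain k./2 (odd k) n).
Proof.
move=> k2 /(has_partitionP _ (ltnW k2)) [X [iX gX]].
by apply: (@chain_False k./2 (odd k) n _ X); rewrite ?half_gt0 // kpar_half.
Qed.

Lemma sharp_example (R : realType) (k : nat) (y : R) : (2 <= k)%N -> f R k < y ->
  exists G : sgraph, mad R G < y /\ ~ has_partition (1 : R) (2 - 2 / (k%:R + 1)) G.
Proof.
move=> k2 fy; have d0 : 0 < y - f R k by rewrite subr_gt0.
pose n := Num.bound (6 / (y - f R k)).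
exists (chain k./2 (odd k) n); split; last exact: chain_not_partition.
have h0 : (0 < k./2)%N by rewrite half_gt0.
apply: le_lt_trans (chain_mad R (odd k) n h0) _; rewrite -f_edgeC // -ltrBrDl.
rewrite ltr_pdivrMr ?ltr0n // mulrC -ltr_pdivrMr //.
apply: lt_trans (archi_boundP _) _; first by rewrite divr_ge0 // ltW.
by rewrite ltr_nat.
Qed.

Theorem mainTheorem5 (R : realType) (k : nat) (hk : (2 <= k)%N) :
  is_g (1 : R) (2 - 2 / (k%:R + 1)) (f R k) /\
  is_g_tilde (1 : R) (2 - 2 / (k%:R + 1)) (f R k).
Proof.
split; split.
- by move=> G mG; apply: mad_le_f_partition hk (ltW mG).
- move=> y hy; rewrite leNgt; apply/negP => fy.
  by have [G [mG nG]] := sharp_example hk fy; apply: nG; apply: hy.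
- exists 0%N, (fun=> chain 0 false 0); split.
    by case.
  by move=> G mG _; apply: mad_le_f_partition hk (ltW mG).
move=> y [n [F [nF hy]]]; rewrite leNgt; apply/negP => fy.
(* Below this threshold a graph contains no F i, since mad is monotone under subgraphs. The initial
   value y keeps the threshold within reach of [hy] and covers an empty family. *)
have fy' : f R k < \big[Num.min/y]_(i < n) mad R (F i).
  apply: lt_bigmin => // i _; rewrite ltNge; apply/negP => le.
  exact: nF i (mad_le_f_partition hk le).
have [G [mG nG]] := sharp_example hk fy'.
apply: nG; apply: hy => [|i /(mad_subgraph R) le].
  exact: lt_le_trans mG (bigmin_le_id _ _ _ _).
have := lt_le_trans mG (bigmin_le_cond _ (fun i => mad R (F i)) (erefl : predT i)).
by rewrite ltNge le.
Qed.
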